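(* For the Hurwitz zeta-function and $0<\delta\le0.05$, $$\delta^{\frac{7}{6\delta}}10^{-\frac9\delta}\ \le\ \inf_{0<\alpha\le1}\ \inf_{T\in\mathbb{R}}\int_T^{T+\delta}|\zeta(1+it,\alpha)|\,dt\ \le\ \frac{e^{-\gamma}\pi^2}{24}\,\delta^2+O(\delta^4),$$ where the implied constant is absolute.
   Context: $\zeta(s,\alpha)$ is the Hurwitz zeta-function, $\zeta(s,\alpha)=\sum_{n=0}^\infty(n+\alpha)^{-s}$ for $\operatorname{Re}(s)>1$, continued analytically to $\mathbb{C}\setminus\{1\}$ (simple pole at $s=1$; the integral is $+\infty$ when $0\in[T,T+\delta]$). $\gamma$ is Euler's constant. *)

(* Defs.v *)
From HB Require Import structures.
From mathcomp Require Import all_boot all_order all_algebra.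
From mathcomp Require Import complex.
From mathcomp Require Import all_classical all_reals all_analysis.

Set Implicit Arguments.
Unset Strict Implicit.
Unset Printing Implicit Defensive.

Import Order.TTheory GRing.Theory Num.Theory.
Import numFieldNormedType.Exports.

Local Open Scope classical_set_scope.
Local Open Scope ring_scope.
Local Open Scope complex_scope.

(* [R[i]^o] is the complex field viewed as a normed space over itself: it
   carries the topology of C, and [derivable f s 1] on it means that f has a
   complex derivative at s. *)
Notation "R [i]^o" := (GRing.regular (R[i]))
  (at level 1, left associativity, format "R [i]^o") : type_scope.

Definition cexp (R : realType) (z : R[i]) : R[i] :=
  (expR (complex.Re z) * cos (complex.Im z)) +i* (expR (complex.Re z) * sin (complex.Im z)).

(* Meaningful for a > 0 only; uses the real logarithm of a. *)
Definition rpowc (R : realType) (a : R) (z : R[i]) : R[i] :=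
  cexp (z * (ln a)%:C).

(* The value f 1 at the pole is left unconstrained.  The two conditions
   determine f on the rest of the plane, by the identity theorem. *)
Definition is_hurwitz_zeta (R : realType) (alpha : R)
    (f : R[i]^o -> R[i]^o) : Prop :=
  (forall s : R[i]^o, 1 < complex.Re s ->
     (fun N : nat =>
        \sum_(0 <= n < N) rpowc (n%:R + alpha) (- s) : R[i]^o) @ \oo --> f s)
  /\ (forall s : R[i]^o, s != 1 -> derivable f s 1).

Definition euler_gamma (R : realType) : R :=
  limn (fun n : nat => (\sum_(1 <= k < n.+1) k%:R^-1) - ln n%:R : R).

(* The integral over [T, T + delta] of |f(1 + it)|, as a Lebesgue integral in
   the extended reals.  For a Hurwitz zeta-function it is +oo as soon as
   0 lies in [T, T + delta], because of the simple pole at 1; the value f 1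
   does not matter since {0} is a null set. *)
Definition line1_integral (R : realType) (f : R[i]^o -> R[i]^o)
    (delta T : R) : \bar R :=
  (\int[lebesgue_measure]_(t in `[T, (T + delta)%R])
     (Normc.normc (f (1 +i* t)%R))%:E)%E.

(* Main.v *)
Require Import Defs.
From Stdlib Require Import ZArith.
From HB Require Import structures.
From mathcomp Require Import all_boot all_order all_algebra.
From mathcomp Require Import complex.
From mathcomp Require Import all_classical all_reals all_analysis.
From mathcomp Require Import measurable_realfun.
From mathcomp Require Import ssrZ zify ring lra.

Set Implicit Arguments.
Unset Strict Implicit.
Unset Printing Implicit Defensive.

Import Order.TTheory GRing.Theory Num.Theory.
Import numFieldNormedType.Exports.

Local Open Scope classical_set_scope.
Local Open Scope ring_scope.

(** Both bounds rest on one approximation of [zeta (s, alpha)], valid on the closed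
    half-plane [Re s >= 1]: a partial sum of the Dirichlet series plus a boundary
    term ([hz_approx]). Its error is a sum of local errors of a corrected midpoint
    rule, of order [|t| ^ 4 / N ^ 4] ([zeta_approx]). On the line it is
    obtained by letting the abscissa decrease to 1, so that all that is used of the
    function there is its continuity.

    Lower bound. When the interval contains 0, the pole makes the integral at least
    1/4 ([line1_integral_ge_pole]). Otherwise the partial sums [P] are tested
    against a nonnegative weight [W] on the interval: the integral of [|P|] is at
    least that of [W * Re (w * P)], divided by the maximum of [W], for any [w] of
    modulus 1. If the phase of [w] is affine in [t], the frequencies
    [ln (n + alpha)] are shifted together, to [B] and above, say. The weight of
    [weight_exists], on an interval of length [d = 2 r], responds to the
    frequency [y] as the parabola [(r ^ 2 - (t - c) ^ 2) ^ 2] does to the frequency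
    [sqrt (y ^ 2 - (a / r) ^ 2)]. So with [B] just above [a / r] the first term is
    seen in full, and the [n]-th one is damped by a multiple of
    [(ln n) ^ (- 3 / 2)]. Since [1 / (n (ln n) ^ (3 / 2))] has a convergent sum, the
    first term wins as soon as [a] is a large enough multiple of [1 / d], and
    [a = 47 / (2 d)] will do ([partial_sum_segint]). The loss is the factor
    [exp (- a)] from the maximum of the weight, and the result exceeds the claimed
    bound ([lower_bound_numeric]).

    Upper bound. The function [|zeta (1 + i t, alpha)|] has an exact zero [T] for some
    [alpha], near which it is at most [s * |t - T|] with
    [s / 4 <= exp (- gamma) * pi ^ 2 / 24] ([zeta_zero], [slope_lt]). The integral
    over an interval of length [d] centered at [T] is then at most [s / 4 * d ^ 2]
    when [d] is small, and for other [d] a constant multiple of [d ^ 4] absorbs it.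
    The zero lies near [alpha = 0.960928847], [T = 304.271724], where the modulus of
    the derivative in [t] is about 0.9001, while [exp (- gamma) * pi ^ 2 / 6] is about
    0.9236. Two real parameters against one complex equation: a simplified Newton
    iteration is a contraction of a small box ([newton_zero]), provided that the
    function is small at the center and has increments close to those of an
    invertible linear map. For [hz_approx] with 1000 terms this is checked by a
    computation with balls in binary fixed point ([zeta_evalP], [center_check],
    [box_check]). The error of the approximation is itself small, and its increments
    are too, since each local error is linear in the summed function
    ([zeta_error_lipschitz_t], [zeta_error_lipschitz_alpha]). *)

Local Notation normc := (@Normc.normc _).
Local Notation Re := (@complex.Re _).
Local Notation Im := (@complex.Im _).

(** * Modulus of a complex number *)

Section Modulus.
Context {R : realType}.
Implicit Types z w : R[i].

Lemma normcE z : `|z| = ((normc z)%:C)%C.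
Proof. by case: z. Qed.

Lemma sqr_normcE z : normc z ^+ 2 = Re z ^+ 2 + Im z ^+ 2.
Proof. by case: z => a b /=; rewrite sqr_sqrtr // addr_ge0 ?sqr_ge0. Qed.

Lemma normc_ge0 z : 0 <= normc z.
Proof. by case: z => a b; exact: sqrtr_ge0. Qed.

Lemma ReM z w : Re (z * w) = Re z * Re w - Im z * Im w.
Proof. by case: z w => [a b] [c d]. Qed.

Lemma ImM z w : Im (z * w) = Re z * Im w + Im z * Re w.
Proof. by case: z w => [a b] [c d]. Qed.

Lemma ReD z w : Re (z + w) = Re z + Re w.
Proof. by case: z w => [a b] [c d]. Qed.

Lemma ImD z w : Im (z + w) = Im z + Im w.
Proof. by case: z w => [a b] [c d]. Qed.

Lemma ReN z : Re (- z) = - Re z.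
Proof. by case: z. Qed.

Lemma ImN z : Im (- z) = - Im z.
Proof. by case: z. Qed.

Lemma ReB z w : Re (z - w) = Re z - Re w.
Proof. by rewrite ReD ReN. Qed.

Lemma ImB z w : Im (z - w) = Im z - Im w.
Proof. by rewrite ImD ImN. Qed.

Definition ReImE := (ReM, ImM, ReB, ImB, ReD, ImD, ReN, ImN).

Lemma complex_ext z w : Re z = Re w -> Im z = Im w -> z = w.
Proof. by case: z w => [a b] [c d] /= -> ->. Qed.

Lemma abs_Re_le_normc z : `|Re z| <= normc z.
Proof.
rewrite -(ler_pXn2r (n:=2)) ?nnegrE ?normr_ge0 ?normc_ge0 //.
by rewrite sqr_normcE real_normK ?num_real // lerDl sqr_ge0.
Qed.

Lemma abs_Im_le_normc z : `|Im z| <= normc z.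
Proof.
rewrite -(ler_pXn2r (n:=2)) ?nnegrE ?normr_ge0 ?normc_ge0 //.
by rewrite sqr_normcE real_normK ?num_real // lerDr sqr_ge0.
Qed.

Lemma Re_le_normc z : Re z <= normc z.
Proof. exact: le_trans (ler_norm _) (abs_Re_le_normc z). Qed.

Lemma normc_real (x : R) : normc ((x%:C)%C) = `|x|.
Proof. by rewrite /= expr0n addr0 sqrtr_sqr. Qed.

Lemma normc_im (x : R) : normc (Complex 0 x) = `|x|.
Proof. by rewrite /= expr0n add0r sqrtr_sqr. Qed.

Lemma normcB z w : normc (z - w) = normc (w - z).
Proof. by rewrite -opprB normcN. Qed.

Lemma ler_normcB z w : normc (z - w) <= normc z + normc w.
Proof. by apply: le_trans (le_normcD _ _) _; rewrite normcN. Qed.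

Lemma ler_normcBr z w : normc z - normc w <= normc (z - w).
Proof.
rewrite lerBlDr; apply: le_trans (le_normcD _ _).
by rewrite subrK.
Qed.

Lemma normc_le_abs z : normc z <= `|Re z| + `|Im z|.
Proof.
rewrite -(ler_pXn2r (n:=2)) ?nnegrE ?addr_ge0 ?normr_ge0 ?normc_ge0 //.
rewrite sqr_normcE sqrrD !real_normK ?num_real //.
by rewrite addrAC lerDl mulrn_wge0 // mulr_ge0.
Qed.

Lemma Re_sum (I : Type) (r : seq I) (P : pred I) (F : I -> R[i]) :
  Re (\sum_(i <- r | P i) F i) = \sum_(i <- r | P i) Re (F i).
Proof. by elim/big_rec2: _ => // i y1 y2 _ <-; rewrite ReD. Qed.

Lemma dot_le_normc z w : Re z * Re w + Im z * Im w <= normc z * normc w.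
Proof.
have -> : Re z * Re w + Im z * Im w = Re (z * conjc w).
  by case: z w => [a b] [c d] /=; rewrite mulrN opprK.
apply: le_trans (Re_le_normc _) _; rewrite Normc.normcM.
by case: w => a b /=; rewrite sqrrN.
Qed.

End Modulus.

(** * Derivatives of complex-valued functions of a real variable *)

Section ComplexDerivative.
Context {R : realType}.
Implicit Types (F G : R -> R[i]) (x : R).

(** Coordinatewise, since the variable is real while the derivative is a
    complex number. *)
Definition Cderiv F x (d : R[i]) :=
  is_derive x 1 (fun y => Re (F y)) (Re d) /\
  is_derive x 1 (fun y => Im (F y)) (Im d).

Lemma Cderiv_eq F x d e : Cderiv F x d -> d = e -> Cderiv F x e.
Proof. by move=> h <-. Qed.

Lemma CderivC (c : R[i]) x : Cderiv (fun _ => c) x 0.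
Proof. by split; exact: is_derive_cst. Qed.

Lemma CderivD F G x d e :
  Cderiv F x d -> Cderiv G x e -> Cderiv (fun y => F y + G y) x (d + e).
Proof.
move=> [h1 h2] [k1 k2]; split.
  have -> : (fun y => Re (F y + G y)) = (fun y => Re (F y)) + (fun y => Re (G y)).
    by apply/funext => y; rewrite ReD.
  by rewrite ReD; exact: is_deriveD.
have -> : (fun y => Im (F y + G y)) = (fun y => Im (F y)) + (fun y => Im (G y)).
  by apply/funext => y; rewrite ImD.
by rewrite ImD; exact: is_deriveD.
Qed.

Lemma CderivN F x d : Cderiv F x d -> Cderiv (fun y => - F y) x (- d).
Proof.
move=> [h1 h2]; split.
  have -> : (fun y => Re (- F y)) = - (fun y => Re (F y)).
    by apply/funext => y; rewrite ReN.
  by rewrite ReN; exact: is_deriveN.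
have -> : (fun y => Im (- F y)) = - (fun y => Im (F y)).
  by apply/funext => y; rewrite ImN.
by rewrite ImN; exact: is_deriveN.
Qed.

Lemma CderivB F G x d e :
  Cderiv F x d -> Cderiv G x e -> Cderiv (fun y => F y - G y) x (d - e).
Proof. by move=> h k; apply: CderivD => //; exact: CderivN. Qed.

Lemma CderivM F G x d e :
  Cderiv F x d -> Cderiv G x e ->
  Cderiv (fun y => F y * G y) x (d * G x + F x * e).
Proof.
move=> [h1 h2] [k1 k2]; split.
  have -> : (fun y => Re (F y * G y)) =
     (fun y => Re (F y)) * (fun y => Re (G y)) -
     (fun y => Im (F y)) * (fun y => Im (G y)).
    by apply/funext => y; rewrite ReM.
  have p := is_deriveM h1 k1; have q := is_deriveM h2 k2.
  apply: (is_derive_eq (is_deriveB p q)).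
  by rewrite !(ReD, ReM, ImM) /GRing.scale /=; ring.
have -> : (fun y => Im (F y * G y)) =
     (fun y => Re (F y)) * (fun y => Im (G y)) +
     (fun y => Im (F y)) * (fun y => Re (G y)).
  by apply/funext => y; rewrite ImM.
have p := is_deriveM h1 k2; have q := is_deriveM h2 k1.
apply: (is_derive_eq (is_deriveD p q)).
by rewrite !(ImD, ReM, ImM) /GRing.scale /=; ring.
Qed.

Lemma CderivMl (c : R[i]) F x d :
  Cderiv F x d -> Cderiv (fun y => c * F y) x (c * d).
Proof.
move=> h; apply: Cderiv_eq (CderivM (CderivC c x) h) _.
by rewrite mul0r add0r.
Qed.

Lemma Cderiv_real (f : R -> R) x d :
  is_derive x 1 f d -> Cderiv (fun y => ((f y)%:C)%C) x ((d%:C)%C).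
Proof. by move=> h; split => //=; exact: is_derive_cst. Qed.

Lemma Cderiv_sum (I : Type) (r : seq I) (F : I -> R -> R[i]) (d : I -> R[i]) x :
  (forall i, Cderiv (F i) x (d i)) ->
  Cderiv (fun y => \sum_(i <- r) F i y) x (\sum_(i <- r) d i).
Proof.
move=> h; elim: r => [|i r ih].
  rewrite big_nil; have -> : (fun y => \sum_(i <- [::]) F i y) = (fun=> 0).
    by apply/funext => y; rewrite big_nil.
  exact: CderivC.
rewrite big_cons; have -> : (fun y => \sum_(j <- i :: r) F j y) =
    (fun y => F i y + \sum_(j <- r) F j y).
  by apply/funext => y; rewrite big_cons.
exact: CderivD.
Qed.

Lemma Cderiv_comp F (g : R -> R) x d e :
  Cderiv F (g x) d -> is_derive x 1 g e ->
  Cderiv (fun y => F (g y)) x ((e%:C)%C * d).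
Proof.
move=> [h1 h2] k; split.
  apply: (is_derive_eq (is_derive1_comp h1 k)).
  by rewrite ReM /= mul0r subr0 mulrC.
apply: (is_derive_eq (is_derive1_comp h2 k)).
by rewrite ImM /= mul0r addr0 mulrC.
Qed.

Lemma is_derive_continuous (f : R -> R) x d :
  is_derive x 1 f d -> {for x, continuous f}.
Proof. by case=> h _; apply/differentiable_continuous/derivable1_diffP. Qed.

(** Mean value inequality: testing [F] against the fixed direction
    [F b - F a] reduces it to the monotonicity of a real function. *)
Lemma Cderiv_bound F F' (B B' : R -> R) a b : a <= b ->
  (forall x, a <= x <= b -> Cderiv F x (F' x)) ->
  (forall x, a <= x <= b -> is_derive x 1 B (B' x)) ->
  (forall x, a <= x <= b -> normc (F' x) <= B' x) ->
  normc (F b - F a) <= B b - B a.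
Proof.
move=> ab hF hB hle.
pose z := F b - F a.
pose h c : R -> R := c *: B - (Re z *: (fun y => Re (F y)) + Im z *: (fun y => Im (F y))).
have dh c x : a <= x <= b -> is_derive x 1 (h c)
   (c * B' x - (Re z * Re (F' x) + Im z * Im (F' x))).
  move=> xab; have [p q] := hF x xab; have r := hB x xab.
  exact: (is_deriveB (is_deriveZ c r)
           (is_deriveD (is_deriveZ (Re z) p) (is_deriveZ (Im z) q))).
have mono c : normc z <= c -> h c a <= h c b.
  move=> zc.
  have [||x xab e] := @MVT_segment R (h c) (fun x => c * B' x - (Re z * Re (F' x) + Im z * Im (F' x))) a b ab.
  - move=> x; rewrite in_itv /= => /andP[/ltW ax /ltW xb].
    by apply: dh; rewrite ax.
  - apply: continuous_in_subspaceT => x; rewrite inE /= in_itv /= => xab.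
    by apply: is_derive_continuous (dh c x xab).
  rewrite in_itv /= in xab.
  rewrite -subr_ge0 e mulr_ge0 ?subr_ge0 //.
  apply: le_trans (dot_le_normc _ _) _.
  have := hle x xab => hx.
  by apply: ler_pM => //; exact: normc_ge0.
have sq c : h c b - h c a = c * (B b - B a) - normc z ^+ 2.
  rewrite sqr_normcE /h /= !fctE /GRing.scale /= /z !ReB !ImB; ring.
have Bab : 0 <= B b - B a.
  have [||x xab ->] := @MVT_segment R B B' a b ab.
  - by move=> x; rewrite in_itv /= => /andP[/ltW ax /ltW xb]; apply: hB; rewrite ax.
  - apply: continuous_in_subspaceT => x; rewrite inE /= in_itv /= => xab.
    exact: is_derive_continuous (hB x xab).
  rewrite in_itv /= in xab.
  by rewrite mulr_ge0 ?subr_ge0 // (le_trans (normc_ge0 _) (hle _ xab)).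
have [z0|z0] := eqVneq (normc z) 0; first by rewrite -/z z0.
have zp : 0 < normc z by rewrite lt_def z0 normc_ge0.
have := mono _ (lexx _); rewrite -subr_ge0 sq expr2 -mulrBr pmulr_rge0 //.
by rewrite subr_ge0.
Qed.

Lemma Cderiv_lipschitz F F' M a b : a <= b ->
  (forall x, a <= x <= b -> Cderiv F x (F' x)) ->
  (forall x, a <= x <= b -> normc (F' x) <= M) ->
  normc (F b - F a) <= M * (b - a).
Proof.
move=> ab hF hM; rewrite mulrBr.
apply: (@Cderiv_bound F F' ( *%R M) (fun=> M)) => // x _.
have := is_deriveZ M (is_derive_id x (1:R)).
by rewrite /GRing.scale /= mulr1.
Qed.

(** Iterating this lemma produces Taylor remainders. *)
Lemma Cderiv_pow_bound F F' M k h : 0 <= h -> F 0 = 0 ->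
  (forall x, 0 <= x <= h -> Cderiv F x (F' x)) ->
  (forall x, 0 <= x <= h -> normc (F' x) <= M * x ^+ k) ->
  normc (F h) <= M / k.+1%:R * h ^+ k.+1.
Proof.
move=> h0 F0 hF hM.
pose B := (M / k.+1%:R) *: ((id : R -> R) ^+ k.+1).
have BE x : B x = M / k.+1%:R * x ^+ k.+1 by rewrite /B !fctE /GRing.scale.
have B0 : B 0 = 0 by rewrite BE expr0n mulr0.
rewrite -BE -[B h]subr0 -B0 -[F h]subr0 -F0.
apply: (@Cderiv_bound F F' B (fun x => M * x ^+ k)) => // x _.
apply: (is_derive_eq (is_deriveZ _ (is_deriveX k.+1 (is_derive_id x (1:R))))).
rewrite /GRing.scale /= mulr1 -mulr_natl mulrA divfK // pnatr_eq0 //.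
Qed.

End ComplexDerivative.

(** * The corrected midpoint rule *)

Section MidpointRule.
Context {R : realType}.
Implicit Types (F G g : R -> R[i]) (x M : R).

Definition Cderiv_on F F' x :=
  forall y, x - 2^-1 <= y <= x + 2^-1 -> Cderiv F y (F' y).

(** Deviation of [g x] from the integral of [g] over the unit interval centered
    at [x], where [G] is an antiderivative of [g], corrected by the next term of
    the expansion, in which [g1] is the derivative of [g]. *)
Definition midpoint_error G g g1 x : R[i] :=
  g x - (G (x + 2^-1) - G (x - 2^-1)) +
  ((24^-1)%:C)%C * (g1 (x + 2^-1) - g1 (x - 2^-1)).

Lemma Cderiv_shift F F' x h : Cderiv F (x + h) (F' (x + h)) ->
  Cderiv (fun k => F (x + k)) h (F' (x + h)).
Proof.
move=> hF.
have k : is_derive h 1 (fun k : R => x + k) (0 + 1).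
  exact: (is_deriveD (is_derive_cst x h 1) (is_derive_id h (1:R))).
apply: (Cderiv_eq (@Cderiv_comp R F (fun k => x + k) h _ _ hF k)).
by rewrite add0r mul1r.
Qed.

Lemma Cderiv_shiftN F F' x h : Cderiv F (x - h) (F' (x - h)) ->
  Cderiv (fun k => F (x - k)) h (- F' (x - h)).
Proof.
move=> hF.
have k : is_derive h 1 (fun k : R => x - k) (0 - 1).
  exact: (is_deriveB (is_derive_cst x h 1) (is_derive_id h (1:R))).
apply: (Cderiv_eq (@Cderiv_comp R F (fun k => x - k) h _ _ hF k)).
by rewrite sub0r rmorphN1 mulN1r.
Qed.

Lemma Cderiv_monomial (a : R) k (c : R[i]) h :
  Cderiv (fun y => ((a * y ^+ k.+1)%:C)%C * c) h
         (((a * k.+1%:R * h ^+ k)%:C)%C * c).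
Proof.
have p : is_derive h 1 (fun y : R => a * y ^+ k.+1) (a * k.+1%:R * h ^+ k).
  have -> : (fun y : R => a * y ^+ k.+1) = a *: ((id : R -> R) ^+ k.+1).
    by apply/funext => y; rewrite !fctE /GRing.scale.
  apply: (is_derive_eq (is_deriveZ _ (is_deriveX k.+1 (is_derive_id h (1:R))))).
  by rewrite /GRing.scale /= mulr1 -mulr_natl mulrA.
apply: (Cderiv_eq (CderivM (Cderiv_real p) (CderivC c h))).
by rewrite mulr0 addr0.
Qed.

Lemma normcD_le_pair (z w : R[i]) M : normc z <= M -> normc w <= M ->
  normc (z + w) <= 2 * M.
Proof.
move=> h k; apply: le_trans (le_normcD _ _) _.
by rewrite mulr_natl mulr2n lerD.
Qed.

(** The deviation of [g x] from the integral is [- g2 x / 24] up to a Taylor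
    remainder in [g4], and the correction is [g2 x / 24] up to another one; the
    two remainders cost [M / 1920] and [M / 576]. *)
Lemma midpoint_error_le G g g1 g2 g3 g4 x M :
  Cderiv_on G g x -> Cderiv_on g g1 x -> Cderiv_on g1 g2 x ->
  Cderiv_on g2 g3 x -> Cderiv_on g3 g4 x ->
  (forall y, x - 2^-1 <= y <= x + 2^-1 -> normc (g4 y) <= M) ->
  normc (midpoint_error G g g1 x) <= M / 400.
Proof.
move=> dG dg dg1 dg2 dg3 hM.
have M0 : 0 <= M by apply: le_trans (normc_ge0 _) (hM x _); lra.
pose S F h := F (x + h) + F (x - h) : R[i].
pose D F h := F (x + h) - F (x - h) : R[i].
have inr (h : R) : 0 <= h <= 2^-1 -> x - 2^-1 <= x + h <= x + 2^-1 by move=> ?; lra.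
have inl (h : R) : 0 <= h <= 2^-1 -> x - 2^-1 <= x - h <= x + 2^-1 by move=> ?; lra.
have dS F F' (h : R) : Cderiv_on F F' x -> 0 <= h <= 2^-1 -> Cderiv (S F) h (D F' h).
  move=> dF hh; apply: CderivD; first by apply: Cderiv_shift; exact/dF/inr.
  by apply: Cderiv_shiftN; exact/dF/inl.
have dD F F' (h : R) : Cderiv_on F F' x -> 0 <= h <= 2^-1 -> Cderiv (D F) h (S F' h).
  move=> dF hh; have := CderivB (Cderiv_shift (dF _ (inr _ hh)))
    (Cderiv_shiftN (dF _ (inl _ hh))).
  by rewrite opprK.
pose c2 := g2 x.
(* [b3], ..., [b0] integrate [g4] up to [g1], and [a1], [a0] go on to [G]; odd
   orders vanish at 0 by symmetry. *)
have b3 (h : R) : 0 <= h <= 2^-1 -> normc (S g4 h) <= 2 * M * h ^+ 0.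
  move=> hh; rewrite expr0 mulr1; apply: normcD_le_pair; apply: hM.
  - exact: inr.
  - exact: inl.
have sub (h k : R) : 0 <= h <= 2^-1 -> 0 <= k <= h -> 0 <= k <= 2^-1 by move=> ? ?; lra.
have b2 (h : R) : 0 <= h <= 2^-1 -> normc (D g3 h) <= 2 * M * h ^+ 1.
  move=> hh; have := @Cderiv_pow_bound R (D g3) (S g4) (2 * M) 0 h.
  rewrite divr1; apply; first by case/andP: hh.
  - by rewrite /D addr0 subr0 subrr.
  - by move=> k hk; apply: dD => //; exact: sub hk.
  - by move=> k hk; apply: b3; exact: sub hk.
have b1 (h : R) : 0 <= h <= 2^-1 ->
    normc (S g2 h - ((2 * h ^+ 0)%:C)%C * c2) <= M * h ^+ 2.
  move=> hh; have -> : M * h ^+ 2 = 2 * M / 2 * h ^+ 2 by field.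
  apply: (@Cderiv_pow_bound R
    (fun h => S g2 h - ((2 * h ^+ 0)%:C)%C * c2) (D g3) (2 * M) 1 h); first by case/andP: hh.
  - rewrite /S /c2 addr0 subr0 expr0 mulr1 rmorph_nat; ring.
  - move=> k hk; rewrite -[D g3 k]subr0; apply: CderivB.
      by apply: dS => //; exact: sub hk.
    under [X in Cderiv X _ _]eq_fun do rewrite expr0.
    exact: CderivC.
  - by move=> k hk; apply: b2; exact: sub hk.
have b0 (h : R) : 0 <= h <= 2^-1 ->
    normc (D g1 h - ((2 * h ^+ 1)%:C)%C * c2) <= M / 3 * h ^+ 3.
  move=> hh; have := @Cderiv_pow_bound R
    (fun h => D g1 h - ((2 * h ^+ 1)%:C)%C * c2)
    (fun h => S g2 h - ((2 * h ^+ 0)%:C)%C * c2) M 2 h.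
  apply; first by case/andP: hh.
  - by rewrite /D addr0 subr0 subrr expr1 mulr0 mul0r subrr.
  - move=> k hk; apply: CderivB; first by apply: dD => //; exact: sub hk.
    by have := @Cderiv_monomial 2 0 c2 k; rewrite mulr1.
  - by move=> k hk; apply: b1; exact: sub hk.
have a1 (h : R) : 0 <= h <= 2^-1 ->
    normc (((2 * h ^+ 0)%:C)%C * g x - S g h + ((1 * h ^+ 2)%:C)%C * c2)
    <= M / 3 / 4 * h ^+ 4.
  move=> hh; have := @Cderiv_pow_bound R
    (fun h => ((2 * h ^+ 0)%:C)%C * g x - S g h + ((1 * h ^+ 2)%:C)%C * c2)
    (fun h => - (D g1 h - ((2 * h ^+ 1)%:C)%C * c2)) (M / 3) 3 h.
  apply; first by case/andP: hh.
  - rewrite /S addr0 subr0 expr0 mulr1 rmorph_nat expr0n mulr0 mul0r; ring.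
  - move=> k hk; rewrite opprB addrC -[- D g1 k]sub0r.
    apply: CderivD; last by have := @Cderiv_monomial 1 1 c2 k; rewrite mul1r.
    apply: CderivB; last by apply: dS => //; exact: sub hk.
    under [X in Cderiv X _ _]eq_fun do rewrite expr0.
    exact: CderivC.
  - by move=> k hk; rewrite normcN; apply: b0; exact: sub hk.
have a0 (h : R) : 0 <= h <= 2^-1 ->
    normc (((2 * h ^+ 1)%:C)%C * g x - D G h + ((3^-1 * h ^+ 3)%:C)%C * c2)
    <= M / 3 / 4 / 5 * h ^+ 5.
  move=> hh; have := @Cderiv_pow_bound R
    (fun h => ((2 * h ^+ 1)%:C)%C * g x - D G h + ((3^-1 * h ^+ 3)%:C)%C * c2)
    (fun h => ((2 * h ^+ 0)%:C)%C * g x - S g h + ((1 * h ^+ 2)%:C)%C * c2)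
    (M / 3 / 4) 4 h.
  apply; first by case/andP: hh.
  - by rewrite /D addr0 subr0 subrr expr1 mulr0 mul0r subrr expr0n mulr0 mul0r addr0.
  - move=> k hk; apply: CderivD.
      apply: CderivB; last by apply: dD => //; exact: sub hk.
      by have := @Cderiv_monomial 2 0 (g x) k; rewrite mulr1.
    by have := @Cderiv_monomial 3^-1 2 c2 k; rewrite mulVf ?pnatr_eq0.
  - by move=> k hk; apply: a1; exact: sub hk.
have hhalf : (0:R) <= 2^-1 <= (2^-1 : R) by rewrite lexx andbT invr_ge0.
have := a0 _ hhalf; have := b0 _ hhalf => p q.
have -> : midpoint_error G g g1 x =
   (((2 * 2^-1 ^+ 1)%:C)%C * g x - D G 2^-1 + ((3^-1 * 2^-1 ^+ 3)%:C)%C * c2) +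
   ((24^-1)%:C)%C * (D g1 2^-1 - ((2 * 2^-1 ^+ 1)%:C)%C * c2).
  rewrite /midpoint_error -/(D G _) -/(D g1 _).
  have -> : 2 * (2^-1 : R) ^+ 1 = 1 by field.
  have -> : (3^-1 * 2^-1 ^+ 3 : R) = 24^-1 by field.
  rewrite rmorph1; ring.
apply: le_trans (le_normcD _ _) _.
rewrite Normc.normcM normc_real ger0_norm ?invr_ge0 //.
have -> : M / 400 = M / 1920 + (M / 400 - M / 1920) by ring.
apply: lerD; first by apply: le_trans q _; lra.
apply: (@le_trans _ _ (24^-1 * (M / 3 * 2^-1 ^+ 3))); first by rewrite ler_wpM2l // invr_ge0.
lra.
Qed.

End MidpointRule.

(** * Complex powers *)

Section ComplexPower.
Context {R : realType}.
Implicit Types (s z w : R[i]) (y : R).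

Lemma cexpD z w : cexp (z + w) = cexp z * cexp w.
Proof.
apply: complex_ext; rewrite !(ReM, ImM) /= ReD ImD expRD ?cosD ?sinD; ring.
Qed.

Lemma cexp0 : cexp (0 : R[i]) = 1.
Proof. by apply: complex_ext; rewrite /= expR0 ?cos0 ?sin0 mul1r. Qed.

Lemma normc_cexp z : normc (cexp z) = expR (Re z).
Proof.
rewrite /cexp /= !exprMn -mulrDr cos2Dsin2 mulr1 sqrtr_sqr ger0_norm //.
Qed.

Lemma Cderiv_cexp (F : R -> R[i]) x d :
  Cderiv F x d -> Cderiv (fun y => cexp (F y)) x (d * cexp (F x)).
Proof.
move=> [h1 h2].
have e := is_derive1_comp (is_derive_expR (Re (F x))) h1.
have c := is_derive1_comp (is_derive_cos (Im (F x))) h2.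
have s := is_derive1_comp (is_derive_sin (Im (F x))) h2.
split.
  apply: (is_derive_eq (is_deriveM e c)).
  by rewrite ReM /= /GRing.scale /=; ring.
apply: (is_derive_eq (is_deriveM e s)).
by rewrite ImM /= /GRing.scale /=; ring.
Qed.

(** [cpow y s] is [y ^ (- s)], the general term of a Dirichlet series. *)
Definition cpow y s : R[i] := rpowc y (- s).

Lemma cpowE y s : cpow y s = cexp (- s * ((ln y)%:C)%C).
Proof. by []. Qed.

Lemma cpowD y s z : cpow y (s + z) = cpow y s * cpow y z.
Proof. by rewrite !cpowE -cexpD; congr cexp; ring. Qed.

Lemma cpow1 y : 0 < y -> cpow y 1 = ((y^-1)%:C)%C.
Proof.
move=> y0; rewrite cpowE.
have -> : - 1 * ((ln y)%:C)%C = ((- ln y)%:C)%C by rewrite mulN1r rmorphN.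
by apply: complex_ext; rewrite /= ?cos0 ?sin0 ?mulr0 // mulr1 expRN lnK.
Qed.

Lemma cpowS y s : 0 < y -> cpow y (s + 1) = ((y^-1)%:C)%C * cpow y s.
Proof. by move=> y0; rewrite cpowD cpow1 // mulrC. Qed.

Lemma normc_cpow y s : normc (cpow y s) = expR (- Re s * ln y).
Proof. by rewrite normc_cexp ReM ReN /= mulr0 subr0. Qed.

Lemma normc_cpow_ge1 y s (k : nat) : 1 <= y -> k%:R <= Re s ->
  normc (cpow y s) <= y ^- k.
Proof.
move=> y1 hk; have y0 : 0 < y by lra.
rewrite normc_cpow.
have -> : y ^- k = expR (- (k%:R * ln y)) by rewrite expRN expRM_natl lnK.
by rewrite ler_expR mulNr lerN2 ler_wpM2r // ln_ge0.
Qed.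

Lemma Cderiv_cpow y s : 0 < y -> Cderiv (cpow ^~ s) y (- s * cpow y (s + 1)).
Proof.
move=> y0.
have l := Cderiv_real (is_derive1_ln y0).
apply: (Cderiv_eq (Cderiv_cexp (CderivMl (- s) l))).
by rewrite cpowS // -mulrA.
Qed.

End ComplexPower.

(** * Inverses, continuity and limits in the modulus *)

Section ContinuityTools.
Context {R : realType}.

Lemma complex_inverse (z : R[i]) :
  z^-1 = Complex (Re z * (Re z ^+ 2 + Im z ^+ 2)^-1)
    (- (Im z * (Re z ^+ 2 + Im z ^+ 2)^-1)).
Proof. by case: z. Qed.

Lemma CderivV (F : R -> R[i]) x d : F x != 0 ->
  Cderiv F x d -> Cderiv (fun y => (F y)^-1) x (- d / F x ^+ 2).
Proof.
move=> F0 [h1 h2].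
pose n2 y := Re (F y) ^+ 2 + Im (F y) ^+ 2.
have n20 : n2 x != 0.
  by rewrite /n2 -sqr_normcE sqrf_eq0; apply: contra_neq F0 => /Normc.eq0_normc.
have dn : is_derive x 1 n2 (2 * (Re (F x) * Re d + Im (F x) * Im d)).
  apply: (is_derive_eq (is_deriveD (is_deriveX 2 h1) (is_deriveX 2 h2))).
  by rewrite /GRing.scale /= !expr1; ring.
have di := @is_deriveV R n2 x _ 1 n20 dn.
have key : (n2 x)^-1 = (Re (F x) ^+ 2 + Im (F x) ^+ 2) * (n2 x)^-1 * (n2 x)^-1.
  by rewrite -/(n2 x) divff // mul1r.
have -> : - d / F x ^+ 2 = - d * ((F x)^-1 * (F x)^-1) by rewrite -exprVn expr2.
have FV := complex_inverse (F x); rewrite -/(n2 x) in FV.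
rewrite FV {FV F0} -exprVn in di *.
set m := (n2 x)^-1 in key di *.
have sub0 : m - (Re (F x) ^+ 2 + Im (F x) ^+ 2) * m * m = 0 by rewrite -key subrr.
split.
  have -> : (fun y => Re (F y)^-1) = (fun y => Re (F y)) * (fun y => (n2 y)^-1).
    by apply/funext => y; rewrite complex_inverse fctE.
  apply: (is_derive_eq (is_deriveM h1 di)).
  rewrite /GRing.scale /= !(ReM, ReN, ImM, ImN) /= -/m.
  clearbody m; clear key di; move: m (Re (F x)) (Im (F x)) (Re d) (Im d) sub0 => m' a b p q sub0.
  apply/eqP; rewrite -subr_eq0; apply/eqP.
  transitivity (p * (m' - (a ^+ 2 + b ^+ 2) * m' * m')); first by ring.
  by rewrite sub0 mulr0.
have -> : (fun y => Im (F y)^-1) = - ((fun y => Im (F y)) * (fun y => (n2 y)^-1)).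
  by apply/funext => y; rewrite complex_inverse /= !fctE.
apply: (is_derive_eq (is_deriveN (is_deriveM h2 di))).
rewrite /GRing.scale /= !(ReM, ReN, ImM, ImN) /= -/m.
clearbody m; clear key di; move: m (Re (F x)) (Im (F x)) (Re d) (Im d) sub0 => m' a b p q sub0.
apply/eqP; rewrite -subr_eq0; apply/eqP.
transitivity (- q * (m' - (a ^+ 2 + b ^+ 2) * m' * m')); first by ring.
by rewrite sub0 mulr0.
Qed.

Definition Ccontinuous_at (F : R -> R[i]) x := forall e : R, 0 < e ->
  exists2 d : R, 0 < d & forall y, `|y - x| < d -> normc (F y - F x) < e.

Lemma Cderiv_continuous F x d : Cderiv F x d -> Ccontinuous_at F x.
Proof.
move=> [/is_derive_continuous h1 /is_derive_continuous h2] e e0.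
have e2 : 0 < e / 2 by rewrite divr_gt0.
move/cvgrPdist_lt : h1 => /(_ _ e2) [d1 /= d10 k1].
move/cvgrPdist_lt : h2 => /(_ _ e2) [d2 /= d20 k2].
exists (Num.min d1 d2); first by rewrite lt_min d10.
move=> y; rewrite lt_min => /andP[y1 y2].
apply: le_lt_trans (normc_le_abs _) _; rewrite ReB ImB [e]splitr.
rewrite -normrN opprB -[in X in _ + X]normrN opprB.
by apply: ltrD; [apply: k1|apply: k2]; rewrite /= distrC.
Qed.

Lemma Ccontinuous_atD F G x : Ccontinuous_at F x -> Ccontinuous_at G x ->
  Ccontinuous_at (fun y => F y + G y) x.
Proof.
move=> hF hG e e0; have e2 : 0 < e / 2 by rewrite divr_gt0.
have [d1 d10 k1] := hF _ e2; have [d2 d20 k2] := hG _ e2.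
exists (Num.min d1 d2); first by rewrite lt_min d10.
move=> y; rewrite lt_min => /andP[y1 y2].
have -> : F y + G y - (F x + G x) = (F y - F x) + (G y - G x) by ring.
apply: le_lt_trans (le_normcD _ _) _; rewrite [e]splitr.
by apply: ltrD; [apply: k1|apply: k2].
Qed.

(** A bound on a right neighbourhood passes to the point. *)
Lemma Ccontinuous_at_bound (F : R -> R[i]) x b K : x < b ->
  Ccontinuous_at F x -> (forall y, x < y < b -> normc (F y) <= K) ->
  normc (F x) <= K.
Proof.
move=> xb hF hK; apply/ler_addgt0Pr => e e0.
have [d d0 k] := hF e e0.
pose y := x + Num.min (d / 2) ((b - x) / 2).
have m0 : 0 < Num.min (d / 2) ((b - x) / 2) by rewrite lt_min !divr_gt0 // subr_gt0.
have yb : x < y < b.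
  have : Num.min (d / 2) ((b - x) / 2) <= (b - x) / 2 by rewrite ge_min lexx orbT.
  by rewrite /y => h; apply/andP; split; lra.
have yd : `|y - x| < d.
  rewrite /y addrC addKr gtr0_norm //.
  have : Num.min (d / 2) ((b - x) / 2) <= d / 2 by rewrite ge_min lexx.
  by move=> h; lra.
have -> : F x = F y - (F y - F x) by ring.
apply: le_trans (ler_normcB _ _) _; apply: lerD; first exact: hK.
by apply/ltW/k.
Qed.

(** The topology of [R[i]^o] comes from a norm with values in [R[i]]; here and
    in the next lemma it is restated with the real modulus. *)
Lemma cvg_normc (u : nat -> R[i]^o) (l : R[i]^o) : u @ \oo --> l ->
  forall e : R, 0 < e -> exists N, forall n, (N <= n)%N -> normc (l - u n) < e.
Proof.
move=> /cvgrPdist_lt h e e0.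
have : 0 < ((e%:C)%C : R[i]) by rewrite ltcR.
move=> /h [N _ hN]; exists N => n Nn.
by have := hN n Nn; rewrite /= normcE ltcR.
Qed.

Lemma derivable_continuous_normc (f : R[i]^o -> R[i]^o) (s : R[i]^o) :
  derivable f s 1 -> forall e : R, 0 < e ->
  exists2 d : R, 0 < d & forall z : R[i], normc (z - s) < d -> normc (f z - f s) < e.
Proof.
move=> /derivable1_diffP/differentiable_continuous/cvgrPdist_lt h e e0.
have : 0 < ((e%:C)%C : R[i]) by rewrite ltcR.
move=> /h [d /= d0 hd]; exists (Re d).
  by move: d0; rewrite ltcE => /andP[].
move=> z hz; rewrite normcB.
have := hd z; rewrite /= !normcE ltcR; apply.
rewrite ltcE /=; move: d0; rewrite ltcE /= => /andP[/eqP -> _].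
by rewrite eqxx normcB.
Qed.

End ContinuityTools.

(** * Euler-Maclaurin approximation of the Hurwitz zeta-function *)

Section HurwitzApproximation.
Context {R : realType}.
Implicit Types (s : R[i]) (x y alpha : R) (n N M : nat).

(** An antiderivative of [- y ^ (- s)] and the midpoint correction. *)
Definition hz_boundary s y : R[i] :=
  (s - 1)^-1 * cpow y (s - 1) - ((24^-1)%:C)%C * (s * cpow y (s + 1)).

(** The boundary is taken half-way between two arguments of the sum, as the
    midpoint rule requires. *)
Definition hz_approx N alpha s : R[i] :=
  \sum_(0 <= n < N) cpow (n%:R + alpha) s + hz_boundary s (N%:R + alpha - 2^-1).

(** The [k]-th derivative of [y ^ (- s)] is [dcoef s k * y ^ (- s - k)]. *)
Definition dcoef s k : R[i] := \prod_(j < k) - (s + j%:R).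

Definition em_antideriv s y : R[i] := - (s - 1)^-1 * cpow y (s - 1).
Definition em_deriv s k y : R[i] := dcoef s k * cpow y (s + k%:R).

(** The contribution of one term to the error, since it is the increment of
    [hz_approx] in [N]. *)
Definition em_term s x : R[i] :=
  midpoint_error (em_antideriv s) (em_deriv s 0) (em_deriv s 1) x.

Lemma Cderiv_em_antideriv s y : s != 1 -> 0 < y ->
  Cderiv (em_antideriv s) y (em_deriv s 0 y).
Proof.
move=> s1 y0; apply: (Cderiv_eq (CderivMl (- (s - 1)^-1) (Cderiv_cpow (s - 1) y0))).
rewrite /em_deriv /dcoef big_ord0 mul1r addr0 subrK mulrA mulrNN mulVf ?mul1r //.
by rewrite subr_eq0.
Qed.

Lemma Cderiv_em_deriv s k y : 0 < y ->
  Cderiv (em_deriv s k) y (em_deriv s k.+1 y).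
Proof.
move=> y0; apply: (Cderiv_eq (CderivMl (dcoef s k) (Cderiv_cpow (s + k%:R) y0))).
by rewrite /em_deriv /dcoef big_ord_recr /= mulrA -natr1 addrA.
Qed.

Lemma em_termE s x :
  em_term s x = cpow x s - (hz_boundary s (x - 2^-1) - hz_boundary s (x + 2^-1)).
Proof.
rewrite /em_term /midpoint_error /em_antideriv /em_deriv /dcoef /hz_boundary.
rewrite !big_ord_recr !big_ord0 /= addr0; ring.
Qed.

Lemma em_term_le_gen s x K : s != 1 -> 2^-1 < x ->
  (forall y, x - 2^-1 <= y <= x + 2^-1 -> normc (em_deriv s 4 y) <= K) ->
  normc (em_term s x) <= K / 400.
Proof.
move=> s1 x2 hK.
have pos y : x - 2^-1 <= y <= x + 2^-1 -> 0 < y by move=> ?; lra.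
apply: (@midpoint_error_le _ _ _ _ (em_deriv s 2) (em_deriv s 3) (em_deriv s 4) x) => // y /pos y0.
- exact: Cderiv_em_antideriv.
- exact: Cderiv_em_deriv.
- exact: Cderiv_em_deriv.
- exact: Cderiv_em_deriv.
- exact: Cderiv_em_deriv.
Qed.

Lemma normc_dcoef s t k : 1 <= Re s <= 2 -> `|Im s| <= t ->
  normc (dcoef s k) <= (t + 2 + k%:R) ^+ k.
Proof.
move=> /andP[s1 s2] st.
have t0 : 0 <= t by apply: le_trans st.
suff h m : (m <= k)%N -> normc (dcoef s m) <= (t + 2 + k%:R) ^+ m by exact: h.
elim: m => [_|m ih mk]; first by rewrite /dcoef big_ord0 Normc.normc1 expr0.
rewrite /dcoef big_ord_recr /= -/(dcoef s m) Normc.normcM exprSr.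
apply: ler_pM; rewrite ?normc_ge0 ?ih ?(ltnW mk) // normcN.
apply: le_trans (normc_le_abs _) _.
have mE : (m%:R : R[i]) = ((m%:R : R)%:C)%C by rewrite rmorph_nat.
rewrite ReD ImD mE /= addr0 ger0_norm ?addr_ge0 //; last by lra.
have : (m%:R : R) <= k%:R by rewrite ler_nat ltnW.
by move=> h; lra.
Qed.

Lemma inv_pow5_telescope y : 1 < y ->
  y ^- 5 <= 4^-1 * ((y - 1) ^- 4 - y ^- 4).
Proof.
move=> y1; have u0 : 0 < y - 1 by lra.
have y0 : 0 < y by lra.
rewrite -subr_ge0.
have -> : 4^-1 * ((y - 1) ^- 4 - y ^- 4) - y ^- 5 =
   4^-1 * (10 * (y - 1) ^+ 3 + 10 * (y - 1) ^+ 2 + 5 * (y - 1) + 1)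
    / ((y - 1) ^+ 4 * y ^+ 5).
  by field; rewrite !gt_eqF.
apply: divr_ge0; last by rewrite mulr_ge0 // exprn_ge0 // ltW.
by rewrite mulr_ge0 ?invr_ge0 // !addr_ge0 ?mulr_ge0 ?exprn_ge0 // ltW.
Qed.

Lemma em_term_le s t x : s != 1 -> 1 <= Re s <= 2 -> `|Im s| <= t -> 3 / 2 < x ->
  normc (em_term s x) <=
  (t + 6) ^+ 4 / 1600 * ((x - 2^-1 - 1) ^- 4 - (x - 2^-1) ^- 4).
Proof.
move=> s1 sr st x2; have t0 : 0 <= t by apply: le_trans st.
have x0 : 1 < x - 2^-1 by lra.
apply: le_trans (@em_term_le_gen s x ((t + 6) ^+ 4 * (x - 2^-1) ^- 5) s1 _ _) _.
- by lra.
- move=> y yx; rewrite /em_deriv Normc.normcM; apply: ler_pM; rewrite ?normc_ge0 //.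
    have := normc_dcoef 4 sr st.
    by have -> : t + 2 + 4%:R = t + 6 by ring.
  have y1 : 1 <= y by lra.
  apply: le_trans (normc_cpow_ge1 (k := 5) y1 _) _.
    rewrite ReD; have -> : Re (4%:R : R[i]) = 4%:R by rewrite -(rmorph_nat (real_complex R)).
    by case/andP: sr => ? _; lra.
  rewrite lef_pV2 ?posrE ?exprn_gt0; try lra.
  by rewrite lerXn2r ?nnegrE //; lra.
have := inv_pow5_telescope x0 => h.
have t4 : 0 <= (t + 6) ^+ 4 by rewrite exprn_ge0 //; lra.
move: h t4; set D := _ ^- 4 - _ ^- 4; set A := _ ^+ 4 => h t4.
have -> : A / 1600 * D = A * (4^-1 * D) / 400 by field.
by apply: ler_wpM2r; [rewrite invr_ge0 ler0n | exact: ler_wpM2l].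
Qed.

Lemma hz_approx_step N alpha s :
  hz_approx N.+1 alpha s - hz_approx N alpha s = em_term s (N%:R + alpha).
Proof.
rewrite /hz_approx big_nat_recr //= em_termE.
have -> : N.+1%:R + alpha - 2^-1 = N%:R + alpha + 2^-1 :> R.
  by rewrite -natr1; field.
ring.
Qed.

Lemma hz_approx_diff N M alpha s t : s != 1 -> 1 <= Re s <= 2 -> `|Im s| <= t ->
  0 < alpha -> (1 < N)%N -> (N <= M)%N ->
  normc (hz_approx M alpha s - hz_approx N alpha s) <=
  (t + 6) ^+ 4 / 1600 * (N%:R + alpha - 2^-1 - 1) ^- 4.
Proof.
move=> s1 sr st a0 N1 NM; have t0 : 0 <= t by apply: le_trans st.
have t4 : 0 <= (t + 6) ^+ 4 / 1600.
  by apply: mulr_ge0; [apply: exprn_ge0; lra | rewrite invr_ge0 ler0n].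
have pos n : (N <= n)%N -> 0 < n%:R + alpha - 2^-1 - 1.
  move=> Nn; have : (2 : R) <= n%:R by rewrite (ler_nat _ 2) (leq_trans N1).
  by move=> ?; lra.
have : normc (hz_approx M alpha s - hz_approx N alpha s) <=
  (t + 6) ^+ 4 / 1600 * ((N%:R + alpha - 2^-1 - 1) ^- 4 - (M%:R + alpha - 2^-1 - 1) ^- 4).
  elim: M NM => [|M ih]; first by rewrite leqn0 => /eqP N0; rewrite N0 in N1.
  rewrite leq_eqVlt => /orP[/eqP <-|]; first by rewrite !subrr mulr0 Normc.normc0.
  rewrite ltnS => NM.
  have -> : hz_approx M.+1 alpha s - hz_approx N alpha s =
    (hz_approx M alpha s - hz_approx N alpha s) + em_term s (M%:R + alpha).
    by rewrite -hz_approx_step; ring.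
  apply: le_trans (le_normcD _ _) _.
  apply: le_trans (lerD (ih NM) (em_term_le s1 sr st _)) _.
    by have := pos _ NM => ?; lra.
  rewrite -mulrDr ler_wpM2l //.
  have -> : M.+1%:R + alpha - 2^-1 - 1 = M%:R + alpha - 2^-1 :> R by rewrite -natr1; ring.
  by rewrite [leLHS]addrA subrK.
move=> h; apply: le_trans h _; rewrite ler_wpM2l // gerBl invr_ge0 exprn_ge0 //.
exact/ltW/pos.
Qed.

Lemma hz_boundary_cvg0 s : 1 < Re s -> forall e : R, 0 < e ->
  exists Y : R, forall y, Y <= y -> normc (hz_boundary s y) < e.
Proof.
move=> s1 e e0; set c := normc (s - 1)^-1 + 24^-1 * normc s + 1.
have c0 : 0 < c.
  by rewrite /c ltr_wpDl // addr_ge0 ?normc_ge0 // mulr_ge0 ?normc_ge0.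
have d0 : 0 < Re s - 1 by lra.
exists (Num.max 1 (expR (ln (c / e) / (Re s - 1)))) => y.
rewrite ge_max => /andP[y1 hy].
have y0 : 0 < y by lra.
have ly : 0 <= ln y by rewrite ln_ge0.
set E := expR (- (Re s - 1) * ln y).
have k1 : normc (cpow y (s - 1)) <= E by rewrite normc_cpow ReB.
have k2 : normc (cpow y (s + 1)) <= E.
  rewrite normc_cpow ler_expR ReD /=; nra.
have Ee : E <= e / c.
  rewrite /E -[e / c]lnK ?posrE ?divr_gt0 // ler_expR.
  have -> : ln (e / c) = - ln (c / e) by rewrite !ln_div ?posrE // opprB.
  have l1 : ln (c / e) / (Re s - 1) <= ln y by rewrite -ler_expR lnK ?posrE.
  by rewrite mulNr lerN2 -ler_pdivrMl // mulrC.
apply: (@le_lt_trans _ _ ((c - 1) * E)).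
  rewrite /hz_boundary; apply: le_trans (ler_normcB _ _) _.
  rewrite !Normc.normcM normc_real ger0_norm ?invr_ge0 //.
  rewrite /c addrK mulrDl; apply: lerD.
    by rewrite ler_wpM2l ?normc_ge0.
  by rewrite -mulrA ler_wpM2l ?invr_ge0 // ler_wpM2l ?normc_ge0.
have E0 : 0 < E by exact: expR_gt0.
apply: (@lt_le_trans _ _ (c * E)); first by rewrite ltr_pM2r //; lra.
by rewrite mulrC -ler_pdivlMr.
Qed.

(** For [Re s > 1] the boundary term tends to 0, so the error is the sum of all
    later local errors, which telescopes. *)
Lemma zeta_approx_gt1 alpha f N s t : is_hurwitz_zeta alpha f -> 0 < alpha ->
  1 < Re s <= 2 -> `|Im s| <= t -> (1 < N)%N ->
  normc (f s - hz_approx N alpha s) <=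
  (t + 6) ^+ 4 / 1600 * (N%:R + alpha - 2^-1 - 1) ^- 4.
Proof.
move=> [hf _] a0 /andP[s1 s2] st N1.
have sn1 : s != 1 by apply: contraTneq s1 => ->; rewrite ltxx.
have sr : 1 <= Re s <= 2 by rewrite ltW.
apply/ler_addgt0Pr => e e0.
have e2 : 0 < e / 2 by rewrite divr_gt0.
have [N2 hN2] := cvg_normc (hf s s1) e2.
have [Y hY] := hz_boundary_cvg0 s1 e2.
pose M := maxn N (maxn N2 (Num.bound `|Y + 1|)).
have bM : Y <= M%:R + alpha - 2^-1.
  have : Y + 1 <= M%:R.
    apply: le_trans (ler_norm _) _.
    apply: le_trans (ltW (archi_boundP (normr_ge0 _))) _.
    by rewrite ler_nat /M !leq_max leqnn !orbT.
  by move=> ?; lra.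
have MN2 : (N2 <= M)%N by rewrite /M !leq_max leqnn orbT.
have MN : (N <= M)%N by rewrite /M leq_max leqnn.
have -> : f s - hz_approx N alpha s =
  (f s - \sum_(0 <= n < M) cpow (n%:R + alpha) s)
  - hz_boundary s (M%:R + alpha - 2^-1)
  + (hz_approx M alpha s - hz_approx N alpha s).
  by rewrite /hz_approx; ring.
apply: le_trans (le_normcD _ _) _; rewrite addrC.
apply: lerD; first exact: hz_approx_diff.
apply: le_trans (ler_normcB _ _) _; rewrite [e]splitr.
by apply: lerD; apply: ltW; [exact: hN2 | exact: hY].
Qed.

End HurwitzApproximation.

(** * The line of abscissa 1 *)

Section BoundaryLine.
Context {R : realType}.
Implicit Types (s : R[i]) (x y alpha t : R) (n N M : nat).

Lemma Cderiv_cpow_exponent (F : R -> R[i]) x d y :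
  Cderiv F x d ->
  Cderiv (fun u => cpow y (F u)) x (- (((ln y)%:C)%C * d) * cpow y (F x)).
Proof.
move=> hF; rewrite /cpow /rpowc.
apply: (Cderiv_eq (Cderiv_cexp (CderivM (CderivN hF) (CderivC ((ln y)%:C)%C x)))).
by rewrite mulr0 addr0 mulNr [d * _]mulrC.
Qed.

Lemma Cderiv_hz_boundary_exponent (F : R -> R[i]) x d y : F x != 1 ->
  Cderiv F x d ->
  Cderiv (fun u => hz_boundary (F u) y) x
    (- d * (((ln y)%:C)%C * hz_boundary (F x) y
            + (F x - 1)^-1 * ((F x - 1)^-1 * cpow y (F x - 1))
            + ((24^-1)%:C)%C * cpow y (F x + 1))).
Proof.
move=> F1 hF; rewrite /hz_boundary.
have F10 : F x - 1 != 0 by rewrite subr_eq0.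
have hm : Cderiv (fun u => F u - 1) x d.
  by rewrite -[d]subr0; apply: CderivB => //; exact: CderivC.
have hp : Cderiv (fun u => F u + 1) x d.
  by rewrite -[d]addr0; apply: CderivD => //; exact: CderivC.
have k1 := CderivM (@CderivV R (fun u => F u - 1) x d F10 hm)
  (@Cderiv_cpow_exponent (fun u => F u - 1) x d y hm).
have k2 := CderivMl ((24^-1)%:C)%C
  (CderivM hF (@Cderiv_cpow_exponent (fun u => F u + 1) x d y hp)).
apply: (Cderiv_eq (CderivB k1 k2)); rewrite -exprVn; ring.
Qed.

Lemma Cderiv_hz_approx_exponent (F : R -> R[i]) x d N alpha : F x != 1 ->
  Cderiv F x d ->
  Cderiv (fun u => hz_approx N alpha (F u)) x
    (\sum_(0 <= n < N) - (((ln (n%:R + alpha))%:C)%C * d) * cpow (n%:R + alpha) (F x)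
     - d * (((ln (N%:R + alpha - 2^-1))%:C)%C * hz_boundary (F x) (N%:R + alpha - 2^-1)
            + (F x - 1)^-1 * ((F x - 1)^-1 * cpow (N%:R + alpha - 2^-1) (F x - 1))
            + ((24^-1)%:C)%C * cpow (N%:R + alpha - 2^-1) (F x + 1))).
Proof.
move=> F1 hF; apply: CderivD.
  by apply: Cderiv_sum => n; exact: Cderiv_cpow_exponent.
by rewrite -[- (d * _)]mulNr; exact: Cderiv_hz_boundary_exponent.
Qed.

Lemma Cderiv_Complex_re t x : Cderiv (fun u => Complex u t) x 1.
Proof. by split; [exact: is_derive_id | exact: is_derive_cst]. Qed.

Lemma Cderiv_Complex_im x t : Cderiv (fun u => Complex x u) t (Complex 0 1).
Proof. by split; [exact: is_derive_cst | exact: is_derive_id]. Qed.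

Lemma zeta_continuous_re alpha f x t : is_hurwitz_zeta alpha f -> t != 0 ->
  Ccontinuous_at (fun u => f (Complex u t)) x.
Proof.
move=> [_ hf] t0 e e0.
have s1 : Complex x t != 1 by apply: contra_neq t0 => -[].
have [d d0 hd] := derivable_continuous_normc (hf _ s1) e0.
exists d => // y yx; apply: hd.
have -> : Complex y t - Complex x t = ((y - x)%:C)%C.
  by apply: complex_ext; rewrite /= ?subrr.
by rewrite normc_real.
Qed.

(** The bound of [zeta_approx_gt1] does not degenerate as the abscissa decreases
    to 1, where both sides are continuous. *)
Lemma zeta_approx alpha f N x t : is_hurwitz_zeta alpha f -> 0 < alpha ->
  1 <= x <= 2 -> t != 0 -> (1 < N)%N ->
  normc (f (Complex x t) - hz_approx N alpha (Complex x t)) <=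
  (`|t| + 6) ^+ 4 / 1600 * (N%:R + alpha - 2^-1 - 1) ^- 4.
Proof.
move=> hf a0 /andP[x1 x2] t0 N1.
have gt1 y : 1 < y <= 2 -> normc (f (Complex y t) - hz_approx N alpha (Complex y t)) <=
  (`|t| + 6) ^+ 4 / 1600 * (N%:R + alpha - 2^-1 - 1) ^- 4.
  by move=> y12; apply: zeta_approx_gt1.
move: x1; rewrite le_eqVlt => /predU1P[<-|x1]; last by apply: gt1; rewrite x1.
apply: (@Ccontinuous_at_bound R (fun u => f (Complex u t) - hz_approx N alpha (Complex u t)) 1 2).
- by rewrite ltr1n.
- apply: Ccontinuous_atD; first exact: zeta_continuous_re hf t0.
  have s1 : Complex 1 t != 1 by apply: contra_neq t0 => -[].
  exact: Cderiv_continuous (CderivN (@Cderiv_hz_approx_exponent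
    (fun u => Complex u t) 1 1 N alpha s1 (Cderiv_Complex_re t 1))).
- by move=> y /andP[y1 y2]; apply: gt1; rewrite y1 ltW.
Qed.

Lemma normc_inv_le (z : R[i]) (c : R) : 0 < c -> c <= normc z -> normc z^-1 <= c^-1.
Proof.
move=> c0 cz; rewrite Normc.normcV lef_pV2 ?posrE //.
exact: lt_le_trans cz.
Qed.

Lemma normc_hz_boundary_le y x t h : 1 <= y -> 1 <= x <= 2 -> 0 < h <= `|t| ->
  normc (hz_boundary (Complex x t) y) <= h^-1 + (2 + `|t|) / 24.
Proof.
move=> y1 /andP[x1 x2] /andP[h0 ht].
rewrite /hz_boundary; apply: le_trans (ler_normcB _ _) _.
rewrite !Normc.normcM normc_real [`|24^-1|]ger0_norm ?invr_ge0 ?ler0n //.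
have k1 : normc (cpow y (Complex x t - 1)) <= 1.
  have := @normc_cpow_ge1 R y (Complex x t - 1) 0 y1.
  by rewrite expr0 invr1; apply; rewrite ReB /=; lra.
have k2 : normc (cpow y (Complex x t + 1)) <= 1.
  have := @normc_cpow_ge1 R y (Complex x t + 1) 0 y1.
  by rewrite expr0 invr1; apply; rewrite ReD /=; lra.
have k3 : normc (Complex x t - 1)^-1 <= h^-1.
  apply: normc_inv_le => //; apply: le_trans ht _.
  by have := abs_Im_le_normc (Complex x t - 1); rewrite ImB /= subr0.
have k4 : normc (Complex x t) <= 2 + `|t|.
  apply: le_trans (normc_le_abs _) _ => /=; rewrite lerD2r ger0_norm; lra.
apply: lerD.
  by rewrite -[h^-1]mulr1; apply: ler_pM => //; exact: normc_ge0.
rewrite mulrC ler_wpM2r ?invr_ge0 ?ler0n // -[2 + _]mulr1.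
by apply: ler_pM => //; exact: normc_ge0.
Qed.

Lemma normc_cpow_term alpha n x t : 0 < alpha <= 1 -> 1 <= x <= 2 ->
  normc (cpow (n%:R + alpha) (Complex x t)) <= alpha ^- 2.
Proof.
move=> /andP[a0 a1] /andP[x1 x2]; rewrite normc_cpow /=.
have na : alpha <= n%:R + alpha by rewrite lerDr.
have -> : alpha ^- 2 = expR (- 2 * ln alpha).
  by rewrite mulNr expRN expRM_natl lnK ?posrE.
rewrite ler_expR.
have l1 : ln alpha <= 0 by exact: ln_le0.
have l2 : ln alpha <= ln (n%:R + alpha).
  by rewrite ler_ln ?posrE //; apply: lt_le_trans na.
nra.
Qed.

(** Crude, but free of [N] and of [alpha]. *)
Lemma em_error_le N alpha t : (1 < N)%N -> 0 < alpha ->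
  (t + 6) ^+ 4 / 1600 * (N%:R + alpha - 2^-1 - 1) ^- 4 <= (t + 6) ^+ 4 / 100.
Proof.
move=> N1 a0; have N2 : (2 : R) <= N%:R by rewrite (ler_nat _ 2).
have -> : (t + 6) ^+ 4 / 100 = (t + 6) ^+ 4 / 1600 * 16 by field.
apply: ler_wpM2l; first by apply: mulr_ge0; [rewrite exprn_even_ge0 | rewrite invr_ge0 ler0n].
have -> : (16 : R) = 2^-1 ^- 4 by rewrite exprVn invrK -natrX.
by rewrite lef_pV2 ?posrE ?exprn_gt0 ?lerXn2r ?nnegrE ?invr_ge0 //; lra.
Qed.

Lemma pow4_le t B : 0 <= t -> t <= B -> (t + 6) ^+ 4 / 100 <= (B + 6) ^+ 4 / 100.
Proof.
move=> t0 tB; apply: ler_wpM2r; first by rewrite invr_ge0 ler0n.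
by apply: lerXn2r; rewrite ?nnegrE; lra.
Qed.

(** Two terms of the series, and twice the boundary term and the error; the factor
    2 leaves room in [partial_sum_bound]. *)
Definition line_bound alpha h t := 2 * alpha ^- 2 + 2 * (h^-1 + (2 + t) / 24) + 2 * ((t + 6) ^+ 4 / 100) : R.

Lemma line_bound_ge0 alpha h t : 0 <= alpha -> 0 <= h -> 0 <= t ->
  0 <= line_bound alpha h t.
Proof.
move=> a0 h0 t0; rewrite /line_bound.
have p : 0 <= (t + 6) ^+ 4 by apply: exprn_ge0; lra.
have q : 0 <= alpha ^- 2 by rewrite invr_ge0 exprn_ge0.
have z : 0 <= h^-1 by rewrite invr_ge0.
by move: p q z; move: (_ ^+ 4) (_ ^- 2) (h^-1) => a b c; lra.
Qed.

Lemma zeta_line_bound alpha f x t h B : is_hurwitz_zeta alpha f -> 0 < alpha <= 1 ->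
  1 <= x <= 2 -> 0 < h <= `|t| -> `|t| <= B ->
  normc (f (Complex x t)) <= line_bound alpha h B.
Proof.
move=> hf a01 x12 ht tB; have /andP[a0 a1] := a01; have /andP[h0 _] := ht.
have t0 : t != 0 by rewrite -normr_gt0; case/andP: ht => ? ?; apply: lt_le_trans h0 _.
have e1 := zeta_approx hf a0 x12 t0 (isT : (1 < 2)%N).
have e2 := @em_error_le 2 alpha `|t| isT a0.
have -> : f (Complex x t) = (f (Complex x t) - hz_approx 2 alpha (Complex x t)) +
   hz_approx 2 alpha (Complex x t) by ring.
apply: le_trans (le_normcD _ _) _.
have b : normc (hz_boundary (Complex x t) (2%:R + alpha - 2^-1)) <= h^-1 + (2 + `|t|) / 24.
  by apply: normc_hz_boundary_le => //; lra.
have s : normc (\sum_(0 <= n < 2) cpow (n%:R + alpha) (Complex x t)) <= 2 * alpha ^- 2.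
  rewrite !big_nat_recr //= big_geq // add0r mulr_natl mulr2n.
  by apply: le_trans (le_normcD _ _) _; apply: lerD; exact: normc_cpow_term.
have ap : normc (hz_approx 2 alpha (Complex x t)) <= 2 * alpha ^- 2 + (h^-1 + (2 + `|t|) / 24).
  by apply: le_trans (le_normcD _ _) _; exact: lerD.
have tB4 : (`|t| + 6) ^+ 4 / 100 <= (B + 6) ^+ 4 / 100.
  exact: pow4_le.
have B4 : 0 <= (B + 6) ^+ 4 / 100.
  by apply: mulr_ge0; [rewrite exprn_even_ge0 | rewrite invr_ge0 ler0n].
have hi : 0 < h^-1 by rewrite invr_gt0.
have t00 := normr_ge0 t.
rewrite /line_bound; move: (alpha ^- 2) s ap => A s ap.
lra.
Qed.

(** Partial sums of the Dirichlet series do not converge on the line, but stay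
    bounded away from the pole. *)
Lemma partial_sum_bound alpha f N x t h B : is_hurwitz_zeta alpha f -> 0 < alpha <= 1 ->
  1 <= x <= 2 -> 0 < h <= `|t| -> `|t| <= B -> (1 < N)%N ->
  normc (\sum_(0 <= n < N) cpow (n%:R + alpha) (Complex x t)) <= 2 * line_bound alpha h B.
Proof.
move=> hf a01 x12 ht tB N1; have /andP[a0 a1] := a01; have /andP[h0 _] := ht.
have t0 : t != 0 by rewrite -normr_gt0; case/andP: ht => ? ?; apply: lt_le_trans h0 _.
have e1 := zeta_approx hf a0 x12 t0 N1.
have e2 := @em_error_le N alpha `|t| N1 a0.
have N2 : (2 : R) <= N%:R by rewrite (ler_nat _ 2).
have b : normc (hz_boundary (Complex x t) (N%:R + alpha - 2^-1)) <= h^-1 + (2 + `|t|) / 24.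
  by apply: normc_hz_boundary_le => //; lra.
have z := zeta_line_bound hf a01 x12 ht tB.
have -> : \sum_(0 <= n < N) cpow (n%:R + alpha) (Complex x t) =
   f (Complex x t) - (f (Complex x t) - hz_approx N alpha (Complex x t)) -
   hz_boundary (Complex x t) (N%:R + alpha - 2^-1).
  by rewrite /hz_approx; ring.
apply: le_trans (ler_normcB _ _) _.
apply: le_trans (lerD (ler_normcB _ _) b) _.
have tB4 : (`|t| + 6) ^+ 4 / 100 <= (B + 6) ^+ 4 / 100.
  exact: pow4_le.
have B4 : 0 <= (B + 6) ^+ 4 / 100.
  by apply: mulr_ge0; [rewrite exprn_even_ge0 | rewrite invr_ge0 ler0n].
have hi : 0 < h^-1 by rewrite invr_gt0.
have A0 : 0 <= alpha ^- 2 by rewrite invr_ge0 exprn_ge0 // ltW.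
move: z; rewrite /line_bound; move: (alpha ^- 2) A0 => A A0 z.
lra.
Qed.

(** The term [1 / (s - 1)] of the boundary has modulus [1 / |t|] on the line, and
    the other terms are bounded. *)
Lemma zeta_pole_ge alpha f t : is_hurwitz_zeta alpha f -> 0 < alpha <= 1 ->
  0 < `|t| <= 1 ->
  `|t|^-1 - (2 * alpha ^- 2 + 50) <= normc (f (Complex 1 t)).
Proof.
move=> hf a01 /andP[t0 t1]; have /andP[a0 a1] := a01.
have tn0 : t != 0 by rewrite -normr_gt0.
have x12 : 1 <= (1:R) <= 2 by rewrite lexx ler1n.
have e1 := zeta_approx hf a0 x12 tn0 (isT : (1 < 2)%N).
have e2 := @em_error_le 2 alpha `|t| isT a0.
have s : normc (\sum_(0 <= n < 2) cpow (n%:R + alpha) (Complex 1 t)) <= 2 * alpha ^- 2.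
  rewrite !big_nat_recr //= big_geq // add0r mulr_natl mulr2n.
  by apply: le_trans (le_normcD _ _) _; apply: lerD; exact: normc_cpow_term.
have e3 : (`|t| + 6) ^+ 4 / 100 <= 7 ^+ 4 / 100.
  have -> : (7 : R) = 1 + 6 by ring.
  exact: pow4_le.
have y1 : 1 <= 2%:R + alpha - 2^-1 :> R by lra.
set y := 2%:R + alpha - 2^-1 in y1 *.
have k1 : normc ((Complex 1 t - 1)^-1 * cpow y (Complex 1 t - 1)) = `|t|^-1.
  have -> : Complex 1 t - 1 = Complex 0 t by apply: complex_ext; rewrite /= ?subrr ?subr0.
  by rewrite Normc.normcM Normc.normcV normc_im normc_cpow /= oppr0 mul0r expR0 mulr1.
have k2 : normc (((24^-1)%:C)%C * (Complex 1 t * cpow y (Complex 1 t + 1))) <= 1.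
  rewrite !Normc.normcM normc_real [`|24^-1|]ger0_norm ?invr_ge0 ?ler0n //.
  have k3 : normc (cpow y (Complex 1 t + 1)) <= 1.
    have := @normc_cpow_ge1 R y (Complex 1 t + 1) 0 y1.
    by rewrite expr0 invr1; apply; rewrite ReD /=; lra.
  have k4 : normc (Complex 1 t) <= 2.
    by apply: le_trans (normc_le_abs _) _ => /=; rewrite ger0_norm; lra.
  have := ler_pM (normc_ge0 _) (normc_ge0 _) k4 k3; lra.
have -> : f (Complex 1 t) = (Complex 1 t - 1)^-1 * cpow y (Complex 1 t - 1) -
  (((24^-1)%:C)%C * (Complex 1 t * cpow y (Complex 1 t + 1))
   - \sum_(0 <= n < 2) cpow (n%:R + alpha) (Complex 1 t)
   - (f (Complex 1 t) - hz_approx 2 alpha (Complex 1 t))).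
  by rewrite /hz_approx /hz_boundary -/y; ring.
apply: le_trans (ler_normcBr _ _); rewrite k1.
apply: lerB => //.
apply: le_trans (ler_normcB _ _) _.
apply: le_trans (lerD (ler_normcB _ _) (lexx _)) _.
move: (alpha ^- 2) s => A s; lra.
Qed.

End BoundaryLine.

(** * Integrals of continuous functions over a segment *)

Section SegmentIntegral.
Context {R : realType}.
Implicit Types (f g F : R -> R) (a b : R).
Local Notation mu := (@lebesgue_measure R).

Definition segint a b f : R := \int[mu]_(t in `[a, b]) f t.

Lemma continuous_segment_integrable a b f : continuous f ->
  mu.-integrable `[a, b] (EFin \o f).
Proof.
move=> cf; apply: continuous_compact_integrable; first exact: segment_compact.
exact: continuous_subspaceT.
Qed.

Lemma segintD a b f g : continuous f -> continuous g ->
  segint a b (fun t => f t + g t) = segint a b f + segint a b g.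
Proof.
move=> cf cg; rewrite /segint RintegralD //; exact: continuous_segment_integrable.
Qed.

Lemma segintZ a b k f : continuous f ->
  segint a b (fun t => k * f t) = k * segint a b f.
Proof. by move=> cf; rewrite /segint RintegralZl //; exact: continuous_segment_integrable. Qed.

Lemma continuous_bigsum (I : Type) (r : seq I) (h : I -> R -> R) :
  (forall i, continuous (h i)) -> continuous (fun t => \sum_(i <- r) h i t).
Proof.
move=> ch; elim: r => [|i r ih].
  have -> : (fun t => \sum_(i <- [::]) h i t) = (fun=> 0 : R).
    by apply/funext => t; rewrite big_nil.
  by move=> x; exact: cvg_cst.
have -> : (fun t => \sum_(j <- i :: r) h j t) = (fun t => h i t + \sum_(j <- r) h j t).
  by apply/funext => t; rewrite big_cons.
by move=> x; apply: cvgD; [exact: ch | exact: ih].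
Qed.

Lemma segint_sum a b (I : Type) (r : seq I) (h : I -> R -> R) :
  (forall i, continuous (h i)) ->
  segint a b (fun t => \sum_(i <- r) h i t) = \sum_(i <- r) segint a b (h i).
Proof.
move=> ch; elim: r => [|i r ih].
  rewrite big_nil /segint; under eq_Rintegral do rewrite big_nil.
  by rewrite Rintegral_cst // mul0r.
rewrite big_cons -ih -segintD //; last exact: continuous_bigsum.
by apply: eq_Rintegral => t _; rewrite big_cons.
Qed.

Lemma segint_le a b f g : continuous f -> continuous g ->
  (forall t, a <= t <= b -> f t <= g t) -> segint a b f <= segint a b g.
Proof.
move=> cf cg fg; rewrite /segint.
apply: le_Rintegral => //; exact: continuous_segment_integrable.
Qed.

Lemma segint_cst a b k : a <= b -> segint a b (fun=> k) = k * (b - a).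
Proof.
move=> ab; rewrite /segint Rintegral_cst //.
rewrite /= lebesgue_measure_itv /= lte_fin.
by move: ab; rewrite le_eqVlt => /predU1P[->|->] //=; rewrite ltxx subrr.
Qed.

Lemma segint_abs_le a b f K : a <= b -> continuous f ->
  (forall t, a <= t <= b -> `|f t| <= K) -> `|segint a b f| <= K * (b - a).
Proof.
move=> ab cf fK; have cK c : continuous (fun _ : R => c : R) by move=> x; exact: cvg_cst.
rewrite ler_norml -mulNr -!segint_cst //; apply/andP; split.
  by apply: segint_le => // t /fK; rewrite ler_norml => /andP[].
by apply: segint_le => // t /fK; rewrite ler_norml => /andP[].
Qed.

Lemma segint_FTC a b f F : a < b -> continuous f ->
  (forall t : R, is_derive t 1 F (f t)) -> segint a b f = F b - F a.
Proof.
move=> ab cf dF; rewrite /segint /Rintegral (@continuous_FTC2 _ _ F) //.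
- exact: continuous_subspaceT.
- split; first by move=> x _; case: (dF x).
  + by apply: cvg_at_right_filter; exact: (is_derive_continuous (dF a)).
  + by apply: cvg_at_left_filter; exact: (is_derive_continuous (dF b)).
- by move=> t _; rewrite derive1E; exact: (@derive_val _ _ _ _ _ _ _ (dF t)).
Qed.

End SegmentIntegral.

(** * Derivation rules at a point *)

Section PointwiseDerivatives.
Context {R : realType}.
Implicit Types (f g : R -> R) (x : R).

Lemma der_eq f x a b : is_derive x 1 f a -> a = b -> is_derive x 1 f b.
Proof. by move=> h <-. Qed.
Lemma der_cst (k : R) x : is_derive x 1 (fun _ : R => k) 0.
Proof. exact: is_derive_cst. Qed.
Lemma der_id x : is_derive x 1 (fun t : R => t) 1.
Proof. exact: is_derive_id. Qed.
Lemma der_add f g x a b : is_derive x 1 f a -> is_derive x 1 g b ->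
  is_derive x 1 (fun t => f t + g t) (a + b).
Proof. by move=> h k; exact: is_deriveD. Qed.
Lemma der_sub f g x a b : is_derive x 1 f a -> is_derive x 1 g b ->
  is_derive x 1 (fun t => f t - g t) (a - b).
Proof. by move=> h k; exact: is_deriveB. Qed.
Lemma der_mul f g x a b : is_derive x 1 f a -> is_derive x 1 g b ->
  is_derive x 1 (fun t => f t * g t) (f x * b + g x * a).
Proof. by move=> h k; exact: is_deriveM. Qed.
Lemma der_scale (k : R) f x a : is_derive x 1 f a ->
  is_derive x 1 (fun t => k * f t) (k * a).
Proof. by move=> h; exact: is_deriveZ. Qed.
Lemma der_pow n f x a : is_derive x 1 f a ->
  is_derive x 1 (fun t => f t ^+ n.+1) (n.+1%:R * f x ^+ n * a).
Proof.
move=> h; have -> : (fun t => f t ^+ n.+1) = f ^+ n.+1 by apply/funext => t; rewrite fctE.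
by apply: (der_eq (is_deriveX n.+1 h)); rewrite /GRing.scale.
Qed.
Lemma der_cos f x a : is_derive x 1 f a ->
  is_derive x 1 (fun t => cos (f t)) (- sin (f x) * a).
Proof. by move=> h; exact: (is_derive1_comp (is_derive_cos (f x)) h). Qed.
Lemma der_sin f x a : is_derive x 1 f a ->
  is_derive x 1 (fun t => sin (f t)) (cos (f x) * a).
Proof. by move=> h; exact: (is_derive1_comp (is_derive_sin (f x)) h). Qed.
Lemma der_affine (y c th x : R) : is_derive x 1 (fun t => y * (t - c) + th) y.
Proof.
apply: (der_eq (der_add (der_scale y (der_sub (der_id x) (der_cst c x))) (der_cst th x))).
by rewrite subr0 mulr1 addr0.
Qed.
Lemma der_continuous f (f' : R -> R) : (forall x : R, is_derive x 1 f (f' x)) -> continuous f.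
Proof. by move=> h x; exact: is_derive_continuous (h x). Qed.

Lemma continuous_add f g : continuous f -> continuous g ->
  continuous (fun t => f t + g t).
Proof. by move=> cf cg x; apply: cvgD; [exact: cf | exact: cg]. Qed.

Lemma continuous_mul f g : continuous f -> continuous g ->
  continuous (fun t => f t * g t).
Proof. by move=> cf cg x; apply: cvgM; [exact: cf | exact: cg]. Qed.

Lemma sin_sqr_le x : sin x ^+ 2 <= x ^+ 2.
Proof.
wlog x0 : x / 0 <= x.
  move=> h; have [/h //|/ltW x0] := leP 0 x.
  by have := h (- x); rewrite oppr_ge0 sinN !sqrrN => /(_ x0).
have := @Cderiv_lipschitz R (fun t => ((sin t)%:C)%C) (fun t => ((cos t)%:C)%C) 1 0 x x0.
rewrite subr0 mul1r sin0 rmorph0 subr0 normc_real => h.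
rewrite -(real_normK (num_real (sin x))) lerXn2r ?nnegrE //; apply: h.
  by move=> t _; apply: Cderiv_real; exact: is_derive_sin.
by move=> t _; rewrite normc_real cos_max.
Qed.

End PointwiseDerivatives.

(** * Cosine transforms of powers of a parabola *)

Section Moments.
Context {R : realType}.
Variables (r c : R).
Hypothesis r_gt0 : 0 < r.
Implicit Types (y th t u : R) (k : nat).

Definition bump k t := (r ^+ 2 - (t - c) ^+ 2) ^+ k.

(** Cosine transform, with phase [th], of a power of the parabola supported on
    [[c - r, c + r]]. *)
Definition moment k y th :=
  segint (c - r) (c + r) (fun t => bump k t * cos (y * (t - c) + th)).

Lemma der_bumpS k t : is_derive t 1 (bump k.+1) (- (2 * k.+1%:R) * (bump k t * (t - c))).
Proof.
have h := der_sub (der_cst (r ^+ 2) t) (der_pow 1 (der_sub (der_id t) (der_cst c t))).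
apply: (der_eq (der_pow k h)); rewrite -/(bump k t); ring.
Qed.

Lemma continuous_bump k : continuous (bump k).
Proof.
case: k => [|k]; last exact: der_continuous (der_bumpS k).
have -> : bump 0 = fun=> 1 by apply/funext => t; rewrite /bump expr0.
by move=> x; exact: cvg_cst.
Qed.

Lemma continuous_cos_affine y th : continuous (fun t => cos (y * (t - c) + th)).
Proof. apply: der_continuous => x; exact: der_cos (der_affine y c th x). Qed.

Lemma continuous_sin_affine y th : continuous (fun t => sin (y * (t - c) + th)).
Proof. apply: der_continuous => x; exact: der_sin (der_affine y c th x). Qed.

Lemma continuous_bump_cos k y th :
  continuous (fun t => bump k t * cos (y * (t - c) + th)).
Proof.
by move=> x; apply: cvgM; [exact: continuous_bump | exact: continuous_cos_affine].
Qed.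

Lemma continuous_bump_sin k y th :
  continuous (fun t => bump k t * (t - c) * sin (y * (t - c) + th)).
Proof.
move=> x; apply: cvgM; last exact: continuous_sin_affine.
apply: cvgM; first exact: continuous_bump.
exact: (is_derive_continuous (der_sub (der_id x) (der_cst c x))).
Qed.

Lemma abs_center_le t : c - r <= t <= c + r -> `|t - c| <= r.
Proof. by move=> tr; rewrite ler_norml; apply/andP; split; lra. Qed.

Lemma bump_base t : c - r <= t <= c + r -> 0 <= r ^+ 2 - (t - c) ^+ 2 <= r ^+ 2.
Proof.
move=> tr; rewrite lerBlDr lerDl sqr_ge0 andbT subr_ge0.
have {}tr := abs_center_le tr.
by rewrite -(real_normK (num_real (t - c))) lerXn2r ?nnegrE // ltW.
Qed.

Lemma bump_ge0 k t : c - r <= t <= c + r -> 0 <= bump k t.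
Proof. by move=> /bump_base/andP[h _]; exact: exprn_ge0. Qed.

Lemma bump_le k t : c - r <= t <= c + r -> bump k t <= r ^+ (2 * k).
Proof.
move=> /bump_base/andP[h k1]; rewrite /bump exprM.
by rewrite lerXn2r ?nnegrE // exprn_ge0 // ltW.
Qed.

Lemma abs_moment_le k y th : `|moment k y th| <= 2 * r ^+ (2 * k).+1.
Proof.
have -> : 2 * r ^+ (2 * k).+1 = r ^+ (2 * k) * ((c + r) - (c - r)) by rewrite exprS; ring.
apply: segint_abs_le; first by move: r_gt0 => r0; lra.
- exact: continuous_bump_cos.
- move=> t tr; rewrite normrM ger0_norm ?bump_ge0 // -[r ^+ _]mulr1.
  by apply: ler_pM; rewrite ?bump_ge0 ?bump_le // cos_max.
Qed.

Lemma moment_sin k y th :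
  segint (c - r) (c + r) (fun t => bump k t * (t - c) * sin (y * (t - c) + th)) =
  y / (2 * k.+1%:R) * moment k.+1 y th.
Proof.
have k0 : (2 * k.+1%:R : R) != 0 by rewrite mulf_neq0 ?pnatr_eq0.
have d t := der_mul (der_bumpS k t) (der_sin (der_affine y c th t)).
pose g t := bump k.+1 t * (cos (y * (t - c) + th) * y) +
  sin (y * (t - c) + th) * (- (2 * k.+1%:R) * (bump k t * (t - c))).
have gE t : g t = y * (bump k.+1 t * cos (y * (t - c) + th)) +
   - (2 * k.+1%:R) * (bump k t * (t - c) * sin (y * (t - c) + th)) by rewrite /g; ring.
have r0 := r_gt0.
have cyc (a : R) (f : R -> R) : continuous f -> continuous (fun t : R => a * f t :> R).
  by move=> cf x; apply: cvgM; [exact: cvg_cst | exact: cf].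
have : segint (c - r) (c + r) g = 0.
  rewrite (@segint_FTC _ _ _ g (fun t => bump k.+1 t * sin (y * (t - c) + th))).
  - have -> : bump k.+1 (c + r) = 0 by rewrite /bump (_ : c + r - c = r) ?subrr ?exprS ?mul0r //; ring.
    have -> : bump k.+1 (c - r) = 0 by rewrite /bump (_ : c - r - c = - r) ?sqrrN ?subrr ?exprS ?mul0r //; ring.
    by rewrite !mul0r subrr.
  - by lra.
  - have -> : g = (fun t => y * (bump k.+1 t * cos (y * (t - c) + th)) +
      - (2 * k.+1%:R) * (bump k t * (t - c) * sin (y * (t - c) + th))) by exact/funext.
    by apply: continuous_add; apply: cyc; [exact: continuous_bump_cos | exact: continuous_bump_sin].
have -> : g = (fun t => y * (bump k.+1 t * cos (y * (t - c) + th)) +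
      - (2 * k.+1%:R) * (bump k t * (t - c) * sin (y * (t - c) + th))) by exact/funext.
rewrite segintD; [|by apply: cyc; exact: continuous_bump_cos|by apply: cyc; exact: continuous_bump_sin].
rewrite !segintZ; [|exact: continuous_bump_sin|exact: continuous_bump_cos].
rewrite -/(moment k.+1 y th) mulNr => /eqP; rewrite subr_eq0 => /eqP e.
by rewrite mulrAC e mulrAC divff ?mul1r.
Qed.

(** Differentiation in the frequency raises the index: this is what makes all
    moments Taylor coefficients of one function of [y ^ 2]. *)
Lemma der_moment k y th :
  is_derive y 1 (fun y => moment k y th) (- (y / (2 * k.+1%:R) * moment k.+1 y th)).
Proof.
have r0 := r_gt0; pose f y t := bump k t * cos (y * (t - c) + th).
have df (x t : R) : is_derive x 1 (f ^~ t) (- (bump k t * (t - c) * sin (x * (t - c) + th))).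
  have h : is_derive x 1 (fun x => x * (t - c) + th) (t - c).
    apply: (der_eq (der_add (der_mul (der_id x) (der_cst (t - c) x)) (der_cst th x))).
    by rewrite mulr0 add0r mulr1 addr0.
  by apply: (der_eq (der_scale (bump k t) (der_cos h))); ring.
have d1 (x t : R) : partial1of2 f x t = - (bump k t * (t - c) * sin (x * (t - c) + th)).
  by rewrite /partial1of2 derive1E; exact: (@derive_val _ _ _ _ _ _ _ (df x t)).
have Iy : [set` `]y - 1, y + 1[ ] y by rewrite /= in_itv /=; apply/andP; split; lra.
have If (x : R) : [set` `]y - 1, y + 1[ ] x ->
    (@lebesgue_measure R).-integrable `[c - r, c + r] (EFin \o f x).
  by move=> _; apply: continuous_segment_integrable; exact: continuous_bump_cos.
have dfd (x t : R) : [set` `]y - 1, y + 1[ ] x -> [set` `[c - r, c + r] ] t -> derivable (f ^~ t) x 1.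
  by move=> _ _; case: (df x t).
have G0 (t : R) : 0 <= (fun _ : R => r ^+ (2 * k) * r) t by rewrite mulr_ge0 ?exprn_ge0 ?ltW.
have IG : (@lebesgue_measure R).-integrable `[c - r, c + r] (EFin \o (fun _ : R => r ^+ (2 * k) * r)).
  by apply: continuous_segment_integrable => x; exact: cvg_cst.
have GB (x t : R) : [set` `]y - 1, y + 1[ ] x -> [set` `[c - r, c + r] ] t ->
    `|partial1of2 f x t| <= (fun _ : R => r ^+ (2 * k) * r) t.
  rewrite /= !in_itv /= => _ tr; rewrite d1 normrN !normrM -[r ^+ _ * r]mulr1.
  apply: ler_pM; rewrite ?mulr_ge0 ?sin_max //.
  apply: ler_pM => //; first by rewrite ger0_norm ?bump_ge0 ?bump_le.
  exact: abs_center_le.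
have D := @derivable_under_integral R _ _ (@lebesgue_measure R) f `[c - r, c + r] (measurable_itv _)
  y (y - 1) (y + 1) Iy If dfd _ G0 IG GB.
have V := @differentiation_under_integral R _ _ (@lebesgue_measure R) f `[c - r, c + r] (measurable_itv _)
  y (y - 1) (y + 1) Iy If dfd _ G0 IG GB.
apply: DeriveDef; first exact: D.
rewrite -derive1E V -moment_sin -[RHS]mulN1r -segintZ; last exact: continuous_bump_sin.
by apply: eq_Rintegral => t _; rewrite d1 mulN1r.
Qed.

(** Repeated integration by parts, up to the last derivative of the polynomial.
    The boundary values of [bump 2] and of its derivative vanish, which leaves
    the order [u ^ -3]. *)
Lemma moment2_le u th : 0 < u ->
  `|moment 2 u th| <= 16 * r ^+ 2 / u ^+ 3 + 48 * r / u ^+ 4 + 48 / u ^+ 5.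
Proof.
move=> u0; have un : u != 0 by rewrite gt_eqF.
have r0 := r_gt0.
pose C t := cos (u * (t - c) + th); pose S t := sin (u * (t - c) + th).
pose F t := bump 2 t * S t / u - 4 * (bump 1 t * (t - c)) * C t / u ^+ 2
   - (12 * (t - c) ^+ 2 - 4 * r ^+ 2) * S t / u ^+ 3
   - 24 * (t - c) * C t / u ^+ 4 + 24 * S t / u ^+ 5.
have dF (t : R) : is_derive t 1 F (bump 2 t * C t).
  have a := der_affine u c th t.
  have s := der_sin a; have k := der_cos a.
  have l := der_sub (der_id t) (der_cst c t).
  have b2 := der_bumpS 1 t; have b1 := der_bumpS 0 t.
  have q1 := der_mul (der_mul b2 s) (der_cst u^-1 t).
  have q2 := der_mul (der_mul (der_scale 4 (der_mul b1 l)) k) (der_cst (u ^+ 2)^-1 t).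
  have q3 := der_mul (der_mul (der_sub (der_scale 12 (der_pow 1 l)) (der_cst (4 * r ^+ 2) t)) s) (der_cst (u ^+ 3)^-1 t).
  have q4 := der_mul (der_mul (der_scale 24 l) k) (der_cst (u ^+ 4)^-1 t).
  have q5 := der_mul (der_scale 24 s) (der_cst (u ^+ 5)^-1 t).
  apply: (der_eq (der_add (der_sub (der_sub (der_sub q1 q2) q3) q4) q5)).
  rewrite /C /S /bump; move: (sin _) (cos _) => x z.
  by field.
have -> : moment 2 u th = F (c + r) - F (c - r).
  apply: segint_FTC => //; first by lra.
  exact: continuous_bump_cos.
have zp : c + r - c = r by ring.
have zm : c - r - c = - r by ring.
have b0 k : bump k.+1 (c + r) = 0 by rewrite /bump zp subrr exprS mul0r.
have b1 k : bump k.+1 (c - r) = 0 by rewrite /bump zm sqrrN subrr exprS mul0r.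
have -> : F (c + r) - F (c - r) = - (8 * r ^+ 2 / u ^+ 3) * (S (c + r) - S (c - r))
   - 24 * r / u ^+ 4 * (C (c + r) + C (c - r)) + 24 / u ^+ 5 * (S (c + r) - S (c - r)).
  rewrite /F !b0 !b1 zp zm sqrrN; move: (C _) (C _) (S _) (S _) => x1 x2 x3 x4.
  by field.
have p3 : 0 < u ^+ 3 by rewrite exprn_gt0.
have p4 : 0 < u ^+ 4 by rewrite exprn_gt0.
have p5 : 0 < u ^+ 5 by rewrite exprn_gt0.
have Sb : `|S (c + r) - S (c - r)| <= 2.
  by apply: le_trans (ler_normB _ _) _; have := lerD (sin_max (u * (c + r - c) + th)) (sin_max (u * (c - r - c) + th)); rewrite -[1 + 1]/(2%:R).
have Cb : `|C (c + r) + C (c - r)| <= 2.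
  by apply: le_trans (ler_normD _ _) _; have := lerD (cos_max (u * (c + r - c) + th)) (cos_max (u * (c - r - c) + th)); rewrite -[1 + 1]/(2%:R).
have bnd a x : 0 <= a -> `|x| <= 2 -> `|a * x| <= a * 2 :> R.
  by move=> a0 x2; rewrite normrM ger0_norm // ler_wpM2l.
apply: le_trans (ler_normD _ _) _.
have -> : 16 * r ^+ 2 / u ^+ 3 + 48 * r / u ^+ 4 + 48 / u ^+ 5 =
  8 * r ^+ 2 / u ^+ 3 * 2 + 24 * r / u ^+ 4 * 2 + 24 / u ^+ 5 * 2 by field.
apply: lerD; last by apply: bnd => //; rewrite divr_ge0 // ltW.
apply: le_trans (ler_normB _ _) _; apply: lerD.
  rewrite mulNr normrN; apply: bnd => //.
  by rewrite divr_ge0 ?mulr_ge0 ?sqr_ge0 // ltW.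
by apply: bnd => //; rewrite divr_ge0 ?mulr_ge0 // ltW.
Qed.

(** [cos x >= 1 - x ^ 2 / 2] with [|t - c| <= r], and the integral of [bump 2] is
    [16 / 15 * r ^ 5]. *)
Lemma moment2_ge u : 16 / 15 * r ^+ 5 * (1 - (u * r) ^+ 2 / 2) <= moment 2 u 0.
Proof.
have r0 := r_gt0.
have cb : continuous (fun t => bump 2 t * (1 - (u * r) ^+ 2 / 2)).
  by move=> x; apply: cvgM; [exact: continuous_bump | exact: cvg_cst].
apply: (@le_trans _ _ (segint (c - r) (c + r) (fun t => bump 2 t * (1 - (u * r) ^+ 2 / 2)))).
  pose F t := (1 - (u * r) ^+ 2 / 2) * (r ^+ 4 * (t - c) - 2 / 3 * r ^+ 2 * (t - c) ^+ 3 + (t - c) ^+ 5 / 5).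
  have -> : segint (c - r) (c + r) (fun t => bump 2 t * (1 - (u * r) ^+ 2 / 2)) =
      F (c + r) - F (c - r).
    apply: segint_FTC; [by lra | exact: cb | move=> t].
    have l := der_sub (der_id t) (der_cst c t).
    apply: (der_eq (der_scale (1 - (u * r) ^+ 2 / 2) (der_add (der_sub (der_scale (r ^+ 4) l)
      (der_scale (2 / 3 * r ^+ 2) (der_pow 2 l))) (der_mul (der_pow 4 l) (der_cst 5^-1 t))))).
    by rewrite /bump; field.
  by rewrite le_eqVlt; apply/orP; left; apply/eqP; rewrite /F; field.
apply: segint_le; first exact: cb.
  exact: continuous_bump_cos.
move=> t tr; rewrite ler_wpM2l ?bump_ge0 // addr0.
have cosge (x : R) : 1 - x ^+ 2 / 2 <= cos x.
  have -> : x = (x / 2) *+ 2 by rewrite -mulr_natr; field.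
  rewrite cos_mulr2n cos2sin2.
  have : sin (x / 2) ^+ 2 <= (x / 2) ^+ 2.
    exact: sin_sqr_le.
  move: (x / 2) (sin _) => z w h.
  have -> : (z *+ 2) ^+ 2 = 4 * z ^+ 2 by ring.
  by rewrite (mulr2n (1 - _)); lra.
apply: le_trans (cosge _); rewrite lerD2l lerN2 ler_wpM2r ?invr_ge0 //.
rewrite !exprMn ler_wpM2l ?sqr_ge0 //.
by have /andP[] := bump_base tr; rewrite subr_ge0.
Qed.

End Moments.

(** * The test weight *)

Section TestWeight.
Context {R : realType}.
Implicit Types (j k m n K : nat).

(** Taylor coefficients of the modified Bessel function behind the weight. *)
Definition wcoef j : R := \prod_(i < j) (4 * i.+1%:R * i.+3%:R)^-1.

Lemma wcoef0 : wcoef 0 = 1.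
Proof. by rewrite /wcoef big_ord0. Qed.

Lemma wcoefS j : wcoef j.+1 = wcoef j * (4 * j.+1%:R * j.+3%:R)^-1.
Proof. by rewrite /wcoef big_ord_recr. Qed.

Lemma wcoef_gt0 j : 0 < wcoef j.
Proof. by apply: prodr_gt0 => i _; rewrite invr_gt0 !mulr_gt0. Qed.

Lemma wcoef_le j : wcoef j <= ((2 * j)`!%:R)^-1.
Proof.
elim: j => [|j ih]; first by rewrite wcoef0 muln0 fact0 invr1.
have -> : (2 * j.+1)%N = (2 * j).+2 by rewrite mulnS.
rewrite wcoefS !factS !natrM.
have f0 : 0 < ((2 * j)`!%:R : R) by rewrite ltr0n fact_gt0.
have -> : ((2 * j).+2%:R * ((2 * j).+1%:R * (2 * j)`!%:R))^-1 =
  ((2 * j)`!%:R)^-1 * ((2 * j).+2%:R * (2 * j).+1%:R)^-1 :> R.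
  by rewrite mulrA invfM mulrC.
apply: ler_pM => //; first exact/ltW/wcoef_gt0.
rewrite lef_pV2 ?posrE ?mulr_gt0 //.
rewrite -!natrM ler_nat; lia.
Qed.

Lemma wcoef_partial_sum (a : R) K : 0 <= a ->
  \sum_(0 <= j < K) wcoef j * a ^+ (2 * j) <= expR a.
Proof.
move=> a0.
have nd : nondecreasing_seq (series (exp_coeff a)).
  by apply: nondecreasing_series => n _ _; exact: exp_coeff_ge0.
apply: (@le_trans _ _ (series (exp_coeff a) (2 * K)%N)); last first.
  exact: nondecreasing_cvgn_le nd (is_cvg_series_exp_coeff a) _.
rewrite /series /=; elim: K => [|K ih]; first by rewrite muln0 !big_geq.
have -> : (2 * K.+1)%N = (2 * K).+2 by rewrite mulnS.
rewrite !big_nat_recr //= -addrA; apply: lerD => //.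
apply: ler_wpDr; first exact: exp_coeff_ge0.
rewrite /exp_coeff /= mulrC ler_wpM2l ?exprn_ge0 //.
exact: wcoef_le.
Qed.

(** The remainder in [transform_close]. *)
Lemma wcoef_tail_small (a e : R) : 0 <= a -> 0 < e ->
  exists m, m.+1%:R * wcoef m.+1 * a ^+ (2 * m.+1) <= e.
Proof.
move=> a0 e0.
have e1 : 0 < e / (a + 1) by rewrite divr_gt0 // ltr_wpDl.
have /cvgrPdist_lt /(_ _ e1) [N _ hN] := cvg_exp_coeff a.
exists N; have := hN (2 * N).+1 (leqW (leq_pmull _ (isT : 0 < 2)%N)).
rewrite /= sub0r normrN ger0_norm ?exp_coeff_ge0 // ltr_pdivlMr ?ltr_wpDl //.
move=> h; apply/ltW; apply: le_lt_trans h.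
have -> : (2 * N.+1)%N = (2 * N).+2 by rewrite mulnS.
have q0 : 0 <= exp_coeff a (2 * N).+1 by exact: exp_coeff_ge0.
apply: (@le_trans _ _ (exp_coeff a (2 * N).+1 * a)); last by rewrite ler_wpM2l // lerDl.
have := wcoef_le N.+1; have -> : (2 * N.+1)%N = (2 * N).+2 by rewrite mulnS.
rewrite factS natrM invfM => hw.
have w1 : N.+1%:R * wcoef N.+1 <= ((2 * N).+1`!%:R)^-1.
  apply: (@le_trans _ _ (N.+1%:R * (((2 * N).+2%:R)^-1 * ((2 * N).+1`!%:R)^-1))).
    by rewrite ler_wpM2l.
  rewrite mulrA -[leRHS]mul1r ler_wpM2r ?invr_ge0 // ler_pdivrMr // mul1r ler_nat; lia.
rewrite /exp_coeff /= [leRHS]mulrAC -exprSr [leRHS]mulrC.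
by rewrite ler_wpM2r ?exprn_ge0.
Qed.

Variables (r c : R).
Hypothesis r_gt0 : 0 < r.

(** Expanding the transform of the weight of parameter [A] at frequency
    [sqrt (q + s)], with [s] running from [0] to [A ^ 2]. *)
Definition transform q th K s : R :=
  \sum_(0 <= j < K) wcoef j * s ^+ j * moment r c j.+2 (Num.sqrt (q + s)) th.

Lemma der_moment_sqrt k q th (s : R) : 0 < q + s ->
  is_derive s 1 (fun s => moment r c k (Num.sqrt (q + s)) th)
    (- (moment r c k.+1 (Num.sqrt (q + s)) th / (4 * k.+1%:R))).
Proof.
move=> qs.
have h1 : is_derive s 1 (fun s => q + s) 1.
  by apply: (der_eq (der_add (der_cst q s) (der_id s))); rewrite add0r.
have h2 := @is_derive1_comp R Num.sqrt (fun s => q + s) s _ _ (is_derive1_sqrt qs) h1.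
have h3 := @is_derive1_comp R (fun w => moment r c k w th) (fun s => Num.sqrt (q + s)) s _ _
  (der_moment c r_gt0 k (Num.sqrt (q + s)) th) h2.
apply: (der_eq h3).
have w0 : Num.sqrt (q + s) != 0 by rewrite gt_eqF // sqrtr_gt0.
move: (Num.sqrt _) w0 (moment _ _ _ _ _) => w w0 M.
have k0 : (k.+1%:R : R) != 0 by rewrite pnatr_eq0.
by move: (k.+1%:R) k0 => n k0; field; rewrite ?w0 ?k0.
Qed.

(** All but the last term cancel, by the recursion defining [wcoef]. *)
Lemma der_transform q th m (s : R) : 0 < q + s ->
  is_derive s 1 (transform q th m.+1)
    (- (m.+1%:R * wcoef m.+1 * s ^+ m * moment r c m.+3 (Num.sqrt (q + s)) th)).
Proof.
move=> qs; elim: m => [|m ih].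
  have -> : transform q th 1 = (fun s => moment r c 2 (Num.sqrt (q + s)) th).
    by apply/funext => t; rewrite /transform big_nat1 wcoef0 expr0 !mul1r.
  apply: (der_eq (der_moment_sqrt 2 th qs)).
  rewrite wcoefS wcoef0 expr0 mulr1 !mul1r; move: (moment _ _ _ _ _) => M.
  by field.
have -> : transform q th m.+2 = (fun s => transform q th m.+1 s +
    wcoef m.+1 * (s ^+ m.+1 * moment r c m.+3 (Num.sqrt (q + s)) th)).
  by apply/funext => t; rewrite /transform [LHS]big_nat_recr //= mulrA.
apply: (der_eq (der_add ih (der_scale (wcoef m.+1)
  (der_mul (der_pow m (der_id s)) (der_moment_sqrt m.+3 th qs))))).
rewrite (wcoefS m.+1) exprS.
move: (wcoef _) (moment _ _ _ _ _) (moment _ _ _ _ _) (s ^+ m) => w M1 M2 S.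
have k0 : (m.+2%:R : R) != 0 by rewrite pnatr_eq0.
have k1 : (m.+4%:R : R) != 0 by rewrite pnatr_eq0.
by move: (m.+2%:R) (m.+4%:R) k0 k1 => n1 n2 k0 k1; field; rewrite ?k0 ?k1.
Qed.

Lemma transform_close q th m (A : R) : 0 < q -> 0 <= A ->
  `|transform q th m.+1 (A ^+ 2) - moment r c 2 (Num.sqrt q) th| <=
  2 * r ^+ 5 * (m.+1%:R * wcoef m.+1 * (A * r) ^+ (2 * m.+1)).
Proof.
move=> q0 A0; have r0 := r_gt0.
have -> : moment r c 2 (Num.sqrt q) th = transform q th m.+1 0.
  rewrite /transform big_nat_recl // expr0 wcoef0 !mul1r addr0 big1_seq ?addr0 //.
  by move=> i _; rewrite exprS mul0r mulr0 mul0r.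
have A2 : 0 <= A ^+ 2 by rewrite sqr_ge0.
set K := m.+1%:R * wcoef m.+1 * A ^+ (2 * m) * (2 * r ^+ (2 * m.+3).+1).
have := @Cderiv_lipschitz R (fun s => ((transform q th m.+1 s)%:C)%C)
  (fun s => ((- (m.+1%:R * wcoef m.+1 * s ^+ m * moment r c m.+3 (Num.sqrt (q + s)) th))%:C)%C)
  K 0 (A ^+ 2) A2.
rewrite subr0 -rmorphB normc_real => h; apply: le_trans (h _ _) _.
- by move=> s /andP[s0 _]; apply/Cderiv_real/der_transform; rewrite ltr_wpDr.
- move=> s /andP[s0 sA]; rewrite normc_real normrN /K normrM.
  apply: ler_pM => //; last exact: abs_moment_le.
  have w0 : 0 <= m.+1%:R * wcoef m.+1 by rewrite mulr_ge0 // ltW // wcoef_gt0.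
  rewrite ger0_norm; last by rewrite mulr_ge0 // exprn_ge0.
  by rewrite ler_wpM2l // exprM lerXn2r ?nnegrE.
rewrite /K le_eqVlt; apply/orP; left; apply/eqP.
have -> : (2 * m.+3).+1 = (2 * m.+1 + 5)%N by lia.
have eA : A ^+ (2 * m.+1) = A ^+ (2 * m) * A ^+ 2 by rewrite -exprD; congr (_ ^+ _); lia.
rewrite exprD exprMn eA.
by move: (A ^+ (2 * m)) (r ^+ (2 * m.+1)) => x z; ring.
Qed.

(** The generating function of the moments: its transform at the frequency [y]
    is [transform] at [s = A ^ 2]. *)
Definition weight (A : R) K t : R := \sum_(0 <= j < K) wcoef j * A ^+ (2 * j) * bump r c j.+2 t.

Lemma continuous_weight A K : continuous (weight A K).
Proof.
apply: continuous_bigsum => j; apply: continuous_mul; last exact: continuous_bump.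
by move=> x; exact: cvg_cst.
Qed.

Lemma weight_ge0 A K t : 0 <= A -> c - r <= t <= c + r -> 0 <= weight A K t.
Proof.
move=> A0 tr; apply: sumr_ge0 => j _; apply: mulr_ge0; last exact: bump_ge0.
by rewrite mulr_ge0 ?exprn_ge0 // ltW // wcoef_gt0.
Qed.

Lemma weight_le A K t : 0 <= A -> c - r <= t <= c + r ->
  weight A K t <= r ^+ 4 * expR (A * r).
Proof.
move=> A0 tr; have r0 := r_gt0.
have Ar : 0 <= A * r by rewrite mulr_ge0 // ltW.
apply: (@le_trans _ _ (r ^+ 4 * \sum_(0 <= j < K) wcoef j * (A * r) ^+ (2 * j))); last first.
  by apply: ler_wpM2l; [rewrite exprn_ge0 // ltW | exact: wcoef_partial_sum].
rewrite mulr_sumr; apply: ler_sum => j _.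
have -> : r ^+ 4 * (wcoef j * (A * r) ^+ (2 * j)) = wcoef j * A ^+ (2 * j) * r ^+ (2 * j.+2).
  have -> : (2 * j.+2 = 4 + 2 * j)%N by lia.
  by rewrite exprD exprMn; move: (A ^+ (2 * j)) (r ^+ (2 * j)) => x z; ring.
apply: ler_wpM2l; first by rewrite mulr_ge0 ?exprn_ge0 // ltW // wcoef_gt0.
exact: bump_le.
Qed.

Lemma segint_weight A K y th :
  segint (c - r) (c + r) (fun t => weight A K t * cos (y * (t - c) + th)) =
  \sum_(0 <= j < K) wcoef j * A ^+ (2 * j) * moment r c j.+2 y th.
Proof.
have -> : (fun t => weight A K t * cos (y * (t - c) + th)) =
   (fun t => \sum_(0 <= j < K) wcoef j * A ^+ (2 * j) * (bump r c j.+2 t * cos (y * (t - c) + th))).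
  by apply/funext => t; rewrite /weight mulr_suml; apply: eq_bigr => j _; rewrite mulrA.
rewrite segint_sum; last first.
  move=> j; apply: continuous_mul; last exact: continuous_bump_cos.
  by move=> x; exact: cvg_cst.
by apply: eq_bigr => j _; rewrite segintZ //; exact: continuous_bump_cos.
Qed.

(** Up to [e], the transform of [W] at the frequency [y] is that of [bump 2] at the
    frequency [sqrt (y ^ 2 - (a / r) ^ 2)]. So it is of full size when [y] is near
    [a / r] and decays beyond; the price is the factor [expR a] in the maximum
    of [W]. *)
Lemma weight_exists (a e : R) : 0 <= a -> 0 < e ->
  exists W : R -> R, [/\ continuous W,
    forall t, c - r <= t <= c + r -> 0 <= W t <= r ^+ 4 * expR a &
    forall y th, a / r < y ->
     `|segint (c - r) (c + r) (fun t => W t * cos (y * (t - c) + th))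
       - moment r c 2 (Num.sqrt (y ^+ 2 - (a / r) ^+ 2)) th| <= e].
Proof.
move=> a0 e0; have r0 := r_gt0.
have e1 : 0 < e / (2 * r ^+ 5) by rewrite divr_gt0 // mulr_gt0 // exprn_gt0.
have [m hm] := wcoef_tail_small a0 e1.
have A0 : 0 <= a / r by rewrite divr_ge0 // ltW.
have Ar : a / r * r = a by rewrite divfK // gt_eqF.
exists (weight (a / r) m.+1); split.
- exact: continuous_weight.
- move=> t tr; rewrite weight_ge0 //=.
  by have := weight_le m.+1 A0 tr; rewrite Ar.
- move=> y th ya; rewrite segint_weight.
  have y0 : 0 <= y by apply: le_trans A0 (ltW ya).
  have q0 : 0 < y ^+ 2 - (a / r) ^+ 2 by rewrite subr_gt0 ltrXn2r.
  have := transform_close th m q0 A0; rewrite Ar.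
  have -> : transform (y ^+ 2 - (a / r) ^+ 2) th m.+1 ((a / r) ^+ 2) =
     \sum_(0 <= j < m.+1) wcoef j * (a / r) ^+ (2 * j) * moment r c j.+2 y th.
    rewrite /transform subrK sqrtr_sqr ger0_norm //.
    by apply: eq_bigr => j _; rewrite -exprM.
  move=> h; apply: le_trans h _.
  by rewrite mulrC -ler_pdivlMr // mulr_gt0 // exprn_gt0.
Qed.

End TestWeight.

(** * Size of the terms of the tested sum *)

Section PartialSums.
Context {R : realType}.
Implicit Types (n N : nat).

Lemma expR_le_two : expR (13 / 20) <= 2 :> R.
Proof.
have h : 147 / 160 <= expR (- (13 / 160)) :> R.
  by apply: le_trans (expR_ge1Dx _); lra.
have h8 : (147 / 160) ^+ 8 <= expR (- (13 / 160)) ^+ 8 :> R.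
  by rewrite lerXn2r ?nnegrE ?expR_ge0 //; lra.
rewrite -expRM_natl in h8.
have e : 8%:R * - (13 / 160) = - (13 / 20) :> R by field.
have n : 2^-1 <= (147 / 160) ^+ 8 :> R by lra.
have := le_trans n h8; rewrite e expRN lef_pV2 ?posrE ?expR_gt0 //.
Qed.

Lemma ln2_ge : 13 / 20 <= ln 2 :> R.
Proof. by rewrite -ler_expR lnK ?posrE // expR_le_two. Qed.

Lemma ln_nat_ge n : (1 < n)%N -> 13 / 20 <= ln n%:R :> R.
Proof.
move=> n2; apply: le_trans ln2_ge _.
by rewrite ler_ln ?posrE ?ltr0n ?(ltnW n2) // (ler_nat _ 2).
Qed.

(** Comparison with the integral of [1 / (y (ln y) ^ (3 / 2))]. *)
Lemma inv_ln_telescope n : (1 < n)%N ->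
  (n.+1%:R * Num.sqrt (ln n.+1%:R) ^+ 3)^-1 <=
  2 * ((Num.sqrt (ln n%:R))^-1 - (Num.sqrt (ln n.+1%:R))^-1) :> R.
Proof.
move=> n1; have l1 := ln_nat_ge n1; have l2 := ln_nat_ge (leqW n1).
have n0 : (0 : R) < n%:R by rewrite ltr0n ltnW.
have d : n.+1%:R^-1 <= ln n.+1%:R - ln n%:R :> R.
  have h := @le_ln1Dx R (- n.+1%:R^-1).
  have e : 1 - n.+1%:R^-1 = n%:R / n.+1%:R :> R.
    by rewrite -natr1; field; rewrite natr1 pnatr_eq0.
  rewrite e ln_div ?posrE // in h.
  rewrite -lerN2 opprB; apply: h.
  by rewrite ltrN2 invf_lt1 ?ltr0n // ltr1n ltnS ltnW.
set p := ln n%:R in l1 d *; set q := ln n.+1%:R in l2 d *.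
have p0 : 0 < p by lra.
have q0 : 0 < q by lra.
have aE : Num.sqrt p ^+ 2 = p by rewrite sqr_sqrtr // ltW.
have bE : Num.sqrt q ^+ 2 = q by rewrite sqr_sqrtr // ltW.
have a0 : 0 < Num.sqrt p by rewrite sqrtr_gt0.
have b0 : 0 < Num.sqrt q by rewrite sqrtr_gt0.
have nv : 0 < n.+1%:R^-1 :> R by rewrite invr_gt0.
have ab : Num.sqrt p <= Num.sqrt q by rewrite ler_sqrt ?(ltW q0) // -subr_ge0; apply: le_trans d; exact: ltW.
move: (Num.sqrt p) (Num.sqrt q) aE bE a0 b0 ab => a b aE bE a0 b0 ab.
rewrite invfM.
apply: (@le_trans _ _ ((b ^+ 2 - a ^+ 2) * (b ^+ 3)^-1)).
  by rewrite ler_wpM2r ?invr_ge0 ?exprn_ge0 ?(ltW b0) // aE bE.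
have -> : (b ^+ 2 - a ^+ 2) * (b ^+ 3)^-1 = (b - a) * ((a + b) / b ^+ 3) by ring.
have -> : 2 * (a^-1 - b^-1) = (b - a) * (2 / (a * b)).
  by field; rewrite (gt_eqF a0) (gt_eqF b0).
rewrite ler_wpM2l ?subr_ge0 //.
rewrite ler_pdivrMr ?exprn_gt0 // mulrAC ler_pdivlMr ?mulr_gt0 //.
rewrite -subr_ge0 (_ : _ - _ = b * (b - a) * (2 * b + a)); last by ring.
by rewrite !mulr_ge0 ?subr_ge0 ?addr_ge0 ?mulr_ge0 // ltW.
Qed.

Lemma sum_inv_ln_le N :
  \sum_(1 <= n < N) (n.+1%:R * Num.sqrt (ln n.+1%:R) ^+ 3)^-1 <= 7 / 2 :> R.
Proof.
have s2 : 4 / 5 <= Num.sqrt (ln 2) :> R.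
  rewrite -(ger0_norm (_ : 0 <= 4 / 5)); last by lra.
  rewrite -sqrtr_sqr ler_sqrt; last by have := ln2_ge; lra.
  by apply: le_trans ln2_ge; lra.
have s0 : 0 < Num.sqrt (ln 2) :> R by lra.
have first : (2 * Num.sqrt (ln 2) ^+ 3)^-1 + 2 * (Num.sqrt (ln 2))^-1 <= 7 / 2 :> R.
  have i : (Num.sqrt (ln 2))^-1 <= 5 / 4 :> R.
    by rewrite -[5 / 4]invrK lef_pV2 ?posrE ?invr_gt0 //; lra.
  have i0 : 0 <= (Num.sqrt (ln 2))^-1 :> R by rewrite invr_ge0 ltW.
  have i3 : (Num.sqrt (ln 2))^-1 ^+ 3 <= (5 / 4) ^+ 3 :> R.
    by rewrite lerXn2r ?nnegrE //; lra.
  rewrite invfM -exprVn; lra.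
case: N => [|[|N]]; [by rewrite big_geq //; lra|by rewrite big_geq //; lra|].
suff h : \sum_(1 <= n < N.+2) (n.+1%:R * Num.sqrt (ln n.+1%:R) ^+ 3)^-1 <=
  (2 * Num.sqrt (ln 2) ^+ 3)^-1 + 2 * (Num.sqrt (ln 2))^-1 - 2 * (Num.sqrt (ln N.+2%:R))^-1 :> R.
  apply: le_trans h _; apply: le_trans first.
  by rewrite gerBl mulr_ge0 // invr_ge0 sqrtr_ge0.
elim: N => [|N ih]; first by rewrite big_nat1 addrK.
rewrite big_nat_recr //=; apply: le_trans (lerD ih (inv_ln_telescope (isT : 1 < N.+2)%N)) _.
by rewrite le_eqVlt; apply/orP; left; apply/eqP; ring.
Qed.

(** The decay in the form that [partial_sum_segint] sums: [x] is the logarithm of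
    the index of a term, and [47 / 2] is [2 * r * a] there. *)
Lemma moment2_decay (r c u th x : R) : 0 < r -> 0 < u -> 13 / 20 <= x ->
  47 / 2 * x <= (u * r) ^+ 2 ->
  `|moment r c 2 u th| <= 29 / 100 * r ^+ 5 * (Num.sqrt x ^+ 3)^-1.
Proof.
move=> r0 u0 x1 ux; apply: le_trans (moment2_le c r0 th u0) _.
set v := u * r in ux.
have v0 : 0 < v by rewrite mulr_gt0.
have vE : v = u * r by [].
clearbody v.
have x0 : 0 < x by lra.
have sE : Num.sqrt x ^+ 2 = x by rewrite sqr_sqrtr // ltW.
have s0 : 0 < Num.sqrt x by rewrite sqrtr_gt0.
move: (Num.sqrt x) sE s0 => s sE s0.
have vs : 24 / 5 * s <= v.
  have h1 : 0 <= 24 / 5 * s by rewrite mulr_ge0 ?(ltW s0).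
  by rewrite -(ler_pXn2r (n:=2)) ?nnegrE ?(ltW v0) // exprMn sE; lra.
have v38 : 19 / 5 <= v.
  by rewrite -(ler_pXn2r (n:=2)) ?nnegrE ?(ltW v0) //; lra.
rewrite [leLHS](_ : _ =
   r ^+ 5 * (16 + 48 * v^-1 + 48 * v^-1 ^+ 2) * (v ^+ 3)^-1); last first.
  by rewrite vE; field; rewrite (gt_eqF u0) (gt_eqF r0).
have i : v^-1 <= 5 / 19.
  by rewrite -[5 / 19]invrK lef_pV2 ?posrE ?invr_gt0 //; lra.
have i0 : 0 <= v^-1 by rewrite invr_ge0 ltW.
have i2 : v^-1 ^+ 2 <= (5 / 19) ^+ 2 by rewrite lerXn2r ?nnegrE //; lra.
have r5 : 0 < r ^+ 5 by rewrite exprn_gt0.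
have s3 : 0 < s ^+ 3 by rewrite exprn_gt0.
have k : (v ^+ 3)^-1 <= (24 / 5) ^- 3 * (s ^+ 3)^-1.
  have h2 : 0 < 24 / 5 * s by rewrite mulr_gt0.
  rewrite -invfM -exprMn lef_pV2 ?posrE ?exprn_gt0 //.
  by rewrite lerXn2r ?nnegrE ?(ltW h2) ?(ltW v0).
have si : 0 < (s ^+ 3)^-1 by rewrite invr_gt0.
apply: (@le_trans _ _ (r ^+ 5 * 32 * ((24 / 5) ^- 3 * (s ^+ 3)^-1))).
  apply: ler_pM => //.
  - by rewrite mulr_ge0 ?(ltW r5) //; nra.
  - by rewrite invr_ge0 exprn_ge0 // ltW.
  - by rewrite ler_pM2l //; lra.
rewrite mulrA ler_pM2r // -mulrA [leRHS]mulrC ler_pM2l //; lra.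
Qed.

Lemma cpow_polar (y s t : R) : cpow y (Complex s t) =
  Complex (expR (- s * ln y) * cos (t * ln y)) (- (expR (- s * ln y) * sin (t * ln y))).
Proof.
rewrite cpowE /cexp; apply: complex_ext; rewrite /= !mulr0 ?subr0 ?add0r ?addr0.
  by rewrite [- t * _]mulNr cosN.
by rewrite [- t * _]mulNr sinN mulrN.
Qed.

(** Multiplication by a number of modulus 1 whose phase is affine in [t] leaves the
    modulus and adds [B] to all frequencies, of which the least becomes [B]. *)
Lemma Re_le_partial_sum (s t alpha B c : R) N : 0 < alpha ->
  \sum_(0 <= n < N) expR (- s * ln (n%:R + alpha)) *
     cos ((ln (n%:R + alpha) - ln alpha + B) * (t - c) + c * (ln (n%:R + alpha) - ln alpha))
  <= normc (\sum_(0 <= n < N) cpow (n%:R + alpha) (Complex s t)).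
Proof.
move=> a0; pose psi := t * ln alpha - B * (t - c).
pose w : R[i] := Complex (cos psi) (sin psi).
have w1 : normc w = 1 by rewrite /= cos2Dsin2 sqrtr1.
have <- : normc (w * \sum_(0 <= n < N) cpow (n%:R + alpha) (Complex s t)) =
    normc (\sum_(0 <= n < N) cpow (n%:R + alpha) (Complex s t)).
  by rewrite Normc.normcM w1 mul1r.
apply: le_trans (Re_le_normc _).
rewrite mulr_sumr Re_sum; apply: ler_sum => n _.
rewrite le_eqVlt; apply/orP; left; apply/eqP.
rewrite [X in _ * cos X](_ : _ = t * ln (n%:R + alpha) - psi); last first.
  by rewrite /psi; ring.
by rewrite cosB cpow_polar ReM /=; ring.
Qed.

Lemma Cderiv_normc_continuous (F F' : R -> R[i]) :
  (forall x, Cderiv F x (F' x)) -> continuous (fun x => normc (F x)).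
Proof.
move=> dF.
have -> : (fun x => normc (F x)) = (fun x => Num.sqrt (Re (F x) ^+ 2 + Im (F x) ^+ 2)).
  by apply/funext => x; case: (F x).
have cR : continuous (fun x => Re (F x)) by move=> x; exact: is_derive_continuous (dF x).1.
have cI : continuous (fun x => Im (F x)) by move=> x; exact: is_derive_continuous (dF x).2.
move=> x; apply: continuous_comp; last exact: sqrt_continuous.
by apply: continuous_add => {}x; rewrite /=; apply: (continuous_mul (f := fun x => _) (g := fun x => _)).
Qed.

Lemma continuous_partial_sum N (alpha s : R) :
  continuous (fun t => normc (\sum_(0 <= n < N) cpow (n%:R + alpha) (Complex s t))).
Proof.
apply: Cderiv_normc_continuous => t; apply: Cderiv_sum => n.
exact: (Cderiv_cpow_exponent (n%:R + alpha) (Cderiv_Complex_im s t)).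
Qed.

End PartialSums.

(** * Integral of a partial sum *)

Section PartialSumIntegral.
Context {R : realType}.
Implicit Types (n N : nat).

(** The integral of the modulus is at least that of the real part of the rotated
    sum against the weight, divided by the maximum of the weight. In the latter the
    term of index 0 contributes [21 / 20 * r ^ 5], and the sum of the others, over
    which [1 / (n (ln n) ^ (3 / 2))] converges, at most [51 / 50 * r ^ 5]. *)
Lemma partial_sum_segint (alpha s T d : R) N : 0 < alpha <= 1 -> 1 <= s -> 0 < d ->
  (0 < N)%N ->
  3 / 200 * d * expR (- (47 / 2 / d)) <=
  segint T (T + d) (fun t => normc (\sum_(0 <= n < N) cpow (n%:R + alpha) (Complex s t))).
Proof.
move=> /andP[a0 a1] s1 d0 N0.
pose r := d / 2; pose c := T + r; pose a := 47 / 2 / d.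
have r0 : 0 < r by rewrite divr_gt0.
have ag0 : 0 <= a by rewrite divr_ge0 // ltW.
have cm : c - r = T by rewrite /c addrK.
have cp : c + r = T + d by rewrite /c /r; field.
have r5 : 0 < r ^+ 5 by rewrite exprn_gt0.
pose q := r ^+ 5 / 200.
have q5 : 0 < q by apply: divr_gt0 r5 _; rewrite ltr0n.
(* The weight is exact up to [e], which the [N] terms may each cost. *)
pose e := q / N%:R.
have Np : (0 : R) < N%:R by rewrite ltr0n.
have e0 : 0 < e by exact: divr_gt0.
have [W [cW bW hW]] := weight_exists c r0 ag0 e0.
rewrite cm cp in bW hW.
pose x n := ln (n%:R + alpha) - ln alpha.
(* Slightly above [a / r]: the least frequency reaches the weight as a small
   positive one. *)
pose B := Num.sqrt (a ^+ 2 + 50^-1) / r.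
have rB : r * B = Num.sqrt (a ^+ 2 + 50^-1) by rewrite /B mulrC divfK // gt_eqF.
have q0 : 0 < a ^+ 2 + 50^-1 by rewrite ltr_wpDl ?sqr_ge0 // invr_gt0 ltr0n.
have rB2 : (r * B) ^+ 2 = a ^+ 2 + 50^-1 by rewrite rB sqr_sqrtr // ltW.
have rBa : a < r * B.
  rewrite -(ltr_pXn2r (n:=2)) ?nnegrE //; last by rewrite rB sqrtr_ge0.
  by rewrite rB2 ltrDl invr_gt0 ltr0n.
have aB : a / r < B by rewrite ltr_pdivrMr // mulrC.
have pos n : 0 < n%:R + alpha by rewrite ltr_wpDl.
have x0 : x 0%N = 0 by rewrite /x add0r subrr.
have xE n : x n = ln ((n%:R + alpha) / alpha) by rewrite /x ln_div ?posrE.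
have ratio n : n.+1%:R <= (n%:R + alpha) / alpha.
  rewrite ler_pdivlMr // -natr1 mulrDl mul1r lerD2r.
  by rewrite -[leRHS]mulr1 ler_wpM2l.
have xge n : ln n.+1%:R <= x n.
  by rewrite xE ler_ln ?posrE ?ltr0n ?divr_gt0.
have xge0 n : 0 <= x n by apply: le_trans (xge n); apply: ln_ge0; rewrite ler1n.
pose E n := expR (- s * ln (n%:R + alpha)).
have E0 n : 0 < E n by exact: expR_gt0.
have Ele n : E n <= E 0%N / n.+1%:R.
  have -> : E n = E 0%N * expR (- (s * x n)).
    by rewrite /E -expRD; congr expR; rewrite /x add0r; ring.
  rewrite ler_pM2l //.
  apply: (@le_trans _ _ (expR (- (ln n.+1%:R)))); last by rewrite expRN lnK ?posrE ?ltr0n.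
  rewrite ler_expR lerN2; apply: le_trans (xge n) _.
  by rewrite -[leLHS]mul1r ler_wpM2r.
pose u n := Num.sqrt ((x n + B) ^+ 2 - (a / r) ^+ 2).
have qE n : ((x n + B) ^+ 2 - (a / r) ^+ 2) * r ^+ 2 = (r * x n) ^+ 2 + 2 * r * (r * B) * x n + 50^-1.
  transitivity ((r * x n) ^+ 2 + 2 * r * (r * B) * x n + (r * B) ^+ 2 - a ^+ 2).
    by field; rewrite gt_eqF.
  by rewrite rB2; ring.
have qge n : 47 / 2 * x n + 50^-1 <= ((x n + B) ^+ 2 - (a / r) ^+ 2) * r ^+ 2.
  rewrite qE lerD2r; apply: ler_wpDl; first by rewrite sqr_ge0.
  apply: ler_wpM2r => //.
  have -> : 47 / 2 = 2 * r * a by rewrite /r /a; field; rewrite gt_eqF.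
  by rewrite ler_wpM2l ?mulr_ge0 ?(ltW r0) // ltW.
have qp n : 0 < (x n + B) ^+ 2 - (a / r) ^+ 2.
  rewrite -(pmulr_lgt0 _ (exprn_gt0 2 r0)); apply: lt_le_trans (qge n).
  by rewrite ltr_wpDl ?mulr_ge0 ?divr_ge0 ?ler0n // invr_gt0 ltr0n.
have u0 n : 0 < u n by rewrite sqrtr_gt0.
have ur n : (u n * r) ^+ 2 = ((x n + B) ^+ 2 - (a / r) ^+ 2) * r ^+ 2.
  by rewrite exprMn sqr_sqrtr // ltW.
pose I n := segint T (T + d) (fun t => W t * cos ((x n + B) * (t - c) + c * x n)).
have hI n : `|I n - moment r c 2 (u n) (c * x n)| <= e.
  by apply: hW; apply: lt_le_trans aB _; rewrite lerDr.
have I0 : 21 / 20 * r ^+ 5 <= I 0%N.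
  have := hI 0%N; have := @moment2_ge R r c r0 (u 0%N).
  rewrite ur qE x0 mulr0 expr0n mulr0 !add0r.
  rewrite mulr0 ler_norml => h1 /andP[h2 _].
  have h3 : e <= q by rewrite /e ler_pdivrMr // ler_peMr ?ler1n // ltW.
  move: h3; rewrite /q => h3; move: (I 0%N) (moment _ _ _ _ _) h1 h2 h3 r5 => i M h1 h2 h3 r5.
  by lra.
have In n : (0 < n)%N -> `|I n| <= 29 / 100 * r ^+ 5 * (Num.sqrt (ln n.+1%:R) ^+ 3)^-1 + e.
  move=> n0; have ln1 := @ln_nat_ge R n.+1 n0.
  have h : 47 / 2 * ln n.+1%:R <= (u n * r) ^+ 2.
    rewrite ur; apply: le_trans (qge n); rewrite -[leLHS]addr0; apply: lerD.
      by apply: ler_wpM2l (xge n); rewrite divr_ge0 ?ler0n.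
    by rewrite invr_ge0 ler0n.
  have := moment2_decay c (c * x n) r0 (u0 n) ln1 h => h1.
  have -> : I n = moment r c 2 (u n) (c * x n) + (I n - moment r c 2 (u n) (c * x n)) by ring.
  by apply: le_trans (ler_normD _ _) _; apply: lerD.
have cS := @continuous_partial_sum R N alpha s.
pose h t := \sum_(0 <= n < N) E n * cos ((x n + B) * (t - c) + c * x n).
have ccos n : continuous (fun t => cos ((x n + B) * (t - c) + c * x n)).
  exact: continuous_cos_affine.
have ch : continuous h.
  apply: continuous_bigsum => n; apply: continuous_mul; last exact: ccos.
  by move=> z; exact: cvg_cst.
have upper : segint T (T + d) (fun t => W t * h t) <=
  r ^+ 4 * expR a * segint T (T + d) (fun t => normc (\sum_(0 <= n < N) cpow (n%:R + alpha) (Complex s t))).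
  rewrite -segintZ //; apply: segint_le; first exact: continuous_mul.
    by apply: continuous_mul => // z; exact: cvg_cst.
  move=> t /bW/andP[W0 W1].
  apply: (@le_trans _ _ (W t * normc (\sum_(0 <= n < N) cpow (n%:R + alpha) (Complex s t)))).
    by rewrite ler_wpM2l //; exact: Re_le_partial_sum.
  by rewrite ler_wpM2r // normc_ge0.
have lower : 3 / 100 * r ^+ 5 <= segint T (T + d) (fun t => W t * h t).
  have -> : segint T (T + d) (fun t => W t * h t) = \sum_(0 <= n < N) E n * I n.
    have -> : (fun t => W t * h t) = (fun t => \sum_(0 <= n < N) E n * (W t * cos ((x n + B) * (t - c) + c * x n))).
      by apply/funext => t; rewrite /h mulr_sumr; apply: eq_bigr => n _; rewrite mulrCA.
    rewrite segint_sum; last first.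
      move=> n; apply: continuous_mul; first by move=> z; exact: cvg_cst.
      exact: continuous_mul.
    by apply: eq_bigr => n _; rewrite segintZ //; exact: continuous_mul.
  rewrite big_ltn //.
  have tail : `|\sum_(1 <= n < N) E n * I n| <= E 0%N * (51 / 50 * r ^+ 5).
    apply: le_trans (ler_norm_sum _ _ _) _.
    apply: (@le_trans _ _ (\sum_(1 <= n < N) E 0%N * (29 / 100 * r ^+ 5 * (n.+1%:R * Num.sqrt (ln n.+1%:R) ^+ 3)^-1 + e))).
      rewrite big_nat_cond [leRHS]big_nat_cond; apply: ler_sum => n /andP[/andP[n1 _] _].
      rewrite normrM gtr0_norm //.
      apply: (@le_trans _ _ (E 0%N / n.+1%:R * (29 / 100 * r ^+ 5 * (Num.sqrt (ln n.+1%:R) ^+ 3)^-1 + e))).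
        by apply: ler_pM => //; [exact: ltW | exact: In].
      rewrite -mulrA ler_pM2l // mulrDr; apply: lerD.
        by rewrite [X in _ <= _ * X]invfM mulrCA.
      rewrite ler_piMl // ?(ltW e0) // invf_le1 ?ltr0n // ler1n //.
    rewrite -mulr_sumr ler_pM2l // big_split /= -mulr_sumr.
    have -> : 51 / 50 * r ^+ 5 = 203 / 200 * r ^+ 5 + q by rewrite /q; field.
    apply: lerD.
      apply: (@le_trans _ _ (29 / 100 * r ^+ 5 * (7 / 2))).
        by rewrite ler_wpM2l ?sum_inv_ln_le // mulr_ge0 ?(ltW r5) // divr_ge0 ?ler0n.
      by lra.
    rewrite sumr_const_nat -[e *+ _]mulr_natr /e.
    rewrite -[q / N%:R * _]mulrA ler_piMr ?(ltW q5) //.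
    rewrite mulrC ler_pdivrMr // mul1r ler_nat.
    exact: leq_subr.
  have Eg : 1 <= E 0%N.
    rewrite -expR0 ler_expR mulNr oppr_ge0 add0r.
    by rewrite mulr_ge0_le0 ?ln_le0 //; lra.
  move: tail; rewrite ler_norml => /andP[tail _].
  have t1 : E 0%N * (21 / 20 * r ^+ 5) <= E 0%N * I 0%N by rewrite ler_pM2l.
  have t2 : 3 / 100 * r ^+ 5 <= E 0%N * (3 / 100 * r ^+ 5).
    by rewrite ler_peMl // mulr_ge0 ?(ltW r5) // mulr_ge0 ?ler0n // invr_ge0 ler0n.
  move: (\sum_(1 <= n < N) E n * I n) tail t1 t2 => S tail t1 t2.
  have t3 : E 0%N * (3 / 100 * r ^+ 5) = E 0%N * (21 / 20 * r ^+ 5) - E 0%N * (51 / 50 * r ^+ 5) by field.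
  by apply: le_trans t2 _; rewrite t3; apply: lerD.
have key := le_trans lower upper.
have -> : 3 / 200 * d * expR (- a) = 3 / 100 * r ^+ 5 / (r ^+ 4 * expR a).
  by rewrite expRN /r; field; rewrite (gt_eqF d0) gt_eqF ?expR_gt0.
by rewrite ler_pdivrMr ?mulr_gt0 ?exprn_gt0 ?expR_gt0 // [leRHS]mulrC.
Qed.

End PartialSumIntegral.

(** * Passage to the line *)

Section LimitToLine.
Context {R : realType}.
Local Notation mu := (@lebesgue_measure R).

Lemma measurable_zeta_line (alpha x : R) f (D : set R) : is_hurwitz_zeta alpha f ->
  measurable D -> ~ D 0 -> measurable_fun D (fun t => normc (f (Complex x t))).
Proof.
move=> [_ hf] mD D0.
have op : open [set~ (0 : R)] by rewrite openC; exact: closed_eq.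
suff key : measurable_fun [set~ (0 : R)] (fun t : R => normc (f (Complex x t))).
  apply: measurable_funS key; first by apply: measurableC; exact: measurable_set1.
  by move=> t Dt /= t0; rewrite t0 in Dt.
apply: open_continuous_measurable_fun => // t; rewrite inE /= => /eqP t0.
apply/cvgrPdist_lt => e e0.
have s1 : Complex x t != 1 by apply: contra_neq t0 => -[].
have [d d0 hd] := derivable_continuous_normc (hf _ s1) e0.
exists d => // u /= tu.
have h : normc (f (Complex x u) - f (Complex x t)) < e.
  apply: hd; have -> : Complex x u - Complex x t = Complex 0 (u - t).
    by apply: complex_ext; rewrite /= ?subrr.
  by rewrite normc_im distrC.
rewrite distrC ltr_norml; apply/andP; split.
  by rewrite ltrNl opprB; apply: le_lt_trans (ler_normcBr _ _) _; rewrite normcB.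
exact: le_lt_trans (ler_normcBr _ _) h.
Qed.

(** Dominated convergence on a segment. *)
Lemma integral_lower_limit (a b K m : R) (g_ : nat -> R -> R) (g : R -> R) :
  (forall k, measurable_fun `[a, b] (g_ k)) -> measurable_fun `[a, b] g ->
  (forall k t, a <= t <= b -> 0 <= g_ k t <= K) ->
  (forall t, a <= t <= b -> g_ ^~ t @ \oo --> g t) ->
  (forall k, (m%:E <= \int[mu]_(t in `[a, b]) (g_ k t)%:E)%E) ->
  (m%:E <= \int[mu]_(t in `[a, b]) (g t)%:E)%E.
Proof.
move=> mg_ mg bg_ cg hm.
have iK : mu.-integrable `[a, b] (EFin \o (fun=> K)).
  by apply: continuous_segment_integrable => x; exact: cvg_cst.
have [|||||_ _ cv] := @dominated_convergence _ _ R mu `[a, b] (measurable_itv _)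
  (fun k t => (g_ k t)%:E) (fun t => (g t)%:E) (EFin \o (fun=> K)).
- by move=> k; apply/measurable_EFinP; exact: mg_.
- exact/measurable_EFinP.
- apply: aeW => t; rewrite /= in_itv /= => tab.
  by apply: cvg_EFin; [exact: nearW | exact: cg].
- exact: iK.
- apply: aeW => t k; rewrite /= in_itv /= => tab.
  by have /andP[h1 h2] := bg_ k t tab; rewrite lee_fin ger0_norm.
apply: cvge_ge cv; exact: nearW.
Qed.

Lemma normc_cvg (u : nat -> R[i]) (l : R[i]) :
  (forall e : R, 0 < e -> exists N, forall n, (N <= n)%N -> normc (l - u n) < e) ->
  (fun n => normc (u n)) @ \oo --> normc l.
Proof.
move=> h; apply/cvgrPdist_lt => e /h [N hN]; exists N => // n /= /hN nN.
rewrite ltr_norml; apply/andP; split; last exact: le_lt_trans (ler_normcBr _ _) nN.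
by rewrite ltrNl opprB; apply: le_lt_trans (ler_normcBr _ _) _; rewrite normcB.
Qed.

Lemma integral_segint (a b : R) g : continuous g ->
  (\int[mu]_(t in `[a, b]) (g t)%:E)%E = (segint a b g)%:E.
Proof.
move=> cg; rewrite /segint /Rintegral fineK //.
apply: integrable_fin_num => //; exact: continuous_segment_integrable.
Qed.

(** Away from the pole: first the length of the partial sums, then the
    abscissa tends to its limit. *)
Lemma line1_integral_ge_nopole (alpha T d : R) f : is_hurwitz_zeta alpha f ->
  0 < alpha <= 1 -> 0 < d -> (0 < T) || (T + d < 0) ->
  ((3 / 200 * d * expR (- (47 / 2 / d)))%:E <= line1_integral f d T)%E.
Proof.
move=> hf a01 d0 Td; set m := 3 / 200 * d * expR _.
pose h := Num.max T (- (T + d)); pose B := `|T| + d.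
have h0 : 0 < h by rewrite lt_max oppr_gt0.
have ht t : T <= t <= T + d -> h <= `|t|.
  move=> /andP[t1 t2]; rewrite ge_max; case/orP: Td => hT.
    have t0 : 0 < t by apply: lt_le_trans t1.
    by rewrite (gtr0_norm t0); apply/andP; split => //; lra.
  have t0 : t < 0 by apply: le_lt_trans hT.
  by rewrite (ltr0_norm t0); apply/andP; split; lra.
have tB t : T <= t <= T + d -> `|t| <= B.
  move=> /andP[t1 t2]; have := ler_norm T; have := ler_norm (- T); rewrite normrN.
  by rewrite /B ler_norml => ? ?; apply/andP; split; lra.
have D0 : ~ `[T, T + d]%classic 0.
  by rewrite /= in_itv /= => t0; have := ht 0 t0; rewrite normr0; lra.
have mz x : measurable_fun `[T, T + d] (fun t => normc (f (Complex x t))).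
  exact: measurable_zeta_line hf (measurable_itv _) D0.
have above x : 1 < x <= 2 ->
    (m%:E <= \int[mu]_(t in `[T, (T + d)%R]) (normc (f (Complex x t)))%:E)%E.
  move=> /andP[x1 x2]; have x12 : 1 <= x <= 2 by rewrite ltW.
  apply: (@integral_lower_limit T (T + d) (2 * line_bound alpha h B) m
    (fun N t => normc (\sum_(0 <= n < N.+2) cpow (n%:R + alpha) (Complex x t)))) => //.
  - move=> N; apply: measurable_funS (continuous_measurable_fun (@continuous_partial_sum R N.+2 alpha x)) => //.
  - move=> N t tT; rewrite normc_ge0 /=.
    by apply: (partial_sum_bound hf a01 x12) => //; rewrite ?h0 ?ht ?tB.
  - move=> t tT; apply: normc_cvg => e e0.
    have [N hN] := cvg_normc (hf.1 (Complex x t) x1) e0.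
    exists N => n Nn; apply: hN; exact: leq_trans Nn (leqW (leqW (leqnn n))).
  - move=> N; rewrite integral_segint; last exact: continuous_partial_sum.
    by rewrite lee_fin; apply: partial_sum_segint => //; exact: ltW.
pose xs k := 1 + k.+1%:R^-1 : R.
have xs1 k : 1 < xs k <= 2.
  rewrite /xs ltrDl invr_gt0 ltr0n /=.
  have : k.+1%:R^-1 <= 1 :> R by rewrite invf_le1 ?ler1n ?ltr0n.
  by move: (k.+1%:R^-1) => y; lra.
apply: (@integral_lower_limit T (T + d) (line_bound alpha h B) m
    (fun k t => normc (f (Complex (xs k) t)))) => //.
- move=> k t tT; rewrite normc_ge0 /=.
  have /andP[x1 x2] := xs1 k.
  by apply: (zeta_line_bound hf a01) => //; rewrite ?h0 ?ht ?tB // (ltW x1).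
- move=> t tT; apply: normc_cvg => e e0.
  have t0 : t != 0.
    by rewrite -normr_gt0; apply: lt_le_trans h0 (ht t tT).
  have [r r0 hr] := @zeta_continuous_re R alpha f 1 t hf t0 e e0.
  exists (Num.bound r^-1) => k kb; rewrite normcB; apply: hr.
  rewrite /xs addrC addKr ger0_norm ?invr_ge0 //.
  rewrite -[r]invrK ltf_pV2 ?posrE ?invr_gt0 ?ltr0n //.
  apply: lt_le_trans (archi_boundP _) _; first by rewrite invr_ge0 ltW.
  by rewrite ler_nat leqW.
- by move=> k; exact: above.
Qed.

(** Near the pole the integrand exceeds [1 / (2 |t|)]. *)
Lemma line1_integral_ge_pole (alpha T d : R) f : is_hurwitz_zeta alpha f ->
  0 < alpha <= 1 -> 0 < d -> T <= 0 <= T + d ->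
  ((4^-1)%:E <= line1_integral f d T)%E.
Proof.
move=> hf a01 d0 /andP[T0 Td0]; have /andP[a0 a1] := a01.
pose M := 2 * alpha ^- 2 + 50.
have M0 : 0 < M by rewrite ltr_wpDl // mulr_ge0 // invr_ge0 exprn_ge0 // ltW.
pose y := Num.min 1 (Num.min ((2 * M)^-1) (d / 2)).
have y0 : 0 < y by rewrite !lt_min ltr01 invr_gt0 mulr_gt0 ?divr_gt0.
have yM : y <= (2 * M)^-1 by rewrite /y !ge_min lexx orbT.
have y1 : y <= 1 by rewrite /y !ge_min lexx.
have yd : y <= d / 2 by rewrite /y !ge_min lexx !orbT.
have big t : 0 < `|t| <= y -> (2 * y)^-1 <= normc (f (Complex 1 t)).
  move=> /andP[t0 ty]; apply: le_trans (zeta_pole_ge hf a01 _); last first.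
    by rewrite t0 (le_trans ty).
  rewrite -/M.
  have ti : y^-1 <= `|t|^-1 by rewrite lef_pV2 ?posrE.
  have My : 2 * M <= y^-1 by rewrite -[2 * M]invrK lef_pV2 ?posrE ?invr_gt0 ?mulr_gt0.
  rewrite invfM; move: (y^-1) (`|t|^-1) ti My => u v ti My; lra.
pose J := if - T <= T + d then `[y / 2, y]%classic else `[- y, - (y / 2)]%classic.
have mJ : measurable J by rewrite /J; case: ifP => _; exact: measurable_itv.
have JD : J `<=` `[T, T + d].
  rewrite /J; case: ifPn => h t; rewrite /= !in_itv /= => /andP[t1 t2]; apply/andP; split; lra.
have J0 t : J t -> 0 < `|t| <= y.
  rewrite /J; case: ifP => h; rewrite /= in_itv /= => /andP[t1 t2].
    have t0 : 0 < t by lra.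
    by rewrite (gtr0_norm t0) t0 t2.
  have t0 : t < 0 by lra.
  by rewrite (ltr0_norm t0) oppr_gt0 t0 /=; lra.
have nJ : ~ J 0 by move=> /J0; rewrite normr0 ltxx.
have muJ : mu J = (y / 2)%:E.
  rewrite /J; case: ifP => _; rewrite lebesgue_measure_itv /= lte_fin.
    rewrite ifT; last by lra.
    by rewrite -EFinB; congr (_%:E); field.
  rewrite ifT; last by lra.
  by rewrite -EFinB; congr (_%:E); field.
rewrite /line1_integral.
rewrite -(@integral_setD1 _ _ 0 `[T, T + d]); last 2 first.
- by apply: measurableD => //; exact: measurable_set1.
- apply/measurable_EFinP; apply: measurable_zeta_line hf _ _.
    by apply: measurableD => //; exact: measurable_set1.
  by move=> [_ /=].
apply: (@le_trans _ _ (\int[mu]_(t in J) (normc (f (Complex 1 t)))%:E)%E).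
  apply: (@le_trans _ _ (\int[mu]_(t in J) (cst ((2 * y)^-1)%:E t))%E).
    rewrite integral_cst //.
    apply: (@le_trans _ _ (((2 * y)^-1)%:E * (y / 2)%:E)%E); last by rewrite -muJ.
    rewrite -EFinM lee_fin.
    by rewrite le_eqVlt; apply/orP; left; apply/eqP; field; rewrite gt_eqF.
  apply: ge0_le_integral => //.
  - by move=> t _; rewrite lee_fin invr_ge0 mulr_ge0 // ltW.
  - by apply/measurable_EFinP; apply: measurable_zeta_line hf _ _.
  - by move=> t /J0 /big; rewrite lee_fin.
apply: ge0_subset_integral => //.
- by apply: measurableD => //; exact: measurable_set1.
- apply/measurable_EFinP; apply: measurable_zeta_line hf _ _.
    by apply: measurableD => //; exact: measurable_set1.
  by move=> [_ /=].
- by move=> t _; rewrite lee_fin normc_ge0.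
- move=> t Jt; split; first exact: JD.
  by move=> /= t0; apply: nJ; rewrite -t0.
Qed.

End LimitToLine.

(** * Rational inequalities decided in binary integers *)

(** Locked, because the integers in use have hundreds of digits and the cast unfolds
    to unary numerals. *)
HB.lock Definition ZR (R : realType) (a : Z) : R := (int_of_Z a)%:~R.
Arguments ZR {R}.

Section BinaryIntegers.
Context {R : realType}.
Implicit Types a b c : Z.
Local Notation ZR := (@ZR R).

Lemma ZRD a b : ZR (Z.add a b) = ZR a + ZR b :> R.
Proof. by rewrite ZR.unlock -[Z.add a b]/(a + b) rmorphD rmorphD. Qed.

Lemma ZRM a b : ZR (Z.mul a b) = ZR a * ZR b :> R.
Proof. by rewrite ZR.unlock -[Z.mul a b]/(a * b) rmorphM rmorphM. Qed.

Lemma ZRN a : ZR (Z.opp a) = - ZR a :> R.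
Proof. by rewrite ZR.unlock -[Z.opp a]/(- a) rmorphN rmorphN. Qed.

Lemma ZRB a b : ZR (Z.sub a b) = ZR a - ZR b :> R.
Proof. by rewrite -ZRN -ZRD. Qed.

Lemma ZR0 : ZR Z0 = 0 :> R. Proof. by rewrite ZR.unlock. Qed.
Lemma ZR1 : ZR (Zpos xH) = 1 :> R. Proof. by rewrite ZR.unlock. Qed.

Lemma ZR_nat n : ZR (Z.of_nat n) = n%:R :> R.
Proof. by rewrite ZR.unlock; have -> : int_of_Z (Z.of_nat n) = n :> int by lia. Qed.

Lemma ZR_le a b : Z.leb a b -> ZR a <= ZR b :> R.
Proof. by move=> h; rewrite ZR.unlock ler_int; lia. Qed.

Lemma ZR_lt a b : Z.ltb a b -> ZR a < ZR b :> R.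
Proof. by move=> h; rewrite ZR.unlock ltr_int; lia. Qed.

Lemma ZR_ge0 a : Z.leb Z0 a -> 0 <= ZR a :> R.
Proof. by move=> /ZR_le; rewrite ZR0. Qed.

Lemma ZR_gt0 a : Z.ltb Z0 a -> 0 < ZR a :> R.
Proof. by move=> /ZR_lt; rewrite ZR0. Qed.

Lemma ZR_pow a n : ZR (Z.pow a (Z.of_nat n)) = ZR a ^+ n :> R.
Proof.
elim: n => [|n ih]; first by rewrite expr0 ZR1.
by rewrite Nat2Z.inj_succ Z.pow_succ_r ?ZRM ?ih ?exprS //; lia.
Qed.

(** [ln c >= a / b], from [exp (- x / n) >= 1 - x / n]. *)
Lemma ln_ge_rat (n : nat) a b c : Z.ltb Z0 b -> Z.ltb Z0 c -> (0 < n)%N ->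
  Z.ltb a (Z.mul (Z.of_nat n) b) ->
  Z.leb (Z.pow (Z.mul (Z.of_nat n) b) (Z.of_nat n))
     (Z.mul c (Z.pow (Z.sub (Z.mul (Z.of_nat n) b) a) (Z.of_nat n))) ->
  ZR a / ZR b <= ln (ZR c) :> R.
Proof.
move=> /ZR_gt0 b0 /ZR_gt0 c0 n0 /ZR_lt ab /ZR_le.
rewrite ZR_pow ZRM ZRM ZR_pow ZRB ZRM ZR_nat in ab * => h.
have nR : (0 : R) < n%:R by rewrite ltr0n.
have nb : 0 < n%:R * ZR b by rewrite mulr_gt0.
rewrite -ler_expR lnK ?posrE //.
have e1 : 1 - ZR a / (n%:R * ZR b) <= expR (- (ZR a / (n%:R * ZR b))).
  exact: expR_ge1Dx.
have p0 : 0 <= 1 - ZR a / (n%:R * ZR b).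
  by rewrite subr_ge0 ler_pdivrMr // mul1r ltW.
have e2 : (1 - ZR a / (n%:R * ZR b)) ^+ n <= expR (- (ZR a / (n%:R * ZR b))) ^+ n.
  by rewrite lerXn2r ?nnegrE ?expR_ge0.
rewrite -expRM_natl in e2.
have e3 : n%:R * - (ZR a / (n%:R * ZR b)) = - (ZR a / ZR b).
  by field; rewrite (gt_eqF b0) (gt_eqF nR).
rewrite e3 expRN in e2.
have e4 : (1 - ZR a / (n%:R * ZR b)) ^+ n * (n%:R * ZR b) ^+ n = (n%:R * ZR b - ZR a) ^+ n.
  rewrite -exprMn; congr (_ ^+ _); field.
  by rewrite (gt_eqF b0) (gt_eqF nR).
set P := (1 - _) ^+ n in e2 e4.
have B0 : 0 < (n%:R * ZR b) ^+ n by rewrite exprn_gt0.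
have cP : 1 <= ZR c * P.
  by rewrite -(ler_pM2r B0) mul1r -mulrA e4.
have X0 := expR_gt0 (ZR a / ZR b).
have XP : expR (ZR a / ZR b) * P <= 1 by rewrite -ler_pdivlMl // mulr1.
apply: (@le_trans _ _ (ZR c * (expR (ZR a / ZR b) * P))); last first.
  by rewrite -[leRHS]mulr1 ler_wpM2l // ltW.
by rewrite mulrCA ler_peMr // ltW.
Qed.

End BinaryIntegers.

(** * The lower bound *)

Section LowerBound.
Context {R : realType}.

Lemma ln10_ge : 57 / 25 <= ln 10 :> R.
Proof. by rewrite -!ZR_nat; apply: (@ln_ge_rat R 128); vm_compute. Qed.

Lemma ln20_ge : 59 / 20 <= ln 20 :> R.
Proof. by rewrite -!ZR_nat; apply: (@ln_ge_rat R 128); vm_compute. Qed.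

Lemma expRN5_le : expR (- 5) <= 3 / 200 :> R.
Proof.
have h : 5 / 4 <= expR (4^-1) :> R by apply: le_trans (expR_ge1Dx _); lra.
have h5 : (5 / 4) ^+ 20 <= expR 4^-1 ^+ 20 :> R.
  by apply: lerXn2r; rewrite ?nnegrE ?expR_ge0 //; lra.
rewrite -expRM_natl (_ : 20%:R * 4^-1 = 5) in h5; last by field.
have b : 200 / 3 <= (5 / 4) ^+ 20 :> R.
  have -> : 200 / 3 = ZR 200 / ZR 3 :> R by rewrite -!ZR_nat.
  rewrite ler_pdivrMr ?ZR_gt0 //.
  have -> : (5 / 4) ^+ 20 = ZR (5 ^ 20) / ZR (4 ^ 20) :> R.
    by rewrite (ZR_pow 5 20) (ZR_pow 4 20) expr_div_n -!ZR_nat.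
  by rewrite mulrAC ler_pdivlMr ?ZR_gt0 // -!ZRM; apply: ZR_le.
have -> : 3 / 200 = (200 / 3)^-1 :> R by rewrite invf_div.
rewrite expRN lef_pV2 ?posrE ?expR_gt0 ?(le_trans b h5) //.
Qed.

(** With [D = 1 / d >= 20] and [L = ln D >= 59 / 20], the logarithms compare as
    [- 7 / 6 * D * L - 9 * D * ln 10 <= - 5 - L - 47 / 2 * D]. *)
Lemma lower_bound_numeric (d : R) : 0 < d <= 5%:R / 100%:R ->
  d `^ (7%:R / (6%:R * d)) * 10%:R `^ (- (9%:R / d)) <= 3 / 200 * d * expR (- (47 / 2 / d)).
Proof.
move=> /andP[d0 d1].
have dn : d != 0 by rewrite gt_eqF.
have t0 : (0 : R) < 10%:R by rewrite ltr0n.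
rewrite /powR (negbTE dn) gt_eqF // -expRD.
pose D := d^-1.
have D20 : 20 <= D by rewrite -[20]invrK lef_pV2 ?posrE ?invr_gt0 ?ltr0n //; lra.
pose L := ln D.
have L0 : 59 / 20 <= L.
  apply: le_trans ln20_ge _; rewrite ler_ln ?posrE ?ltr0n //.
  by rewrite invr_gt0.
have lnd : ln d = - L by rewrite /L /D lnV ?posrE // opprK.
have e5 := expRN5_le.
apply: (@le_trans _ _ (expR (- 5) * d * expR (- (47 / 2 / d)))); last first.
  by rewrite ler_wpM2r ?expR_ge0 // ler_wpM2r // ltW.
have dE : d = expR (- L) by rewrite -lnd lnK.
have -> : expR (- 5) * d * expR (- (47 / 2 / d)) = expR (- 5 - L - 47 / 2 * D).
  by rewrite !expRD -dE.
have -> : 7 / (6 * d) = 7 / 6 * D by rewrite invfM mulrA.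
rewrite lnd -/D ler_expR.
have l10 := ln10_ge.
have p1 : 0 <= (D - 20) * (L - 59 / 20) by rewrite mulr_ge0 ?subr_ge0.
have p2 : 0 <= D * (ln 10%:R - 57 / 25) by rewrite mulr_ge0 ?subr_ge0 //; lra.
move: (ln 10%:R) p2 l10 => l p2 l10; move: D L D20 L0 p1 p2 {lnd dE} => D L D20 L0 p1 p2.
nra.
Qed.

Lemma line1_integral_ge (alpha T d : R) f : is_hurwitz_zeta alpha f ->
  0 < alpha <= 1 -> 0 < d <= 5%:R / 100%:R ->
  ((d `^ (7%:R / (6%:R * d)) * 10%:R `^ (- (9%:R / d)))%:E <= line1_integral f d T)%E.
Proof.
move=> hf a01 d01; have /andP[d0 d1] := d01.
have num := lower_bound_numeric d01.
have [Td|] := boolP ((0 < T) || (T + d < 0)).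
  by apply: le_trans (line1_integral_ge_nopole hf a01 d0 Td); rewrite lee_fin.
rewrite negb_or -!leNgt => Td.
apply: le_trans (line1_integral_ge_pole hf a01 d0 Td); rewrite lee_fin.
apply: le_trans num _.
apply: (@le_trans _ _ (3 / 200 * d * 1)).
  apply: ler_wpM2l; first by apply: mulr_ge0; [lra | exact: ltW].
  by rewrite -expR0 ler_expR oppr_le0 divr_ge0 ?ltW //; lra.
by lra.
Qed.

End LowerBound.

(** * Lipschitz bounds for the error of the approximation *)

Section ErrorLipschitz.
Context {R : realType}.
Implicit Types (s : R[i]) (x y alpha t : R) (n N M : nat).

Lemma sum_telescope_le (e : nat -> R[i]) (g : nat -> R) N M : (N <= M)%N ->
  (forall n, (N <= n)%N -> normc (e n) <= g n - g n.+1) ->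
  (forall n, (N <= n)%N -> 0 <= g n) -> normc (\sum_(N <= n < M) e n) <= g N.
Proof.
move=> NM he g0; apply: (@le_trans _ _ (g N - g M)); last by rewrite gerBl g0.
elim: M NM => [|M ih].
  by rewrite leqn0 => /eqP ->; rewrite big_geq // Normc.normc0 subrr.
rewrite leq_eqVlt => /orP[/eqP <-|]; first by rewrite big_geq // Normc.normc0 subrr.
rewrite ltnS => NM; rewrite big_nat_recr //=.
apply: le_trans (le_normcD _ _) _.
apply: le_trans (lerD (ih NM) (he _ NM)) _.
by rewrite addrA subrK.
Qed.

Lemma hz_approxB_em N M alpha s : (N <= M)%N ->
  hz_approx M alpha s - hz_approx N alpha s = \sum_(N <= n < M) em_term s (n%:R + alpha).
Proof.
move=> NM; rewrite -(telescope_sumr (fun n => hz_approx n alpha s)) //.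
by apply: eq_bigr => n _; rewrite hz_approx_step.
Qed.

(** The error of the approximation is a convergent series of the local errors
    [em_term], so a bound on the differences of the latter that telescopes is a
    bound on the difference of two errors. *)
Lemma zeta_errorB_le alpha beta f h N t u (g : nat -> R) :
  is_hurwitz_zeta alpha f -> is_hurwitz_zeta beta h -> 0 < alpha -> 0 < beta ->
  t != 0 -> u != 0 -> (1 < N)%N ->
  (forall n, (N <= n)%N ->
    normc (em_term (Complex 1 t) (n%:R + alpha) - em_term (Complex 1 u) (n%:R + beta))
      <= g n - g n.+1) ->
  (forall n, (N <= n)%N -> 0 <= g n) ->
  normc ((f (Complex 1 t) - hz_approx N alpha (Complex 1 t))
         - (h (Complex 1 u) - hz_approx N beta (Complex 1 u))) <= g N.
Proof.
move=> hf hh a0 b0 t0 u0 N1 hg g0.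
apply/ler_addgt0Pr => e e0.
have x12 : 1 <= (1 : R) <= 2 by rewrite lexx ler1n.
set A := (`|t| + 6) ^+ 4 / 1600; set B := (`|u| + 6) ^+ 4 / 1600.
have A0 : 0 <= A by apply: mulr_ge0; [apply: exprn_ge0; have := normr_ge0 t => ?; lra | rewrite invr_ge0 ler0n].
have B0 : 0 <= B by apply: mulr_ge0; [apply: exprn_ge0; have := normr_ge0 u => ?; lra | rewrite invr_ge0 ler0n].
pose M := maxn N (Num.bound ((A + B) / e + 3)).
have NM : (N <= M)%N by rewrite leq_maxl.
have M1 : (1 < M)%N by exact: leq_trans NM.
have bM : (A + B) / e + 3 <= M%:R.
  apply: le_trans (ltW (archi_boundP _)) _.
    by rewrite addr_ge0 // divr_ge0 ?addr_ge0 // ltW.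
  by rewrite ler_nat leq_maxr.
have ef := zeta_approx hf a0 x12 t0 M1.
have eh := zeta_approx hh b0 x12 u0 M1.
rewrite -/A in ef; rewrite -/B in eh; clearbody A B.
have Q0 : 0 <= (A + B) / e by rewrite divr_ge0 ?addr_ge0 // ltW.
have inv4 x : 0 < x -> (M%:R + x - 2^-1 - 1) ^- 4 <= ((A + B) / e + 1)^-1.
  move=> x0; have y1 : (A + B) / e + 1 <= M%:R + x - 2^-1 - 1 by lra.
  have Q1 : 0 < (A + B) / e + 1 by lra.
  rewrite lef_pV2 ?posrE ?exprn_gt0 //; last by lra.
  set Y := M%:R + x - 2^-1 - 1 in y1 *; have Y1 : 1 <= Y by lra.
  apply: le_trans y1 _; rewrite exprSr; apply: ler_peMl; last exact: exprn_ege1.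
  by lra.
have tail : (A + B) * ((A + B) / e + 1)^-1 <= e.
  rewrite ler_pdivrMr; last by lra.
  by rewrite mulrDr mulrCA mulfV ?mulr1 ?lerDl ?ltW // gt_eqF.
have -> : f (Complex 1 t) - hz_approx N alpha (Complex 1 t)
    - (h (Complex 1 u) - hz_approx N beta (Complex 1 u)) =
  \sum_(N <= n < M) (em_term (Complex 1 t) (n%:R + alpha)
                     - em_term (Complex 1 u) (n%:R + beta))
  + ((f (Complex 1 t) - hz_approx M alpha (Complex 1 t))
     - (h (Complex 1 u) - hz_approx M beta (Complex 1 u))).
  by rewrite sumrB -!hz_approxB_em //; ring.
apply: le_trans (le_normcD _ _) _.
apply: lerD; first exact: sum_telescope_le.
apply: le_trans (ler_normcB _ _) _.
apply: le_trans (lerD ef eh) _.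
apply: le_trans tail; rewrite mulrDl.
by apply: lerD; apply: ler_wpM2l => //; apply: inv4.
Qed.

Lemma midpoint_errorB (G G' g g' g1 g1' : R -> R[i]) x x' :
  midpoint_error G g g1 x - midpoint_error G' g' g1' x' =
  midpoint_error (fun h => G (x + h) - G' (x' + h)) (fun h => g (x + h) - g' (x' + h))
     (fun h => g1 (x + h) - g1' (x' + h)) 0.
Proof. by rewrite /midpoint_error !add0r !addr0; ring. Qed.

(** The error of the midpoint rule is linear, so the local errors at two
    parameters differ by the local error of a difference. *)
Lemma em_termB_le s s' x x' K : s != 1 -> s' != 1 -> 2^-1 < x -> 2^-1 < x' ->
  (forall h, - 2^-1 <= h <= 2^-1 ->
     normc (em_deriv s 4 (x + h) - em_deriv s' 4 (x' + h)) <= K) ->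
  normc (em_term s x - em_term s' x') <= K / 400.
Proof.
move=> s1 s1' x2 x2' hK; rewrite /em_term midpoint_errorB.
have pos y h : 2^-1 < y -> 0 - 2^-1 <= h <= 0 + 2^-1 -> 0 < y + h by move=> ? ?; lra.
pose D k h := em_deriv s k (x + h) - em_deriv s' k (x' + h).
apply: (@midpoint_error_le _ _ _ _ (D 2%N) (D 3%N) (D 4%N)).
- move=> h hh; apply: CderivB; apply: Cderiv_shift; apply: Cderiv_em_antideriv => //;
    exact: pos hh.
- move=> h hh; apply: CderivB; apply: Cderiv_shift; apply: Cderiv_em_deriv; exact: pos hh.
- move=> h hh; apply: CderivB; apply: Cderiv_shift; apply: Cderiv_em_deriv; exact: pos hh.
- move=> h hh; apply: CderivB; apply: Cderiv_shift; apply: Cderiv_em_deriv; exact: pos hh.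
- move=> h hh; apply: CderivB; apply: Cderiv_shift; apply: Cderiv_em_deriv; exact: pos hh.
- by move=> h; rewrite sub0r add0r; exact: hK.
Qed.

Lemma Complex1_neq1 t : t != 0 -> Complex 1 t != 1.
Proof. by apply: contra_neq => -[]. Qed.

Lemma normc_em_deriv_le t T k y : `|t| <= T -> 1 <= y ->
  normc (em_deriv (Complex 1 t) k y) <= (T + 2 + k%:R) ^+ k * y ^- k.+1.
Proof.
move=> tT y1; rewrite /em_deriv Normc.normcM.
apply: ler_pM; rewrite ?normc_ge0 //.
  by apply: normc_dcoef => //=; rewrite lexx ler1n.
apply: normc_cpow_ge1 => //; rewrite ReD.
by rewrite -(rmorph_nat (real_complex R)) /= -natr1 addrC.
Qed.

Lemma em_deriv_lipschitz_y t T k x h : `|t| <= T -> 1 <= x -> 1 <= h ->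
  normc (em_deriv (Complex 1 t) k h - em_deriv (Complex 1 t) k x) <=
  (T + 2 + k.+1%:R) ^+ k.+1 * (Num.min x h) ^- k.+2 * `|h - x|.
Proof.
move=> tT.
have T0 : 0 <= T + 2 + k.+1%:R.
  by have := le_trans (normr_ge0 t) tT => ?; have := ler0n R k.+1 => ?; lra.
wlog xh : x h / x <= h => [wl x1 h1|].
  have [xh|] := boolP (x <= h); first exact: wl.
  rewrite -ltNge => /ltW hx.
  rewrite normcB distrC; rewrite minC; exact: wl.
move=> x1 h1; rewrite min_l // ger0_norm ?subr_ge0 //.
apply: (@Cderiv_lipschitz R _ (em_deriv (Complex 1 t) k.+1)) => // y /andP[xy yh].
  by apply: Cderiv_em_deriv; lra.
have y1 : 1 <= y by lra.
apply: le_trans (normc_em_deriv_le _ tT y1) _.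
apply: ler_wpM2l; first exact: exprn_ge0.
rewrite lef_pV2 ?posrE ?exprn_gt0; try lra.
by rewrite lerXn2r ?nnegrE //; lra.
Qed.

Lemma Cderiv_dcoef t T k : 0 <= T -> `|t| <= T ->
  exists2 d, Cderiv (fun u => dcoef (Complex 1 u) k) t d &
    normc d <= k%:R * (T + 2 + k%:R) ^+ k.-1.
Proof.
move=> T0 tT.
suff h m : (m <= k)%N -> exists2 d, Cderiv (fun u => dcoef (Complex 1 u) m) t d &
    normc d <= m%:R * (T + 2 + k%:R) ^+ m.-1 by exact: h.
elim: m => [_|m ih mk].
  exists 0; last by rewrite Normc.normc0 mul0r.
  rewrite (_ : (fun u => _) = fun=> 1); first exact: CderivC.
  by apply/funext => u; rewrite /dcoef big_ord0.
have [d hd dm] := ih (ltnW mk).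
exists (d * - (Complex 1 t + m%:R) + dcoef (Complex 1 t) m * - (Complex 0 1 + 0)).
  rewrite (_ : (fun u => _) = fun u => dcoef (Complex 1 u) m * - (Complex 1 u + m%:R)).
    apply: CderivM => //; apply: CderivN; apply: CderivD; last exact: CderivC.
    exact: Cderiv_Complex_im.
  by apply/funext => u; rewrite /dcoef big_ord_recr.
have m_le : (m%:R : R) <= k%:R by rewrite ler_nat ltnW.
have k0 : (0 : R) <= k%:R by exact: ler0n.
have m0 : (0 : R) <= m%:R by exact: ler0n.
have q0 : 0 <= T + 2 + k%:R by lra.
have hm : normc (Complex 1 t + m%:R) <= T + 2 + k%:R.
  apply: le_trans (normc_le_abs _) _.
  rewrite -(rmorph_nat (real_complex R)) /= addr0 ger0_norm ?addr_ge0 //.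
  by lra.
have hc : normc (dcoef (Complex 1 t) m) <= (T + 2 + k%:R) ^+ m.
  apply: le_trans (@normc_dcoef R (Complex 1 t) T m _ tT) _ => /=; first by rewrite lexx ler1n.
  by apply: lerXn2r; rewrite ?nnegrE //; lra.
apply: le_trans (le_normcD _ _) _.
rewrite !Normc.normcM !normcN addr0 normc_im normr1 mulr1 -natr1 mulrDl mul1r /=.
apply: lerD => //.
case: m {ih mk m_le m0 hd hc} dm hm => [|m] dm hm.
  rewrite mul0r in dm.
  have -> : normc d = 0 by apply: le_anti; rewrite dm normc_ge0.
  by rewrite !mul0r.
rewrite /= exprSr mulrA; apply: ler_pM; rewrite ?normc_ge0 //.
Qed.

Lemma ln_le_div50 y : 500 <= y -> 1 + ln y <= y / 50.
Proof.
move=> y5; have y0 : 0 < y by lra.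
have e0 : (0 : R) < 512 by rewrite ltr0n.
have -> : y = (1 + (y / 512 - 1)) * 2 ^+ 9 by field.
have q0 : 0 < 1 + (y / 512 - 1) by rewrite addrC subrK divr_gt0.
rewrite lnM ?posrE ?exprn_gt0 // lnXn //.
have h1 : ln (1 + (y / 512 - 1)) <= y / 512 - 1.
  by apply: le_ln1Dx; have : 0 < y / 512 := divr_gt0 y0 e0; lra.
have h2 : ln (2 : R) <= 1.
  by have -> : (2 : R) = 1 + 1 by []; apply: le_ln1Dx; lra.
have -> : ln (2 : R) *+ 9 = 9%:R * ln 2 by rewrite mulr_natl.
lra.
Qed.

(** A derivative in [t] costs a factor [ln y]. The bound [y / 50] of
    [ln_le_div50] in its place leaves a sum over [n] that telescopes. *)
Lemma em_deriv_lipschitz_t t u T y : `|t| <= T -> `|u| <= T -> 500 <= y ->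
  normc (em_deriv (Complex 1 u) 4 y - em_deriv (Complex 1 t) 4 y) <=
  (T + 6) ^+ 4 / 50 * y ^- 4 * `|u - t|.
Proof.
wlog tu : t u / t <= u => [wl tT uT y5|].
  have [tu|] := boolP (t <= u); first exact: wl.
  by rewrite -ltNge => /ltW ut; rewrite normcB distrC; exact: wl.
move=> tT uT y5; rewrite [`|u - t|]ger0_norm ?subr_ge0 //.
have T0 : 0 <= T by exact: le_trans tT.
have der v : t <= v <= u -> exists d,
    Cderiv (fun v => em_deriv (Complex 1 v) 4 y) v d /\
    normc d <= (T + 6) ^+ 4 / 50 * y ^- 4.
  move=> /andP[tv vu].
  have vT : `|v| <= T.
    by move: tT uT; rewrite !ler_norml => /andP[? ?] /andP[? ?]; apply/andP; split; lra.
  have [d hd dle] := @Cderiv_dcoef v T 4 T0 vT.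
  exists (d * cpow y (Complex 1 v + 4%:R) +
     dcoef (Complex 1 v) 4 * (- (((ln y)%:C)%C * (Complex 0 1 + 0)) * cpow y (Complex 1 v + 4%:R))).
  split.
    apply: CderivM => //; apply: Cderiv_cpow_exponent; apply: CderivD; last exact: CderivC.
    exact: Cderiv_Complex_im.
  have y1 : 1 <= y by lra.
  have y0 : 0 < y by lra.
  have cle : normc (cpow y (Complex 1 v + 4%:R)) <= y ^- 5.
    apply: (normc_cpow_ge1 (k := 5)) => //.
  have kle : normc (dcoef (Complex 1 v) 4) <= (T + 6) ^+ 4.
    have -> : T + 6 = T + 2 + 4%:R by ring.
    by apply: normc_dcoef => //=; rewrite lexx ler1n.
  have E6 : T + 2 + 4 = T + 6 by ring.
  rewrite E6 /= in dle.
  have l0 : 0 <= ln y by rewrite ln_ge0.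
  have l1 := ln_le_div50 y5.
  apply: le_trans (le_normcD _ _) _.
  rewrite !Normc.normcM normcN Normc.normcM addr0 normc_im normr1 mulr1 normc_real ger0_norm //.
  set c := normc (cpow _ _) in cle *.
  set k := normc (dcoef _ _) in kle *.
  set Q := T + 6 in dle kle *.
  have Q6 : 6 <= Q by rewrite /Q; lra.
  have c0 : 0 <= c by exact: normc_ge0.
  have -> : y ^- 4 = y * y ^- 5 by field; rewrite gt_eqF.
  have y5i : 0 <= y ^- 5 by rewrite invr_ge0 exprn_ge0 // ltW.
  have Q40 : 0 <= Q ^+ 4 by apply: exprn_ge0; lra.
  have d4 : normc d <= Q ^+ 4.
    apply: le_trans dle _; rewrite [Q ^+ 4]exprS; apply: ler_wpM2r; last by lra.
    by apply: exprn_ge0; lra.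
  apply: (@le_trans _ _ ((Q ^+ 4 * (1 + ln y)) * c)).
    have -> : Q ^+ 4 * (1 + ln y) * c = Q ^+ 4 * c + Q ^+ 4 * (ln y * c) by ring.
    by apply: lerD; apply: ler_wpM2r => //; apply: mulr_ge0.
  have -> : Q ^+ 4 / 50 * (y * y ^- 5) = (Q ^+ 4 * (y / 50)) * y ^- 5 by ring.
  apply: ler_pM => //; first by apply: mulr_ge0 => //; lra.
  exact: ler_wpM2l.
(* Only the size of the derivative is known, so it is chosen. *)
pose D v : R[i] := xget 0 [set d | Cderiv (fun v => em_deriv (Complex 1 v) 4 y) v d /\
    normc d <= (T + 6) ^+ 4 / 50 * y ^- 4].
apply: (@Cderiv_lipschitz R (fun v => em_deriv (Complex 1 v) 4 y) D) => // v /der[d hd];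
  rewrite /D; case: xgetP => [z _ [] //|/(_ d) []//].
Qed.

Lemma inv_pow4_telescope y : 1 < y ->
  y ^- 4 <= 3^-1 * ((y - 1) ^- 3 - y ^- 3).
Proof.
move=> y1; have u0 : 0 < y - 1 by lra.
have y0 : 0 < y by lra.
rewrite -subr_ge0.
have -> : 3^-1 * ((y - 1) ^- 3 - y ^- 3) - y ^- 4 =
   3^-1 * (6 * (y - 1) ^+ 2 + 4 * (y - 1) + 1)
    / ((y - 1) ^+ 3 * y ^+ 4).
  by field; rewrite !gt_eqF.
apply: divr_ge0; last by rewrite mulr_ge0 // exprn_ge0 // ltW.
by rewrite mulr_ge0 ?invr_ge0 // !addr_ge0 ?mulr_ge0 ?exprn_ge0 // ltW.
Qed.

Lemma ler_invXn n x y : 0 < x -> x <= y -> y ^- n <= x ^- n.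
Proof.
move=> x0 xy; have y0 : 0 < y by exact: lt_le_trans xy.
rewrite lef_pV2 ?posrE ?exprn_gt0 //.
exact: lerXn2r (ltW x0) (ltW y0) xy.
Qed.

Lemma zeta_error_lipschitz_t alpha f N t u T : is_hurwitz_zeta alpha f -> 0 < alpha ->
  t != 0 -> u != 0 -> `|t| <= T -> `|u| <= T -> 502 <= N%:R :> R ->
  normc ((f (Complex 1 u) - hz_approx N alpha (Complex 1 u))
         - (f (Complex 1 t) - hz_approx N alpha (Complex 1 t)))
  <= (T + 6) ^+ 4 / 50 / 400 / 3 * (N%:R + alpha - 2^-1 - 1) ^- 3 * `|u - t|.
Proof.
move=> hf a0 t0 u0 tT uT N5.
have T0 : 0 <= T by exact: le_trans tT.
have N1 : (1 < N)%N by rewrite -(ltr_nat R); lra.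
have Q40 : 0 <= (T + 6) ^+ 4 by apply: exprn_ge0; lra.
pose g n := (T + 6) ^+ 4 / 50 / 400 / 3 * (n%:R + alpha - 2^-1 - 1) ^- 3 * `|u - t|.
have big n : (N <= n)%N -> 502 <= n%:R :> R.
  by move=> Nn; apply: le_trans N5 _; rewrite ler_nat.
apply: (@zeta_errorB_le _ _ _ _ N _ _ g) => //.
- move=> n /big nb; have x5 : 500 <= n%:R + alpha - 2^-1 by lra.
  apply: le_trans (@em_termB_le _ _ _ _ ((T + 6) ^+ 4 / 50 * (n%:R + alpha - 2^-1) ^- 4 * `|u - t|)
     (Complex1_neq1 u0) (Complex1_neq1 t0) _ _ _) _; try lra.
    move=> h /andP[h1 h2]; have y5 : 500 <= n%:R + alpha + h by lra.
    apply: le_trans (em_deriv_lipschitz_t tT uT y5) _.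
    apply: ler_wpM2r => //; apply: ler_wpM2l.
      by apply: mulr_ge0 => //; rewrite invr_ge0 ler0n.
    by apply: ler_invXn; lra.
  have x1 : 1 < n%:R + alpha - 2^-1 by lra.
  have := inv_pow4_telescope x1.
  rewrite /g; have -> : n.+1%:R + alpha - 2^-1 - 1 = n%:R + alpha - 2^-1 by rewrite -natr1; ring.
  set y := _ ^- 4; set a := _ ^- 3; set b := _ ^- 3 => hy.
  rewrite -mulrBl -mulrBr.
  have -> : (T + 6) ^+ 4 / 50 * y * `|u - t| / 400 = ((T + 6) ^+ 4 / 50 / 400) * y * `|u - t|.
    by ring.
  apply: ler_wpM2r => //.
  have -> : (T + 6) ^+ 4 / 50 / 400 / 3 * (a - b) = (T + 6) ^+ 4 / 50 / 400 * (3^-1 * (a - b)).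
    by field.
  apply: ler_wpM2l; last exact: hy.
  by do ?[apply: mulr_ge0; last by rewrite invr_ge0 ler0n].
- move=> n /big nb; apply: mulr_ge0 (normr_ge0 _).
  apply: mulr_ge0; first by do ?[apply: mulr_ge0; last by rewrite invr_ge0 ler0n].
  by rewrite invr_ge0; apply: exprn_ge0; lra.
Qed.

Lemma zeta_error_lipschitz_alpha alpha beta f h N t T a :
  is_hurwitz_zeta alpha f -> is_hurwitz_zeta beta h ->
  0 < a -> a <= alpha -> a <= beta -> t != 0 -> `|t| <= T -> (2 < N)%N ->
  normc ((f (Complex 1 t) - hz_approx N alpha (Complex 1 t))
         - (h (Complex 1 t) - hz_approx N beta (Complex 1 t)))
  <= (T + 7) ^+ 5 / 400 / 4 * (N%:R + a - 2^-1 - 1) ^- 4 * `|alpha - beta|.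
Proof.
move=> hf hh a0 a1 a2 t0 tT N2.
have T0 : 0 <= T by exact: le_trans tT.
have N1 : (1 < N)%N by exact: ltnW.
have b1 : 0 < alpha by lra.
have b2 : 0 < beta by lra.
have Q50 : 0 <= (T + 7) ^+ 5 by apply: exprn_ge0; lra.
pose g n := (T + 7) ^+ 5 / 400 / 4 * (n%:R + a - 2^-1 - 1) ^- 4 * `|alpha - beta|.
have big n : (N <= n)%N -> 3 <= n%:R :> R.
  by move=> Nn; rewrite (ler_nat _ 3) (leq_trans N2).
apply: (@zeta_errorB_le _ _ _ _ N _ _ g) => //.
- move=> n /big nb; have x1 : 1 < n%:R + a - 2^-1 by lra.
  apply: le_trans (@em_termB_le _ _ _ _ ((T + 7) ^+ 5 * (n%:R + a - 2^-1) ^- 5 * `|alpha - beta|)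
     (Complex1_neq1 t0) (Complex1_neq1 t0) _ _ _) _; try lra.
    move=> k /andP[k1 k2].
    have y1 : 1 <= n%:R + alpha + k by lra.
    have y2 : 1 <= n%:R + beta + k by lra.
    apply: le_trans (em_deriv_lipschitz_y 4 tT y2 y1) _.
    have -> : T + 2 + 5 = T + 7 by ring.
    have -> : n%:R + alpha + k - (n%:R + beta + k) = alpha - beta by ring.
    apply: ler_wpM2r => //; apply: ler_wpM2l => //.
    have mle : n%:R + a - 2^-1 <= Num.min (n%:R + beta + k) (n%:R + alpha + k).
      by rewrite le_min; apply/andP; split; lra.
    set m := Num.min _ _ in mle *.
    have m1 : 1 <= m by lra.
    have m0 : 0 < m by lra.
    apply: (@le_trans _ _ (m ^- 5)); last by apply: ler_invXn mle; lra.
    rewrite lef_pV2 ?posrE ?exprn_gt0 // [leRHS]exprS ler_peMl //.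
    exact: exprn_ge0 (ltW m0).
  have := inv_pow5_telescope x1.
  rewrite /g; have -> : n.+1%:R + a - 2^-1 - 1 = n%:R + a - 2^-1 by rewrite -natr1; ring.
  set y := _ ^- 5; set c := _ ^- 4; set b := _ ^- 4 => hy.
  rewrite -mulrBl -mulrBr.
  have -> : (T + 7) ^+ 5 * y * `|alpha - beta| / 400 = ((T + 7) ^+ 5 / 400) * y * `|alpha - beta|.
    by ring.
  apply: ler_wpM2r; first exact: normr_ge0.
  have -> : (T + 7) ^+ 5 / 400 / 4 * (c - b) = (T + 7) ^+ 5 / 400 * (4^-1 * (c - b)).
    by field.
  apply: ler_wpM2l; last exact: hy.
  by apply: mulr_ge0 Q50 _; rewrite invr_ge0 ler0n.
- move=> n /big nb; apply: mulr_ge0 (normr_ge0 _).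
  apply: mulr_ge0; first by do ?[apply: mulr_ge0; last by rewrite invr_ge0 ler0n].
  by rewrite invr_ge0; apply: exprn_ge0; lra.
Qed.

End ErrorLipschitz.

(** * Ball arithmetic *)

(** A ball holds a center and a radius in units of [2 ^ -48]. *)
Record rball := RBall {rcenter : Z; rradius : Z}.
Record cball := CBall {creal : Z; cimag : Z; cradius : Z}.

Definition unit48 : Z := Zpos 281474976710656.
Definition unit96 : Z := Zpos 79228162514264337593543950336.
Definition round48 (a : Z) : Z := Z.shiftr a 48.

Definition rball_Z k := RBall (Z.mul unit48 k) 0.
Definition rball_add x y :=
  let 'RBall a r := x in let 'RBall b s := y in RBall (Z.add a b) (Z.add r s).
Definition rball_opp x := let 'RBall a r := x in RBall (Z.opp a) r.
Definition rball_mulZ k x := let 'RBall a r := x in RBall (Z.mul k a) (Z.mul (Z.abs k) r).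
Definition rball_mul x y :=
  let 'RBall a r := x in let 'RBall b s := y in
  RBall (round48 (Z.mul a b))
    (Z.add (round48 (Z.add (Z.mul (Z.abs a) s)
                        (Z.add (Z.mul (Z.abs b) r) (Z.mul r s)))) 2).
(** [d] bounds the deviation of [x * c] from 1, hence the relative error of [c].
    The default answer covers the inverse of any number at least 1/2. *)
Definition rball_inv x :=
  let 'RBall a r := x in
  let c := Z.div unit96 a in
  let d := Z.add (round48 (Z.add (Z.abs (Z.sub unit96 (Z.mul c a))) (Z.mul (Z.abs c) r))) 1 in
  let e := round48 (Z.mul (Z.abs c) d) in
  if Z.leb (Z.mul 256 d) unit48 then RBall c (Z.add e (Z.add (Z.shiftr e 7) 4))
  else RBall unit48 unit48.

Definition cball0 := CBall 0 0 0.
Definition cball_add x y :=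
  let 'CBall a b r := x in let 'CBall c d s := y in
  CBall (Z.add a c) (Z.add b d) (Z.add r s).
Definition cball_opp x := let 'CBall a b r := x in CBall (Z.opp a) (Z.opp b) r.
Definition cball_muli x := let 'CBall a b r := x in CBall (Z.opp b) a r.
Definition cball_addr x z :=
  let 'RBall a r := x in let 'CBall c d s := z in CBall (Z.add a c) d (Z.add r s).
Definition cball_scale x z :=
  let 'RBall a r := x in let 'CBall c d s := z in
  CBall (round48 (Z.mul a c)) (round48 (Z.mul a d))
    (Z.add (round48 (Z.add (Z.mul (Z.abs a) s)
                     (Z.mul r (Z.add (Z.abs c) (Z.add (Z.abs d) s))))) 3).
Definition cball_umul x y :=
  let 'CBall a b r := x in let 'CBall c d s := y in
  CBall (round48 (Z.sub (Z.mul a c) (Z.mul b d)))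
        (round48 (Z.add (Z.mul a d) (Z.mul b c)))
    (Z.add (round48 (Z.add (Z.mul unit48 (Z.add r s)) (Z.mul r s))) 3).

Local Arguments Z.mul : simpl never.
Local Arguments Z.add : simpl never.
Local Arguments Z.sub : simpl never.
Local Arguments Z.opp : simpl never.
Local Arguments Z.abs : simpl never.
Local Arguments Z.div : simpl never.
Local Arguments Z.shiftr : simpl never.
Local Arguments Z.leb : simpl never.

(** * Soundness of ball arithmetic *)

Section BallArithmetic.
Context {R : realType}.
Implicit Types (a b c d r s k : Z) (x y : rball) (z w : cball) (u v : R) (p q : R[i]).
Local Notation ZR := (@ZR R).

Let E : R := ZR unit48.
Let E0 : 0 < E. Proof. exact: ZR_gt0. Qed.

Definition rin x u := `|u * ZR unit48 - ZR (rcenter x)| <= ZR (rradius x).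
Definition cin z p :=
  normc (p * (ZR unit48 : R)%:C%C - Complex (ZR (creal z)) (ZR (cimag z))) <= ZR (cradius z).

Lemma ZR_abs a : ZR (Z.abs a) = `|ZR a| :> R.
Proof.
case: a => [|a|a] /=; first by rewrite ZR0 normr0.
  by rewrite ger0_norm //; apply: ZR_ge0.
have -> : ZR (Zneg a) = - ZR (Zpos a) :> R by rewrite -ZRN.
by rewrite normrN ger0_norm //; apply: ZR_ge0.
Qed.

Lemma shiftr7_le a : Z.leb a (Z.add (Z.mul 128 (Z.shiftr a 7)) 128).
Proof.
rewrite (Z.shiftr_div_pow2 a 7 (Zle_0_pos 7)); apply/Z.leb_le.
have h : Zpos 128 <> Z0 by [].
rewrite [X in Z.le X _](Z.div_mod a 128 h).
apply: (proj1 (Z.add_le_mono_l _ _ _)); apply: Z.lt_le_incl.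
by have [] := Z.mod_pos_bound a 128 (Pos2Z.is_pos _).
Qed.

Lemma round48E a : exists r, [/\ a = Z.add (Z.mul unit48 (round48 a)) r,
  Z.leb 0 r & Z.ltb r unit48].
Proof.
have -> : round48 a = Z.div a unit48.
  by rewrite /round48 (Z.shiftr_div_pow2 a 48 (Zle_0_pos 48)); congr Z.div; vm_compute.
have h : Z.lt Z0 unit48 by exact: Pos2Z.is_pos.
have [h1 h2] := Z.mod_pos_bound a _ h.
exists (Z.modulo a unit48); split; last 2 first.
- by apply/Z.leb_le.
- by apply/Z.ltb_lt.
by apply: Z.div_mod => e; rewrite e in h.
Qed.

Lemma round48_bounds a : 0 <= ZR a - E * ZR (round48 a) < E.
Proof.
have [r [ha /ZR_ge0 h0 /ZR_lt h1]] := round48E a.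
have -> : ZR a - E * ZR (round48 a) = ZR r by rewrite {1}ha ZRD ZRM /E; ring.
by rewrite h0; exact: h1.
Qed.

Lemma ZR_round48_le a u : u * E <= ZR a -> u <= ZR (Z.add (round48 a) 1).
Proof.
have /andP[_ h] := round48_bounds a.
rewrite ZRD ZR1 => hu; rewrite -(ler_pM2r E0) mulrDl mul1r; lra.
Qed.

Lemma round_real u a c : `|u * E - ZR a| <= ZR c ->
  `|u - ZR (round48 a)| <= ZR (Z.add (round48 c) 2).
Proof.
move=> h; have /andP[a0 a1] := round48_bounds a.
have hE : `|u - ZR (round48 a)| * E <= ZR c + E.
  rewrite -[E in X in X <= _]gtr0_norm // -normrM mulrBl.
  have -> : u * E - ZR (round48 a) * E = (u * E - ZR a) + (ZR a - E * ZR (round48 a)) by ring.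
  apply: le_trans (ler_normD _ _) _; apply: lerD => //.
  by rewrite ger0_norm // ltW.
have : (`|u - ZR (round48 a)| - 1) * E <= ZR c by rewrite mulrBl mul1r; lra.
move=> /ZR_round48_le; rewrite !ZRD ZR1; have -> : ZR 2 = 1 + 1 :> R by rewrite -ZR1 -ZRD.
by move=> ?; lra.
Qed.

Lemma round_complex p a b c :
  normc (p * E%:C%C - Complex (ZR a) (ZR b)) <= ZR c ->
  normc (p - Complex (ZR (round48 a)) (ZR (round48 b))) <= ZR (Z.add (round48 c) 3).
Proof.
move=> h; have /andP[a0 a1] := round48_bounds a; have /andP[b0 b1] := round48_bounds b.
set n := normc _.
have hE : n * E <= ZR c + (E + E).
  rewrite /n -[E in X in X <= _]gtr0_norm // -(normc_real E) -Normc.normcM.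
  have -> : (p - Complex (ZR (round48 a)) (ZR (round48 b))) * E%:C%C =
    (p * E%:C%C - Complex (ZR a) (ZR b)) +
    Complex (ZR a - E * ZR (round48 a)) (ZR b - E * ZR (round48 b)).
    by apply: complex_ext; rewrite !ReImE /= !mulr0; ring.
  apply: le_trans (le_normcD _ _) _; apply: lerD => //.
  apply: le_trans (normc_le_abs _) _ => /=.
  by apply: lerD; rewrite ger0_norm // ltW.
have : (n - 2) * E <= ZR c by rewrite mulrBl; lra.
move=> /ZR_round48_le; rewrite !ZRD ZR1; have -> : ZR 3 = 1 + (1 + 1) :> R by rewrite -ZR1 -!ZRD.
by move=> ?; lra.
Qed.

Lemma rball_ZP k : rin (rball_Z k) (ZR k).
Proof. by rewrite /rin /= ZRM [ZR k * _]mulrC subrr normr0 ZR0. Qed.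

Lemma rball_addP x y u v : rin x u -> rin y v -> rin (rball_add x y) (u + v).
Proof.
case: x y => [a r] [b s]; rewrite /rin /= => hx hy; rewrite !ZRD.
have -> : (u + v) * ZR unit48 - (ZR a + ZR b) =
  (u * ZR unit48 - ZR a) + (v * ZR unit48 - ZR b) by ring.
by apply: le_trans (ler_normD _ _) _; exact: lerD.
Qed.

Lemma rball_oppP x u : rin x u -> rin (rball_opp x) (- u).
Proof.
case: x => [a r]; rewrite /rin /= => h.
by rewrite ZRN mulNr -opprD normrN.
Qed.

Lemma rball_mulZP k x u : rin x u -> rin (rball_mulZ k x) (ZR k * u).
Proof.
case: x => [a r]; rewrite /rin /= => h.
by rewrite !ZRM ZR_abs -mulrA -mulrBr normrM ler_wpM2l.
Qed.

Lemma rball_mulP x y u v : rin x u -> rin y v -> rin (rball_mul x y) (u * v).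
Proof.
case: x y => [a r] [b s]; rewrite /rin /= => hx hy; apply: round_real.
rewrite !ZRD !ZRM !ZR_abs.
set U := u * _ in hx; set V := v * _ in hy.
have -> : u * v * ZR unit48 * E - ZR a * ZR b =
  ZR a * (V - ZR b) + (ZR b * (U - ZR a) + (U - ZR a) * (V - ZR b)).
  by rewrite /U /V /E; ring.
apply: le_trans (ler_normD _ _) _; apply: lerD.
  by rewrite normrM ler_wpM2l.
apply: le_trans (ler_normD _ _) _; apply: lerD.
  by rewrite normrM ler_wpM2l.
by rewrite normrM; apply: ler_pM.
Qed.

Lemma unit96E : ZR unit96 = E * E.
Proof. by rewrite -ZRM. Qed.

Lemma rball_invP x u : 2^-1 <= u -> rin x u -> rin (rball_inv x) u^-1.
Proof.
move=> u2; have u0 : 0 < u by lra.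
case: x => [a r] hx0; have hx : `|u * ZR unit48 - ZR a| <= ZR r by exact: hx0.
rewrite /rball_inv; cbv zeta.
set c := Z.div _ _; set m := Z.add (Z.abs _) _; set d := Z.add (round48 m) 1.
set n := round48 _.
case: ifP => [|_]; rewrite /rin /rcenter /rradius; last first.
  have i0 : 0 < u^-1 by rewrite invr_gt0.
  have i2 : u^-1 <= 2 by rewrite -[2]invrK lef_pV2 ?posrE ?invr_gt0.
  have e0 : 0 < ZR unit48 by exact: E0.
  rewrite ler_norml; apply/andP; split.
    by rewrite lerBrDr addNr; apply: mulr_ge0; exact: ltW.
  by rewrite lerBlDr -[X in _ <= X + X]mul1r -mulrDl; apply: ler_wpM2r => //; exact: ltW.
move=> /(@ZR_le R); rewrite ZRM => guard.
have hm : `|E * E - (u * E) * ZR c| <= ZR m.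
  rewrite /m ZRD ZRM !ZR_abs ZRB ZRM unit96E.
  have -> : E * E - u * E * ZR c = (E * E - ZR c * ZR a) - ZR c * (u * E - ZR a) by ring.
  apply: le_trans (ler_normB _ _) _; apply: lerD => //.
  by rewrite normrM ler_wpM2l.
have hd : `|E - u * ZR c| <= ZR d.
  apply: ZR_round48_le; rewrite -[E in X in _ * X <= _]gtr0_norm // -normrM.
  by rewrite mulrBl mulrAC.
have E256 : 256%:R * ZR d <= E by rewrite -ZR_nat; exact: guard.
have d0 : 0 <= ZR d by exact: le_trans hd.
have cpos : 0 < ZR c.
  rewrite ltNge; apply/negP => c0.
  have uc : u * ZR c <= 0 by rewrite pmulr_rle0.
  have := le_trans (ler_norm _) hd; have := E0; move: E256 d0 uc.
  by set dd := ZR d; set cc := u * _; clear; lra.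
have hn : ZR c * ZR d <= ZR n * E + E.
  have /andP[_] := round48_bounds (Z.mul (Z.abs c) d).
  by rewrite ZRM ZR_abs (gtr0_norm cpos) -/n [E * _]mulrC; lra.
have [sn hs] : exists s, Z.shiftr n 7 = s /\ ZR n <= 128%:R * ZR s + 128%:R.
  exists (Z.shiftr n 7); split => //; move: (shiftr7_le n).
  by move=> /(@ZR_le R); rewrite ZRD ZRM -(ZR_nat 128).
case: hs => sE hs; rewrite !ZRD sE.
have -> : ZR 4 = 4%:R by rewrite -ZR_nat.
set y := u^-1; have yu : y * u = 1 by rewrite mulVf ?gt_eqF.
have y0 : 0 < y by rewrite invr_gt0.
have hy : `|y * ZR unit48 - ZR c| <= y * ZR d.
  have -> : y * ZR unit48 - ZR c = y * (E - u * ZR c) by rewrite mulrBr mulrA yu mul1r.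
  by rewrite normrM (gtr0_norm y0) ler_wpM2l // ltW.
apply: le_trans (hy) _.
set D := y * ZR d in hy *.
have D0 : 0 <= D by rewrite mulr_ge0 // ltW.
have h1 : y * E - ZR c <= D by exact: le_trans (ler_norm _) hy.
have h2 : D * E <= ZR c * ZR d + D * ZR d.
  have -> : D * E = y * E * ZR d by rewrite /D mulrAC.
  by rewrite -mulrDl; apply: ler_wpM2r => //; lra.
have h3 : D * ZR d * 256%:R <= D * E.
  by rewrite -mulrA [ZR d * _]mulrC; apply: ler_wpM2l.
have h4 : D * 255%:R <= (ZR n + 1) * 256%:R.
  rewrite -(ler_pM2r E0).
  have -> : D * 255%:R * E = D * E * 255%:R by ring.
  have -> : (ZR n + 1) * 256%:R * E = (ZR n * E + E) * 256%:R by ring.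
  by move: h2 h3 hn; set A := D * E; set B := D * ZR d; set C := ZR c * ZR d; set F := ZR n * E + E; clear; lra.
by move: h4 D0 hs; set A := ZR n; set B := ZR sn; clear; lra.
Qed.

Lemma cball0P : cin cball0 0.
Proof.
rewrite /cin mul0r sub0r normcN [creal _]/= [cimag _]/= [cradius _]/= ZR0.
by rewrite Normc.normc0.
Qed.

Lemma cball_addP z w p q : cin z p -> cin w q -> cin (cball_add z w) (p + q).
Proof.
case: z w => [a b r] [c d s]; rewrite /cin /= => hz hw; rewrite !ZRD.
have -> : (p + q) * (ZR unit48)%:C%C - Complex (ZR a + ZR c) (ZR b + ZR d) =
  (p * (ZR unit48)%:C%C - Complex (ZR a) (ZR b)) +
  (q * (ZR unit48)%:C%C - Complex (ZR c) (ZR d)).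
  by apply: complex_ext; rewrite !ReImE /=; ring.
by apply: le_trans (le_normcD _ _) _; exact: lerD.
Qed.

Lemma cball_oppP z p : cin z p -> cin (cball_opp z) (- p).
Proof.
case: z => [a b r]; rewrite /cin /= => h; rewrite !ZRN.
have -> : - p * (ZR unit48)%:C%C - Complex (- ZR a) (- ZR b) =
  - (p * (ZR unit48)%:C%C - Complex (ZR a) (ZR b)).
  by apply: complex_ext; rewrite !ReImE /=; ring.
by rewrite normcN.
Qed.

Lemma cball_muliP z p : cin z p -> cin (cball_muli z) (Complex 0 1 * p).
Proof.
case: z => [a b r]; rewrite /cin /= => h; rewrite !ZRN.
have -> : Complex 0 1 * p * (ZR unit48)%:C%C - Complex (- ZR b) (ZR a) =
  Complex 0 1 * (p * (ZR unit48)%:C%C - Complex (ZR a) (ZR b)).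
  by apply: complex_ext; rewrite !ReImE /=; ring.
by rewrite Normc.normcM normc_im normr1 mul1r.
Qed.

Lemma cball_addrP x z u p : rin x u -> cin z p -> cin (cball_addr x z) (u%:C%C + p).
Proof.
case: x z => [a r] [c d s]; rewrite /rin /cin /= => hx hz; rewrite !ZRD.
have -> : (u%:C%C + p) * (ZR unit48)%:C%C - Complex (ZR a + ZR c) (ZR d) =
  (u * ZR unit48 - ZR a)%:C%C + (p * (ZR unit48)%:C%C - Complex (ZR c) (ZR d)).
  by apply: complex_ext; rewrite !ReImE /=; ring.
apply: le_trans (le_normcD _ _) _; apply: lerD => //.
by rewrite normc_real.
Qed.

Lemma cball_scaleP x z u p : rin x u -> cin z p -> cin (cball_scale x z) (u%:C%C * p).
Proof.
case: x z => [a r] [c d s]; rewrite /rin /cin => hx hz.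
have {}hx : `|u * ZR unit48 - ZR a| <= ZR r by exact: hx.
have {}hz : normc (p * (ZR unit48)%:C%C - Complex (ZR c) (ZR d)) <= ZR s by exact: hz.
apply: round_complex.
rewrite ZRD !ZRM !ZRD !ZR_abs.
set U := u * _ in hx; set P := p * _ in hz.
have -> : u%:C%C * p * (ZR unit48)%:C%C * E%:C%C - Complex (ZR a * ZR c) (ZR a * ZR d) =
  (ZR a)%:C%C * (P - Complex (ZR c) (ZR d)) + (U - ZR a)%:C%C * P.
  by rewrite /U /P /E; apply: complex_ext; rewrite !ReImE /=; ring.
clearbody U P; apply: le_trans (le_normcD _ _) _; rewrite !Normc.normcM !normc_real.
apply: lerD; first by rewrite ler_wpM2l.
apply: ler_pM; rewrite ?normr_ge0 ?normc_ge0 //.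
have -> : P = Complex (ZR c) (ZR d) + (P - Complex (ZR c) (ZR d)) by ring.
apply: le_trans (le_normcD _ _) _; rewrite addrA; apply: lerD => //.
exact: normc_le_abs.
Qed.

(** For numbers of modulus 1 the radii add up, with no loss in a long product. *)
Lemma cball_umulP z w p q : normc p = 1 -> cin z p -> cin w q ->
  normc q = 1 -> cin (cball_umul z w) (p * q).
Proof.
case: z w => [a b r] [c d s] p1; rewrite /cin => hz hw q1.
have {}hz : normc (p * (ZR unit48)%:C%C - Complex (ZR a) (ZR b)) <= ZR r by exact: hz.
have {}hw : normc (q * (ZR unit48)%:C%C - Complex (ZR c) (ZR d)) <= ZR s by exact: hw.
apply: round_complex.
rewrite ZRB !ZRD !ZRM !ZRD.
set P := p * _ in hz; set Q := q * _ in hw.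
have nP : normc P = E by rewrite Normc.normcM p1 mul1r normc_real gtr0_norm.
have nQ : normc Q = E by rewrite Normc.normcM q1 mul1r normc_real gtr0_norm.
have -> : p * q * (ZR unit48)%:C%C * E%:C%C -
    Complex (ZR a * ZR c - ZR b * ZR d) (ZR a * ZR d + ZR b * ZR c) =
  P * (Q - Complex (ZR c) (ZR d)) + Q * (P - Complex (ZR a) (ZR b))
  - (P - Complex (ZR a) (ZR b)) * (Q - Complex (ZR c) (ZR d)).
  by rewrite /P /Q /E; apply: complex_ext; rewrite !ReImE /=; ring.
clearbody P Q; apply: le_trans (ler_normcB _ _) _; apply: lerD; last first.
  by rewrite Normc.normcM; apply: ler_pM; rewrite ?normc_ge0.
apply: le_trans (le_normcD _ _) _; rewrite !Normc.normcM nP nQ.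
by rewrite mulrDr addrC; apply: lerD; apply: ler_wpM2l => //; exact: ltW.
Qed.

End BallArithmetic.

(** * Balls for the exponential on the imaginary axis *)

Fixpoint factZ (n : nat) : Z := if n is m.+1 then Z.mul (Z.of_nat n) (factZ m) else 1.
Definition rball_invZ k := RBall (Z.div unit48 k) 1.
Definition rball_horner (cs : seq rball) x :=
  foldr (fun c acc => rball_add c (rball_mul x acc)) (RBall 0 0) cs.
(** Value of the polynomial at [i x]. *)
Definition cball_horner (cs : seq rball) x :=
  foldr (fun c acc => cball_addr c (cball_muli (cball_scale x acc))) cball0 cs.

Definition exp_coef k := rball_invZ (factZ k).
Definition artanh_coef k := rball_invZ (Z.of_nat k.*2.+1).
Definition exp_coefs : seq rball := Eval vm_compute in [seq exp_coef k | k <- iota 0 10].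
Definition artanh_coefs20 : seq rball := Eval vm_compute in [seq artanh_coef k | k <- iota 0 20].
Definition artanh_coefs10 : seq rball := Eval vm_compute in [seq artanh_coef k | k <- iota 0 10].
Definition artanh_coefs5 : seq rball := Eval vm_compute in [seq artanh_coef k | k <- iota 0 5].
Definition artanh_coefs3 : seq rball := Eval vm_compute in [seq artanh_coef k | k <- iota 0 3].

(** Twice the inverse hyperbolic tangent, [ln ((1 + z) / (1 - z))]; the last unit
    of the radius is for the truncation of the series. *)
Definition rball_log cs z :=
  let 'RBall a r := rball_mul z (rball_horner cs (rball_mul z z)) in
  RBall (Z.mul 2 a) (Z.add (Z.mul 2 r) 1).

(** The threshold [70368744177664] is 1/4 in units of [2 ^ -48]. *)
Fixpoint halvings fuel c : nat :=
  if fuel is n.+1 then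
    if Z.leb c 70368744177664 then 0%N else (halvings n (Z.div2 c)).+1
  else 0%N.
Fixpoint cball_sqn n z := if n is m.+1 then cball_sqn m (cball_umul z z) else z.
Definition cball_widen e z := let 'CBall a b r := z in CBall a b (Z.add r e).

(** [exp (i x)], from the Taylor polynomial at [x / 2 ^ h] and [h] squarings. The
    120 units cover the Taylor remainder. An argument that the halvings do not
    make small gets a disk that covers the whole unit circle. *)
Definition cball_cis x :=
  let 'RBall c r := x in
  let h := halvings 24 (Z.abs c) in
  let m := Z.shiftr c (Z.of_nat h) in
  if Z.leb (Z.abs m) 70368744177664 then
    cball_widen r (cball_sqn h (cball_widen 120 (cball_horner exp_coefs (RBall m 1))))
  else CBall 0 0 (Z.mul 2 unit48).

Local Arguments Z.of_nat : simpl never.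

Section ElementaryFunctions.
Context {R : realType}.
Implicit Types (u v x t : R) (p q : R[i]).
Local Notation ZR := (@ZR R).
Let E : R := ZR unit48.
Let E0 : 0 < E. Proof. exact: ZR_gt0. Qed.

Lemma ZR2 : ZR 2 = 2.
Proof. exact: (ZR_nat 2). Qed.

Lemma factZE n : ZR (factZ n) = n`!%:R.
Proof. by elim: n => [|n ih]; rewrite ?ZR1 // factS natrM -ih -ZR_nat -ZRM. Qed.

Lemma rball_invZP k : Z.ltb 0 k -> rin (rball_invZ k) (ZR k)^-1.
Proof.
move=> k0; have kR := @ZR_gt0 R _ k0.
rewrite /rin /rcenter /rradius /rball_invZ ZR1.
have kZ : Z.lt Z0 k by apply/Z.ltb_lt.
have kn : k <> Z0 by move=> e; rewrite e in kZ.
have [h1 h2] := Z.mod_pos_bound unit48 k kZ.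
have e := Z.div_mod unit48 k kn.
have {}h1 : 0 <= ZR (Z.modulo unit48 k) by apply: ZR_ge0; apply/Z.leb_le.
have {}h2 : ZR (Z.modulo unit48 k) < ZR k by apply: ZR_lt; apply/Z.ltb_lt.
rewrite [X in _ * ZR X]e ZRD ZRM mulrDr mulrA mulVf ?gt_eqF // mul1r addrC addrA addNr add0r.
rewrite ger0_norm; last by rewrite mulr_ge0 // invr_ge0 ltW.
by rewrite ler_pdivrMl // mulr1 ltW.
Qed.

Lemma rball_hornerP (f : nat -> rball) (g : nat -> R) s (x : rball) u :
  (forall k, rin (f k) (g k)) -> rin x u ->
  rin (rball_horner (map f s) x) (foldr (fun k a => g k + u * a) 0 s).
Proof.
move=> hf hx; elim: s => [|k s ih] /=; last by apply: rball_addP => //; exact: rball_mulP.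
by rewrite /rin /= mul0r ZR0 subrr normr0.
Qed.

Lemma cball_hornerP (f : nat -> rball) (g : nat -> R) s (x : rball) u :
  (forall k, rin (f k) (g k)) -> rin x u ->
  cin (cball_horner (map f s) x)
    (foldr (fun k a => (g k)%:C%C + Complex 0 1 * (u%:C%C * a)) 0 s).
Proof.
move=> hf hx; elim: s => [|k s ih] /=; last first.
  by apply: cball_addrP => //; apply: cball_muliP; exact: cball_scaleP.
exact: cball0P.
Qed.

Lemma horner_sum (A : comNzRingType) (g : nat -> A) (u : A) m n :
  foldr (fun k a => g k + u * a) 0 (iota n m) = \sum_(k < m) g (n + k)%N * u ^+ k.
Proof.
elim: m n => [|m ih] n /=; first by rewrite big_ord0.
rewrite big_ord_recl addn0 mulr1 ih mulr_sumr; congr (_ + _).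
by apply: eq_bigr => k _; rewrite /= exprS mulrCA addSnnS.
Qed.

Definition cis_taylor m (e x : R) : R[i] :=
  \sum_(k < m) (k`!%:R^-1)%:C%C * (Complex 0 (e * x)) ^+ k.

Lemma Cderiv_cis_taylor m e x :
  Cderiv (cis_taylor m.+1 e) x (Complex 0 e * cis_taylor m e x).
Proof.
have lin : Cderiv (fun x => Complex 0 (e * x)) x (Complex 0 e).
  rewrite (_ : (fun x => _) = fun x => Complex 0 e * x%:C%C).
    apply: (Cderiv_eq (CderivMl _ (Cderiv_real (is_derive_id x 1)))).
    by apply: complex_ext; rewrite !ReImE /=; ring.
  by apply/funext => y; apply: complex_ext; rewrite !ReImE /=; ring.
have pw k : Cderiv (fun x => (Complex 0 (e * x)) ^+ k.+1) x
   (k.+1%:R * Complex 0 e * (Complex 0 (e * x)) ^+ k).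
  elim: k => [|k ih]; first by rewrite expr0 mulr1 mul1r; apply: lin.
  rewrite (_ : (fun x => _) = fun x => (Complex 0 (e * x)) ^+ k.+1 * Complex 0 (e * x)).
    apply: (Cderiv_eq (CderivM ih lin)).
    by rewrite -[k.+2%:R]natr1 exprSr; ring.
  by apply/funext => y; rewrite exprSr.
elim: m => [|m ih].
  rewrite (_ : cis_taylor 1 e = fun=> 1); last first.
    by apply/funext => y; rewrite /cis_taylor big_ord1 expr0 mulr1 fact0 invr1.
  by apply: (Cderiv_eq (CderivC _ _)); rewrite /cis_taylor big_ord0 mulr0.
rewrite (_ : cis_taylor m.+2 e =
  fun y => cis_taylor m.+1 e y + (m.+1`!%:R^-1)%:C%C * (Complex 0 (e * y)) ^+ m.+1); last first.
  by apply/funext => y; rewrite /cis_taylor big_ord_recr.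
apply: (Cderiv_eq (CderivD ih (CderivMl _ (pw m)))).
rewrite [cis_taylor m.+1 e x]big_ord_recr /= -/(cis_taylor m e x) mulrDr; congr (_ + _).
rewrite factS natrM invfM rmorphM /=.
have -> : ((m.+1%:R : R)^-1)%:C%C = (m.+1%:R : R[i])^-1 by rewrite fmorphV rmorph_nat.
have m0 : (m.+1%:R : R[i]) != 0 by rewrite pnatr_eq0.
set a := m.+1%:R in m0 *; set c := (_%:C)%C; set X := _ ^+ m.
transitivity (a^-1 * a * (Complex 0 e * (c * X))); first by ring.
by rewrite mulVf // mul1r.
Qed.

(** Each remainder is [i] times the primitive of the preceding one. *)
Lemma cis_taylor_le m e x : `|e| <= 1 -> 0 <= x ->
  normc (cexp (Complex 0 (e * x)) - cis_taylor m e x) <= m`!%:R^-1 * x ^+ m.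
Proof.
move=> e1; elim: m x => [|m ih] x x0.
  by rewrite /cis_taylor big_ord0 subr0 normc_cexp expR0 fact0 invr1 mul1r.
rewrite factS natrM invfM [_^-1 * _^-1]mulrC.
apply: (@Cderiv_pow_bound R (fun x => cexp (Complex 0 (e * x)) - cis_taylor m.+1 e x)
  (fun x => Complex 0 e * (cexp (Complex 0 (e * x)) - cis_taylor m e x))) => //.
- rewrite mulr0 (_ : Complex 0 0 = 0) // cexp0 /cis_taylor big_ord_recl /= expr0.
  rewrite fact0 invr1 mulr1 big1 ?addr0 ?subrr // => k _.
  by rewrite mulr0 expr0n /= mulr0.
- move=> y yx; rewrite mulrBr; apply: CderivB; last exact: Cderiv_cis_taylor.
  apply: Cderiv_cexp; split => /=; first exact: is_derive_cst.
  have h := is_deriveZ e (is_derive_id y (1 : R)).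
  by apply: (is_derive_eq h); rewrite /GRing.scale /= mulr1.
- move=> y /andP[y0 yx]; rewrite Normc.normcM normc_im.
  apply: le_trans (ih _ y0).
  by rewrite -[leRHS]mul1r ler_wpM2r // normc_ge0.
Qed.

Lemma cis_taylor_abs m t :
  normc (cexp (Complex 0 t) - cis_taylor m 1 t) <= m`!%:R^-1 * `|t| ^+ m.
Proof.
have [t0|/ltW t0] := leP 0 t.
  have := @cis_taylor_le m 1 t; rewrite normr1 mul1r ger0_norm //; exact.
have := @cis_taylor_le m (-1) (- t); rewrite /cis_taylor !mulN1r opprK normrN1 ler0_norm //.
have -> : \sum_(k < m) (k`!%:R^-1)%:C%C * Complex 0 (1 * t) ^+ k =
          \sum_(k < m) (k`!%:R^-1)%:C%C * Complex 0 t ^+ k :> R[i] by rewrite mul1r.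
by apply=> //; rewrite oppr_ge0.
Qed.

Lemma cexp_imD u v : cexp (Complex 0 (u + v)) = cexp (Complex 0 u) * cexp (Complex 0 v) :> R[i].
Proof. by rewrite -cexpD; congr cexp; apply: complex_ext; rewrite /= ?addr0. Qed.

Lemma normc_cexp_im u : normc (cexp (Complex 0 u)) = 1.
Proof. by rewrite normc_cexp expR0. Qed.

Lemma cexp_im_lipschitz u v :
  normc (cexp (Complex 0 u) - cexp (Complex 0 v)) <= `|u - v|.
Proof.
have -> : u = v + (u - v) by ring.
rewrite cexp_imD -[X in _ - X]mulr1 -mulrBr Normc.normcM normc_cexp_im mul1r.
have -> : v + (u - v) - v = u - v by ring.
have := cis_taylor_abs 1 (u - v).
by rewrite /cis_taylor big_ord1 !expr0 fact0 invr1 mulr1 mul1r expr1.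
Qed.

Lemma exp_coefP k : rin (exp_coef k) (k`!%:R^-1 : R).
Proof.
rewrite -factZE; apply: rball_invZP; elim: k => [//|k ih].
by apply/Z.ltb_lt; apply: Z.mul_pos_pos; [exact/Z.ltb_lt; lia | apply/Z.ltb_lt].
Qed.

Lemma cball_widenP e z p q : cin z p -> normc (q - p) * E <= ZR e ->
  cin (cball_widen e z) q.
Proof.
case: z => [a b r]; rewrite /cin /= ZRD => h he.
have -> : q * (ZR unit48)%:C%C - Complex (ZR a) (ZR b) =
  (p * (ZR unit48)%:C%C - Complex (ZR a) (ZR b)) + (q - p) * (ZR unit48)%:C%C.
  by apply: complex_ext; rewrite !ReImE /=; ring.
apply: le_trans (le_normcD _ _) _; apply: lerD => //.
by rewrite Normc.normcM normc_real gtr0_norm.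
Qed.

Lemma cball_sqnP n z p : normc p = 1 -> cin z p -> cin (cball_sqn n z) (p ^+ (2 ^ n)).
Proof.
elim: n z p => [|n ih] z p p1 hz; first by rewrite expr1.
rewrite expnS exprM expr2; apply: ih; first by rewrite Normc.normcM p1 mulr1.
exact: cball_umulP.
Qed.

Lemma shiftr_pow2 (c : Z) n : exists r, [/\ c = Z.add (Z.mul (Z.pow 2 (Z.of_nat n)) (Z.shiftr c (Z.of_nat n))) r,
  Z.leb 0 r & Z.ltb r (Z.pow 2 (Z.of_nat n))].
Proof.
rewrite Z.shiftr_div_pow2; last exact: Nat2Z.is_nonneg.
have h : Z.lt Z0 (Z.pow 2 (Z.of_nat n)) by apply: Z.pow_pos_nonneg => //; exact: Nat2Z.is_nonneg.
have hn : Z.pow 2 (Z.of_nat n) <> Z0 by move=> e; rewrite e in h.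
have [h1 h2] := Z.mod_pos_bound c _ h.
exists (Z.modulo c (Z.pow 2 (Z.of_nat n))); split; last 2 first.
- by apply/Z.leb_le.
- by apply/Z.ltb_lt.
exact: Z.div_mod.
Qed.

Lemma cexp_im_pow n t : cexp (Complex 0 (n%:R * t)) = cexp (Complex 0 t) ^+ n :> R[i].
Proof.
elim: n => [|n ih]; first by rewrite mul0r expr0 (_ : Complex 0 0 = 0) // cexp0.
by rewrite -natr1 mulrDl mul1r cexp_imD ih exprSr.
Qed.

Lemma exp_coefsE : exp_coefs = [seq exp_coef k | k <- iota 0 10].
Proof. by vm_compute. Qed.

Lemma cball_hornerP_exp (x : rball) t : rin x t -> `|t| <= 13 / 50 ->
  cin (cball_widen 120 (cball_horner exp_coefs x)) (cexp (Complex 0 t)).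
Proof.
move=> hx t1; rewrite exp_coefsE.
have hh := @cball_hornerP exp_coef (fun k => k`!%:R^-1) (iota 0 10) x t exp_coefP hx.
apply: (cball_widenP hh).
have -> : foldr (fun k a => (k`!%:R^-1)%:C%C + Complex 0 1 * (t%:C%C * a)) 0 (iota 0 10) =
  cis_taylor 10 1 t.
  transitivity (foldr (fun k a => (k`!%:R^-1)%:C%C + Complex 0 t * a) 0 (iota 0 10)).
    elim: (iota 0 10) => //= k s ->; congr (_ + _); rewrite mulrA; congr (_ * _).
    by apply: complex_ext; rewrite !ReImE /=; ring.
  rewrite (horner_sum (fun k => (k`!%:R^-1)%:C%C) (Complex 0 t)) /cis_taylor.
  by apply: eq_bigr => k _; rewrite add0n mul1r.
have h10 : `|t| ^+ 10 <= (13 / 50) ^+ 10.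
  by apply: lerXn2r; rewrite ?nnegrE ?normr_ge0 // divr_ge0 ?ler0n.
apply: (@le_trans _ _ (10`!%:R^-1 * (13 / 50) ^+ 10 * E)).
  rewrite ler_pM2r //; apply: le_trans (cis_taylor_abs 10 t) _.
  by rewrite ler_wpM2l // invr_ge0 ler0n.
rewrite -factZE; have f0 : 0 < ZR (factZ 10) by apply: ZR_gt0; vm_compute.
rewrite -mulrA ler_pdivrMl // expr_div_n mulrAC ler_pdivrMr ?exprn_gt0 //.
rewrite -[13]/(13%:R) -[50]/(50%:R) -(ZR_nat 13) -(ZR_nat 50) -!ZR_pow -!ZRM.
by apply: ZR_le; vm_compute.
Qed.

Lemma cball_cisP (x : rball) t : rin x t -> cin (cball_cis x) (cexp (Complex 0 t)).
Proof.
case: x => [c r] hx; have {}hx : `|t * E - ZR c| <= ZR r by exact: hx.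
rewrite /cball_cis; cbv zeta; set h := halvings _ _; set m := Z.shiftr _ _.
case: ifP => [/(@ZR_le R)|_]; last first.
  rewrite /cin [creal _]/= [cimag _]/= [cradius _]/= ZR0 subr0 Normc.normcM normc_cexp_im mul1r.
  rewrite normc_real gtr0_norm // ZRM ZR2; apply: ler_peMl; [exact: ltW | exact: ler1n].
rewrite ZR_abs => hm.
pose u := ZR c / E; pose v := u / 2%:R ^+ h.
have uE : u = (2 ^ h)%:R * v.
  by rewrite /v natrX mulrC divfK // gt_eqF // exprn_gt0.
have hu : `|v * E - ZR m| <= 1.
  have [s [cE /(@ZR_ge0 R) s0 /(@ZR_lt R) s1]] := shiftr_pow2 c h.
  move: cE s1; rewrite -/m => cE; rewrite ZR_pow ZR2 => s1.
  rewrite /v /u; clear hm v uE u; clearbody m h.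
  have p0 : (0 : R) < 2%:R ^+ h by rewrite exprn_gt0.
  have cR : ZR c = 2%:R ^+ h * ZR m + ZR s by rewrite {1}cE ZRD ZRM ZR_pow ZR2.
  have -> : ZR c / E / 2%:R ^+ h * E - ZR m = ZR s / 2%:R ^+ h.
    by rewrite cR; clearbody E; field; rewrite (gt_eqF E0) gt_eqF.
  rewrite ger0_norm; last by apply: divr_ge0 => //; exact: ltW.
  by rewrite ler_pdivrMr // mul1r ltW.
have v1 : `|v| <= 13 / 50.
  rewrite -(ler_pM2r E0) -{1}(gtr0_norm E0) -normrM.
  have -> : v * E = (v * E - ZR m) + ZR m by ring.
  apply: le_trans (ler_normD _ _) _; apply: le_trans (lerD hu hm) _.
  rewrite mulrAC ler_pdivlMr // -(ZR_nat 50) -(ZR_nat 13) -ZR1 -ZRD -!ZRM.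
  by apply: ZR_le; vm_compute.
apply: (@cball_widenP _ _ (cexp (Complex 0 u))); last first.
  apply: (@le_trans _ _ (`|t - u| * E)); first by rewrite ler_pM2r // cexp_im_lipschitz.
  rewrite -{1}(gtr0_norm E0) -normrM mulrBl /u divfK //.
  by rewrite gt_eqF.
rewrite uE cexp_im_pow; apply: cball_sqnP; first exact: normc_cexp_im.
by apply: cball_hornerP_exp => //; rewrite /rin ZR1.
Qed.

End ElementaryFunctions.

(** * Balls for the logarithm *)

Section ArtanhSeries.
Context {R : realType}.
Implicit Types (x z : R).

Lemma der_ln (f : R -> R) x a : 0 < f x -> is_derive x 1 f a ->
  is_derive x 1 (fun t => ln (f t)) ((f x)^-1 * a).
Proof. by move=> f0 h; exact: (is_derive1_comp (is_derive1_ln f0) h). Qed.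

Definition artanh_sum m x : R := \sum_(k < m) k.*2.+1%:R^-1 * (x * x) ^+ k.

Lemma der_artanh_sum m x :
  is_derive x 1 (fun x => x * artanh_sum m x) (\sum_(k < m) (x * x) ^+ k).
Proof.
have E n : (fun x => x * artanh_sum n x) = (fun x => \sum_(k < n) k.*2.+1%:R^-1 * x ^+ k.*2.+1).
  apply/funext => y; rewrite /artanh_sum mulr_sumr; apply: eq_bigr => k _.
  by rewrite mulrCA -expr2 -exprM mul2n -exprS.
rewrite E; elim: m => [|m ih].
  rewrite big_ord0 (_ : (fun x => _) = fun=> 0); first exact: der_cst.
  by apply/funext => y; rewrite big_ord0.
rewrite (_ : (fun x => _) = fun x => \sum_(k < m) k.*2.+1%:R^-1 * x ^+ k.*2.+1
    + m.*2.+1%:R^-1 * x ^+ m.*2.+1); last first.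
  by apply/funext => y; rewrite big_ord_recr.
rewrite big_ord_recr /=.
apply: der_add => //.
apply: (der_eq (der_scale _ (der_pow m.*2 (der_id x)))).
by rewrite mulr1 mulKf ?pnatr_eq0 // -expr2 -exprM mul2n.
Qed.

(** The derivative of the remainder is [2 / (1 - x ^ 2) * x ^ (2 * m)]. *)
Lemma ln_artanh m z : 0 <= z <= 2^-1 ->
  `|ln ((1 + z) / (1 - z)) - 2 * (z * artanh_sum m z)| <= 3 * z ^+ m.*2.+1.
Proof.
move=> /andP[z0 z1].
pose F (x : R) := ln (1 + x) - ln (1 - x) - 2 * (x * artanh_sum m x).
pose F' (x : R) := (1 + x)^-1 + (1 - x)^-1 - 2 * \sum_(k < m) (x * x) ^+ k.
have dF x : 0 <= x <= z -> is_derive x 1 F (F' x).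
  move=> /andP[x0 xz]; apply: der_sub; last exact: der_scale (der_artanh_sum m x).
  have p1 : 0 < 1 + x by lra.
  have p2 : 0 < 1 - x by lra.
  have e1 := der_ln (f := fun x => 1 + x) p1 (der_add (der_cst 1 x) (der_id x)).
  have e2 := der_ln (f := fun x => 1 - x) p2 (der_sub (der_cst 1 x) (der_id x)).
  by apply: (der_eq (der_sub e1 e2)); ring.
have F'E x : 0 <= x <= z -> F' x = 2 / (1 - x * x) * x ^+ m.*2.
  move=> /andP[x0 xz]; have g : 0 < 1 - x * x by nra.
  have gs : (1 - x * x) * \sum_(k < m) (x * x) ^+ k = 1 - (x * x) ^+ m.
    by rewrite -opprB mulNr -subrX1 opprB.
  have -> : x ^+ m.*2 = 1 - (1 - x * x) * \sum_(k < m) (x * x) ^+ k.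
    by rewrite gs opprB addrC subrK -expr2 -exprM mul2n.
  rewrite /F'; field; rewrite !gt_eqF //; lra.
have hb : `|F z| <= 3 / m.*2.+1%:R * z ^+ m.*2.+1.
  have := @Cderiv_pow_bound R (fun x => ((F x)%:C)%C) (fun x => ((F' x)%:C)%C) 3 m.*2 z z0.
  rewrite normc_real; apply.
  - by rewrite /F addr0 subr0 subrr mul0r mulr0 subrr.
  - by move=> x /dF h; apply: Cderiv_real.
  - move=> x xz; rewrite normc_real F'E //; have /andP[x0 xz'] := xz.
    have g : 3 / 4 <= 1 - x * x by nra.
    rewrite ger0_norm; last first.
      by apply: mulr_ge0; [apply: divr_ge0; lra | exact: exprn_ge0].
    apply: ler_wpM2r; first exact: exprn_ge0.
    by rewrite ler_pdivrMr; lra.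
have -> : ln ((1 + z) / (1 - z)) - 2 * (z * artanh_sum m z) = F z.
  by rewrite /F ln_div ?posrE //; lra.
apply: le_trans hb _; apply: ler_wpM2r; first exact: exprn_ge0.
rewrite ler_pdivrMr ?ltr0n // ler_peMr // ler1n //.
Qed.

End ArtanhSeries.

Section Logarithm.
Context {R : realType}.
Implicit Types (u v t : R).
Local Notation ZR := (@ZR R).

Lemma artanh_coefP k : rin (artanh_coef k) (k.*2.+1%:R^-1 : R).
Proof. by rewrite -ZR_nat; apply: rball_invZP; apply/Z.ltb_lt; lia. Qed.

(** The last condition on [a / b] says that the truncation error is below one
    unit. *)
Lemma rball_logP m cs (a b : Z) z u : cs = [seq artanh_coef k | k <- iota 0 m] ->
  Z.ltb 0 b -> Z.leb (Z.mul 2 a) b ->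
  Z.leb (Z.mul (Z.mul 3 unit48) (Z.pow a (Z.of_nat m.*2.+1))) (Z.pow b (Z.of_nat m.*2.+1)) ->
  rin z u -> 0 <= u <= ZR a / ZR b ->
  rin (rball_log cs z) (ln ((1 + u) / (1 - u))).
Proof.
move=> -> /(@ZR_gt0 R) b0 /(@ZR_le R); rewrite ZRM ZR2 => ab /(@ZR_le R).
rewrite !ZRM !ZR_pow => hm hz /andP[u0 u1].
have hb := rball_mulP hz (rball_hornerP (iota 0 m) artanh_coefP (rball_mulP hz hz)).
move: hb; rewrite (horner_sum (fun k => k.*2.+1%:R^-1)) /rball_log.
have -> : \sum_(k < m) (0 + k)%N.*2.+1%:R^-1 * (u * u) ^+ k = artanh_sum m u.
  by apply: eq_bigr => k _; rewrite add0n.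
case: (rball_mul _ _) => c r; rewrite /rin !ZRD !ZRM ZR2 ZR1 => h.
have {}h : `|u * artanh_sum m u * ZR unit48 - ZR c| <= ZR r by exact: h.
have E0 : 0 < ZR unit48 by exact: ZR_gt0.
have uh : 0 <= u <= 2^-1.
  rewrite u0; apply: le_trans u1 _.
  by rewrite ler_pdivrMr // ler_pdivlMl.
have ha := ln_artanh m uh.
set l := ln _ in ha *; set s := u * artanh_sum m u in h ha *.
have -> : l * ZR unit48 - 2 * ZR c = 2 * (s * ZR unit48 - ZR c) + (l - 2 * s) * ZR unit48.
  by clearbody l s; clear; ring.
apply: le_trans (ler_normD _ _) _; apply: lerD.
  by rewrite normrM ger0_norm ?ler0n // ler_wpM2l ?ler0n.
rewrite normrM (gtr0_norm E0).
apply: (@le_trans _ _ (3 * (ZR a / ZR b) ^+ m.*2.+1 * ZR unit48)).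
  rewrite ler_pM2r //; apply: le_trans ha _; rewrite ler_wpM2l ?ler0n //.
  by apply: lerXn2r; rewrite ?nnegrE //; exact: le_trans u1.
rewrite expr_div_n mulrA mulrAC ler_pdivrMr ?exprn_gt0 // mul1r.
have -> : (3 : R) = ZR 3 by rewrite -(ZR_nat 3).
by rewrite mulrAC.
Qed.

End Logarithm.

(** * Balls for the approximation of zeta and its derivatives *)

(** State at [x = n + alpha]: the logarithm of [x], the wave [x ^ (- i t)], and the
    sums over smaller arguments of the wave divided by [x], of the same times
    [ln x], and of the wave divided by [x ^ 2]. *)
Record zeta_state := ZetaState {
  st_log : rball; st_wave : cball; st_sum0 : cball; st_sum1 : cball; st_sum2 : cball }.

(** The argument [1 / (2 n + 2 alpha + 1)] decreases, and with it the number of terms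
    that keeps the truncation error below one unit. *)
Definition log_coefs (n : Z) : seq rball :=
  if Z.leb 100 n then artanh_coefs3
  else if Z.leb 16 n then artanh_coefs5
  else if Z.leb 2 n then artanh_coefs10 else artanh_coefs20.

(** The logarithm and the wave are updated from those of [(x + 1) / x], so that no
    logarithm or phase of a large argument is computed from scratch. *)
Definition zeta_step (alpha t : rball) (n : Z) (st : zeta_state) : zeta_state :=
  let 'ZetaState L w S0 S1 S2 := st in
  let x := rball_add alpha (rball_Z n) in
  let i := rball_inv x in
  let d := rball_log (log_coefs n)
    (rball_inv (rball_add (rball_mulZ 2 x) (rball_Z 1))) in
  ZetaState (rball_add L d) (cball_umul w (cball_cis (rball_opp (rball_mul t d))))
    (cball_add S0 (cball_scale i w))
    (cball_add S1 (cball_scale (rball_mul L i) w))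
    (cball_add S2 (cball_scale (rball_mul i i) w)).

Fixpoint zeta_loop (m : nat) (alpha t : rball) (n : Z) (st : zeta_state) :=
  if m is m'.+1 then zeta_loop m' alpha t (Z.add n 1) (zeta_step alpha t n st) else st.

Definition zeta_init (alpha t : rball) : zeta_state :=
  let z := rball_mul (rball_add (rball_Z 1) (rball_opp alpha))
                     (rball_inv (rball_add (rball_Z 1) alpha)) in
  let L := rball_opp (rball_log artanh_coefs10 z) in
  ZetaState L (cball_cis (rball_opp (rball_mul t L))) cball0 cball0 cball0.

(** Value, derivative in [t] and derivative in [alpha] of [hz_approx] at [1 + i t].
    The boundary term lies at [y - 1 / 2], half a step back from the end of the
    loop; [140737488355328] is 1/2 in units of [2 ^ -48]. *)
Definition zeta_eval (N : nat) (alpha t : rball) : cball * cball * cball :=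
  let 'ZetaState L0 w0 S0 S1 S2 := zeta_loop N alpha t 0 (zeta_init alpha t) in
  let y := rball_add alpha (rball_Z (Z.of_nat N)) in
  let d := rball_log artanh_coefs3
    (rball_inv (rball_add (rball_mulZ 4 y) (rball_Z (Zneg 1)))) in
  let L := rball_add L0 (rball_opp d) in
  let w := cball_umul w0 (cball_cis (rball_mul t d)) in
  let x := rball_add y (RBall (Zneg 140737488355328) 0) in
  let i := rball_inv x in
  let a := rball_inv t in
  let b := rball_mul (rball_mul i i) (rball_invZ 24) in
  let ac := rball_add a (rball_mul t b) in
  let bi := rball_mul b i in
  (cball_add S0 (cball_opp (cball_add (cball_scale b w) (cball_muli (cball_scale ac w)))),
   cball_add (cball_muli (cball_add (cball_opp S1)
       (cball_scale (rball_add (rball_mul L b)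
            (rball_add (rball_mul a a) (rball_opp b))) w)))
     (cball_opp (cball_scale (rball_mul L ac) w)),
   cball_add (cball_opp (cball_add S2 (cball_muli (cball_scale t S2))))
     (cball_add
       (cball_scale (rball_add (rball_mul (rball_add (rball_Z 2) (rball_opp (rball_mul t t))) bi)
                               (rball_opp i)) w)
       (cball_muli (cball_scale (rball_mulZ 3 (rball_mul t bi)) w)))).

Section Evaluation.
Context {R : realType}.
Implicit Types (u v t y : R) (A T : rball).
Local Notation ZR := (@ZR R).

Definition wave t y : R[i] := cexp (Complex 0 (- (t * ln y))).

Lemma normc_wave t y : normc (wave t y) = 1.
Proof. exact: normc_cexp_im. Qed.

Lemma cpow_line y t : 0 < y -> cpow y (Complex 1 t) = (y^-1)%:C%C * wave t y.
Proof.
move=> y0; rewrite (_ : Complex 1 t = Complex 0 t + 1); last by apply: complex_ext; rewrite /= ?addr0 ?add0r.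
rewrite cpowS // cpowE; congr (_ * cexp _).
by apply: complex_ext; rewrite !ReImE /=; ring.
Qed.

Lemma waveM t y z : 0 < y -> 0 < z -> wave t (y * z) = wave t y * wave t z.
Proof.
by move=> y0 z0; rewrite /wave lnM ?posrE // mulrDr opprD cexp_imD.
Qed.

Definition wave_sum (c : R -> R) alpha t n : R[i] :=
  \sum_(0 <= k < n) (c (k%:R + alpha))%:C%C * wave t (k%:R + alpha).

Definition state_ok alpha t n (st : zeta_state) : Prop :=
  [/\ rin (st_log st) (ln (n%:R + alpha)), cin (st_wave st) (wave t (n%:R + alpha)),
    cin (st_sum0 st) (wave_sum (fun y => y^-1) alpha t n),
    cin (st_sum1 st) (wave_sum (fun y => ln y * y^-1) alpha t n) &
    cin (st_sum2 st) (wave_sum (fun y => y^-1 * y^-1) alpha t n)].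

Lemma log_coefsP n z u : rin z u -> 0 <= u -> (2 * n%:R + 14 / 5) * u <= 1 ->
  rin (rball_log (log_coefs (Z.of_nat n)) z) (ln ((1 + u) / (1 - u))).
Proof.
move=> hz u0 hu; have n0 : (0 : R) <= n%:R by exact: ler0n.
have bound k (a b : Z) : Z.leb (Z.of_nat k) (Z.of_nat n) -> Z.ltb 0 a ->
    Z.ltb 0 b ->
    Z.leb (Z.mul 5 b) (Z.mul a (Z.add (Z.mul 10 (Z.of_nat k)) 14)) -> u <= ZR a / ZR b.
  move=> /(@ZR_le R); rewrite !ZR_nat => kn /(@ZR_gt0 R) a0 /(@ZR_gt0 R) b0 /(@ZR_le R).
  rewrite !ZRM ZRD ZRM ZR_nat => h.
  have e5 : ZR 5 = 5 by exact: (ZR_nat 5).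
  have e10 : ZR 10 = 10 by exact: (ZR_nat 10).
  have e14 : ZR 14 = 14 by exact: (ZR_nat 14).
  rewrite e5 e10 e14 in h; rewrite ler_pdivlMr //.
  have h2 : u * (5 * ZR b) <= u * (ZR a * (10 * k%:R + 14)) by rewrite ler_wpM2l.
  have h3 : u * (2 * k%:R + 14 / 5) <= 1.
    apply: le_trans hu; rewrite [leRHS]mulrC ler_wpM2l //; lra.
  have h4 : ZR a * (u * (2 * k%:R + 14 / 5)) <= ZR a * 1 by rewrite ler_wpM2l // ltW.
  clear -h2 h4; move: h2 h4; set A := ZR a; set B := ZR b; set K := k%:R; clearbody A B K.
  by move=> h2 h4; nra.
rewrite /log_coefs; case: ifP => [h100|_].
  by apply: (@rball_logP _ 3 _ 1 202) => //; rewrite u0; apply: (bound 100%N).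
case: ifP => [h16|_].
  by apply: (@rball_logP _ 5 _ 1 34) => //; rewrite u0; apply: (bound 16%N).
case: ifP => [h2|_].
  by apply: (@rball_logP _ 10 _ 1 6) => //; rewrite u0; apply: (bound 2%N).
apply: (@rball_logP _ 20 _ 2 5) => //; rewrite u0; apply: (bound 0%N) => //.
by apply/Z.leb_le; exact: Nat2Z.is_nonneg.
Qed.

Lemma zeta_step_ok A T alpha t n st : 9 / 10 <= alpha -> rin A alpha -> rin T t ->
  state_ok alpha t n st -> state_ok alpha t n.+1 (zeta_step A T (Z.of_nat n) st).
Proof.
move=> a9 hA hT; case: st => L w S0 S1 S2 [/= hL hw h0 h1 h2].
have n0 : (0 : R) <= n%:R by exact: ler0n.
set y := n%:R + alpha.
have yE : n.+1%:R + alpha = y + 1 by rewrite -natr1 /y; ring.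
have y9 : 9 / 10 <= y by rewrite /y; lra.
have y0 : 0 < y by lra.
have hx : rin (rball_add A (rball_Z (Z.of_nat n))) y.
  by rewrite /y addrC -ZR_nat; apply: rball_addP => //; exact: rball_ZP.
have hi : rin (rball_inv (rball_add A (rball_Z (Z.of_nat n)))) y^-1.
  by apply: rball_invP => //; lra.
have hz : rin (rball_inv (rball_add (rball_mulZ 2 (rball_add A (rball_Z (Z.of_nat n)))) (rball_Z 1)))
   (2 * y + 1)^-1.
  apply: rball_invP; first by lra.
  by rewrite -ZR2 -ZR1; apply: rball_addP; [exact: rball_mulZP | exact: rball_ZP].
set u := (2 * y + 1)^-1 in hz.
have p1 : 0 < 2 * y + 1 by lra.
have u0 : 0 <= u by rewrite invr_ge0 ltW.
have hd : rin (rball_log (log_coefs (Z.of_nat n)) (rball_inv (rball_add (rball_mulZ 2 (rball_add A (rball_Z (Z.of_nat n)))) (rball_Z 1)))) (ln ((y + 1) / y)).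
  have -> : (y + 1) / y = (1 + u) / (1 - u).
    by rewrite /u; field; rewrite !gt_eqF //; lra.
  apply: log_coefsP => //; rewrite ler_pdivrMr // mul1r /y; lra.
have q0 : 0 < (y + 1) / y by rewrite divr_gt0 //; lra.
have yS : y + 1 = y * ((y + 1) / y) by rewrite mulrC divfK // gt_eqF.
have wok : cin w (wave t y) := hw.
split => /=.
- rewrite yE yS lnM ?posrE //; exact: rball_addP.
- rewrite yE yS waveM //; apply: cball_umulP; rewrite ?normc_wave //.
  by apply: cball_cisP; apply: rball_oppP; exact: rball_mulP.
- by rewrite /wave_sum big_nat_recr //=; apply: cball_addP => //; exact: cball_scaleP.
- rewrite /wave_sum big_nat_recr //=; apply: cball_addP => //; apply: cball_scaleP => //.
  exact: rball_mulP.
- rewrite /wave_sum big_nat_recr //=; apply: cball_addP => //; apply: cball_scaleP => //.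
  exact: rball_mulP.
Qed.

Lemma zeta_loop_ok A T alpha t m n st : 9 / 10 <= alpha -> rin A alpha -> rin T t ->
  state_ok alpha t n st -> state_ok alpha t (n + m) (zeta_loop m A T (Z.of_nat n) st).
Proof.
move=> a9 hA hT; elim: m n st => [|m ih] n st hst /=; first by rewrite addn0.
have -> : Z.add (Z.of_nat n) 1 = Z.of_nat n.+1 by rewrite Nat2Z.inj_succ -Z.add_1_r.
by rewrite addnS -addSn; apply: ih; exact: zeta_step_ok.
Qed.

Lemma zeta_init_ok A T alpha t : 9 / 10 <= alpha <= 1 -> rin A alpha -> rin T t ->
  state_ok alpha t 0 (zeta_init A T).
Proof.
move=> /andP[a9 a1] hA hT; have a0 : 0 < alpha by lra.
rewrite /zeta_init /state_ok /wave_sum !big_geq // add0r; cbv zeta.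
set z := rball_mul _ _.
have hL : rin (rball_opp (rball_log artanh_coefs10 z)) (ln alpha).
  set u := (1 - alpha) / (1 + alpha).
  have -> : ln alpha = - ln ((1 + u) / (1 - u)).
    have -> : (1 + u) / (1 - u) = alpha^-1.
      by rewrite /u; field; rewrite !gt_eqF //; lra.
    by rewrite lnV ?posrE // opprK.
  apply: rball_oppP; apply: (@rball_logP _ 10 _ 1 6) => //.
    rewrite /u -ZR1; apply: rball_mulP.
      by apply: rball_addP; [exact: rball_ZP | exact: rball_oppP].
    apply: rball_invP; first by rewrite ZR1; lra.
    by apply: rball_addP => //; exact: rball_ZP.
  have -> : ZR 6 = 6 by exact: (ZR_nat 6).
  rewrite ZR1 /u; apply/andP; split; first by apply: divr_ge0; lra.
  by rewrite ler_pdivrMr; lra.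
split => //=; try exact: cball0P.
by apply: cball_cisP; apply: rball_oppP; exact: rball_mulP.
Qed.

(** The two partial derivatives of [hz_approx] on the line, written with the
    sums that the loop accumulates. *)
Definition hz_approx_dt N alpha t : R[i] :=
  let x := N%:R + alpha - 2^-1 in
  let b := x^-1 * x^-1 * 24^-1 in
  Complex 0 1 * (- wave_sum (fun y => ln y * y^-1) alpha t N
    + (ln x * b + (t^-1 * t^-1 - b))%:C%C * wave t x)
  - (ln x * (t^-1 + t * b))%:C%C * wave t x.

Definition hz_approx_dalpha N alpha t : R[i] :=
  let x := N%:R + alpha - 2^-1 in
  let b := x^-1 * x^-1 * 24^-1 in
  let S2 := wave_sum (fun y => y^-1 * y^-1) alpha t N in
  - (S2 + Complex 0 1 * (t%:C%C * S2))
  + (((2 - t * t) * (b * x^-1) - x^-1)%:C%C * wave t x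
     + Complex 0 1 * ((3 * (t * (b * x^-1)))%:C%C * wave t x)).

Lemma cpow_line_sub1 y t : cpow y (Complex 1 t - 1) = wave t y.
Proof.
by rewrite cpowE; congr cexp; apply: complex_ext; rewrite !ReImE /=; ring.
Qed.

Lemma cpow_line_add1 y t : 0 < y -> cpow y (Complex 1 t + 1) = (y^-1 * y^-1)%:C%C * wave t y.
Proof. by move=> y0; rewrite cpowS // cpow_line // rmorphM mulrA. Qed.

Lemma Complex1_sub1 t : Complex 1 t - 1 = Complex 0 t :> R[i].
Proof. by apply: complex_ext; rewrite !ReImE /= ?subrr ?subr0. Qed.

Lemma Complex1E t : Complex 1 t = 1 + Complex 0 1 * t%:C%C :> R[i].
Proof. by apply: complex_ext; rewrite !ReImE /=; ring. Qed.

Lemma imag_unit_sqr : Complex 0 1 * Complex 0 1 + 1 = 0 :> R[i].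
Proof. by apply: complex_ext; rewrite !ReImE /=; ring. Qed.

Lemma inv_Complex0 t : t != 0 -> (Complex 0 t)^-1 = - (Complex 0 1 * (t^-1)%:C%C) :> R[i].
Proof.
move=> t0; have c0 : Complex 0 t != 0 by apply: contra_neq t0 => -[].
apply: (mulfI c0); rewrite mulfV //.
by apply: complex_ext; rewrite !ReImE /=; field.
Qed.

Lemma hz_approx_line N alpha t : 0 < alpha -> (0 < N)%N -> t != 0 ->
  hz_approx N alpha (Complex 1 t) =
  let x := N%:R + alpha - 2^-1 in let b := x^-1 * x^-1 * 24^-1 in
  wave_sum (fun y => y^-1) alpha t N
  - (b%:C%C * wave t x + Complex 0 1 * ((t^-1 + t * b)%:C%C * wave t x)).
Proof.
move=> a0 N0 t0; rewrite /hz_approx /hz_boundary /wave_sum; cbv zeta.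
have N1 : (1 : R) <= N%:R by rewrite ler1n.
have x0 : 0 < N%:R + alpha - 2^-1 by lra.
congr (_ + _).
  by apply: eq_bigr => k _; rewrite cpow_line // ltr_wpDl.
set x := N%:R + alpha - 2^-1 in x0 *.
rewrite cpow_line_sub1 cpow_line_add1 // Complex1_sub1 inv_Complex0 //.
case: (wave t x) => w1 w2; move: x^-1 t^-1 => i j.
by apply: complex_ext; rewrite !ReImE /=; ring.
Qed.

Lemma Cderiv_hz_approx_t N alpha t : 0 < alpha -> (0 < N)%N -> t != 0 ->
  Cderiv (fun t => hz_approx N alpha (Complex 1 t)) t (hz_approx_dt N alpha t).
Proof.
move=> a0 N0 t0.
have s1 : Complex 1 t != 1 :> R[i] by apply: contra_neq t0 => -[].
apply: (Cderiv_eq (Cderiv_hz_approx_exponent N alpha s1 (Cderiv_Complex_im 1 t))).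
rewrite /hz_approx_dt /wave_sum; cbv zeta.
have N1 : (1 : R) <= N%:R by rewrite ler1n.
have x0 : 0 < N%:R + alpha - 2^-1 by lra.
have -> : \sum_(0 <= n < N) - ((ln (n%:R + alpha))%:C%C * Complex 0 1) * cpow (n%:R + alpha) (Complex 1 t)
  = - (Complex 0 1 * \sum_(0 <= k < N) (ln (k%:R + alpha) * (k%:R + alpha)^-1)%:C%C * wave t (k%:R + alpha)).
  rewrite mulr_sumr -sumrN; apply: eq_bigr => k _; rewrite cpow_line ?ltr_wpDl // rmorphM; ring.
set S := \sum_(_ <= _ < _) _; set x := N%:R + alpha - 2^-1 in x0 *.
rewrite /hz_boundary cpow_line_sub1 cpow_line_add1 // Complex1_sub1 inv_Complex0 //.
rewrite Complex1E; move: imag_unit_sqr S (wave t x).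
move: (Complex 0 1) (ln x) x^-1 t^-1 (24^-1 : R) => I l i j c I2 S w.
apply/eqP; rewrite -subr_eq0; apply/eqP.
transitivity ((I * I + 1) *
  (l%:C%C * j%:C%C + l%:C%C * t%:C%C * (i * i * c)%:C%C - I * j%:C%C * j%:C%C) * w); first by ring.
by rewrite I2 !mul0r.
Qed.

Lemma Cderiv_hz_approx_alpha N alpha t : 0 < alpha -> (0 < N)%N -> t != 0 ->
  Cderiv (fun a => hz_approx N a (Complex 1 t)) alpha (hz_approx_dalpha N alpha t).
Proof.
move=> a0 N0 t0.
have s1 : Complex 1 t != 1 :> R[i] by apply: contra_neq t0 => -[].
have N1 : (1 : R) <= N%:R by rewrite ler1n.
have x0 : 0 < N%:R + alpha - 2^-1 by lra.
have shift c s : 0 < alpha + c -> Cderiv (fun a => cpow (a + c) s) alpha (- s * cpow (alpha + c) (s + 1)).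
  move=> c0; have h := Cderiv_comp (g := fun a => a + c) (Cderiv_cpow s c0)
    (der_add (der_id alpha) (der_cst c alpha)).
  by apply: (Cderiv_eq h); rewrite addr0 mul1r.
have shiftS n : Cderiv (fun a => cpow (n%:R + a) (Complex 1 t)) alpha
    (- Complex 1 t * cpow (n%:R + alpha) (Complex 1 t + 1)).
  rewrite (_ : (fun a => _) = fun a => cpow (a + n%:R) (Complex 1 t)); last first.
    by apply/funext => a; rewrite addrC.
  by rewrite [n%:R + alpha]addrC; apply: shift; rewrite ltr_wpDr.
have xE a : N%:R + a - 2^-1 = a + (N%:R - 2^-1) :> R by ring.
have bd : Cderiv (fun a => hz_boundary (Complex 1 t) (N%:R + a - 2^-1)) alpha
  ((Complex 1 t - 1)^-1 * (- (Complex 1 t - 1) * cpow (N%:R + alpha - 2^-1) (Complex 1 t - 1 + 1))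
   - 24^-1%:C%C * (Complex 1 t * (- (Complex 1 t + 1) * cpow (N%:R + alpha - 2^-1) (Complex 1 t + 1 + 1)))).
  rewrite (_ : (fun a => _) = fun a => hz_boundary (Complex 1 t) (a + (N%:R - 2^-1))); last first.
    by apply/funext => a; rewrite xE.
  rewrite xE; apply: CderivB; apply: CderivMl; first by apply: shift; rewrite -xE.
  by apply: CderivMl; apply: shift; rewrite -xE.
apply: (Cderiv_eq (CderivD (Cderiv_sum _ shiftS) bd)).
rewrite /hz_approx_dalpha /wave_sum; cbv zeta.
have -> : \sum_(n <- index_iota 0 N) - Complex 1 t * cpow (n%:R + alpha) (Complex 1 t + 1)
  = - (Complex 1 t * \sum_(0 <= k < N) ((k%:R + alpha)^-1 * (k%:R + alpha)^-1)%:C%C * wave t (k%:R + alpha)).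
  rewrite mulr_sumr -sumrN; apply: eq_bigr => k _.
  by rewrite cpow_line_add1 ?ltr_wpDl // mulNr.
set S := \sum_(_ <= _ < _) _; set x := N%:R + alpha - 2^-1 in x0 *.
rewrite subrK cpowS // !cpow_line_add1 // cpow_line // Complex1_sub1.
have inv : (Complex 0 t)^-1 * - Complex 0 t = -1 :> R[i].
  by rewrite mulrN mulVf //; apply: contra_neq t0 => -[].
rewrite [(Complex 0 t)^-1 * (_ * _)]mulrA inv.
rewrite Complex1E; move: imag_unit_sqr S (wave t x).
move: (Complex 0 1) x^-1 (24^-1 : R) => I i c I2 S w.
apply/eqP; rewrite -subr_eq0; apply/eqP.
transitivity ((I * I + 1) * (c * i * i * i * t * t)%:C%C * w); first by ring.
by rewrite I2 !mul0r.
Qed.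

Definition zeta_eval_ok N alpha t (v : cball * cball * cball) : Prop :=
  [/\ cin v.1.1 (hz_approx N alpha (Complex 1 t)),
      cin v.1.2 (hz_approx_dt N alpha t) & cin v.2 (hz_approx_dalpha N alpha t)].

Lemma zeta_evalP N A T alpha t : 9 / 10 <= alpha <= 1 -> 1 <= t -> (100 <= N)%N ->
  rin A alpha -> rin T t -> zeta_eval_ok N alpha t (zeta_eval N A T).
Proof.
move=> a91 t1 N100 hA hT; have /andP[a9 a1] := a91.
have a0 : 0 < alpha by lra.
have t0 : t != 0 by rewrite gt_eqF //; lra.
have NR : (100 : R) <= N%:R by rewrite ler_nat.
have := zeta_loop_ok N a9 hA hT (zeta_init_ok a91 hA hT).
rewrite add0n /zeta_eval; case: zeta_loop => L0 w0 S0 S1 S2 [].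
rewrite [st_log _]/= [st_wave _]/= [st_sum0 _]/= [st_sum1 _]/= [st_sum2 _]/= => hL0 hw0 h0 h1 h2.
cbv zeta.
have hy : rin (rball_add A (rball_Z (Z.of_nat N))) (N%:R + alpha).
  by rewrite addrC -ZR_nat; apply: rball_addP => //; exact: rball_ZP.
set Y := rball_add A _ in hy *; set y := N%:R + alpha in hL0 hw0 hy *.
have y100 : 100 <= y by rewrite /y; lra.
have hd : rin (rball_log artanh_coefs3 (rball_inv (rball_add (rball_mulZ 4 Y) (rball_Z (Zneg 1)))))
   (ln (y / (y - 2^-1))).
  set u := (4 * y - 1)^-1.
  have -> : y / (y - 2^-1) = (1 + u) / (1 - u).
    by rewrite /u; field; rewrite !gt_eqF //; lra.
  have e202 : ZR 202 = 202 by exact: (ZR_nat 202).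
  apply: (@rball_logP _ 3 _ 1 202) => //.
    apply: rball_invP; first by lra.
    have -> : 4 * y - 1 = ZR 4 * y + ZR (Zneg 1).
      by rewrite -(ZR_nat 4) (_ : Zneg 1 = Z.opp 1) // ZRN ZR1.
    by apply: rball_addP; [exact: rball_mulZP | exact: rball_ZP].
  rewrite ZR1 e202 mul1r invr_ge0; apply/andP; split; first by lra.
  by rewrite lef_pV2 ?posrE; lra.
set D := rball_log _ _ in hd *; set d := ln _ in hd.
have x0 : 0 < y - 2^-1 by lra.
have y0 : 0 < y by lra.
have hL : rin (rball_add L0 (rball_opp D)) (ln (y - 2^-1)).
  have -> : ln (y - 2^-1) = ln y + - d by rewrite /d ln_div ?posrE //; ring.
  by apply: rball_addP => //; exact: rball_oppP.
have hw : cin (cball_umul w0 (cball_cis (rball_mul T D))) (wave t (y - 2^-1)).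
  have -> : wave t (y - 2^-1) = wave t y * cexp (Complex 0 (t * d)).
    by rewrite /wave -cexp_imD /d ln_div ?posrE //; congr (cexp (Complex 0 _)); ring.
  apply: cball_umulP => //; [exact: normc_wave | | exact: normc_cexp_im].
  by apply: cball_cisP; exact: rball_mulP.
have hx : rin (rball_add Y (RBall (Zneg 140737488355328) 0)) (y - 2^-1).
  apply: rball_addP => //; rewrite /rin /rcenter /rradius ZR0.
  have -> : unit48 = Z.mul 2 140737488355328 by [].
  rewrite (_ : Zneg _ = Z.opp 140737488355328) // ZRM ZRN ZR2 mulNr mulKf ?subrr ?normr0 //.
set X := rball_add Y _ in hx *.
have hi : rin (rball_inv X) (y - 2^-1)^-1 by apply: rball_invP => //; lra.
set L := rball_add L0 _ in hL *; set w := cball_umul w0 _ in hw *; set i := rball_inv X in hi *.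
set x := y - 2^-1 in x0 hL hw hx hi *.
have ha : rin (rball_inv T) t^-1 by apply: rball_invP => //; lra.
have hb : rin (rball_mul (rball_mul i i) (rball_invZ 24)) (x^-1 * x^-1 * 24^-1).
  apply: rball_mulP; first exact: rball_mulP.
  have -> : (24 : R) = ZR 24 by rewrite -(ZR_nat 24).
   exact: rball_invZP.
set b := rball_mul (rball_mul i i) _ in hb *; set a := rball_inv T in ha *.
have hac : rin (rball_add a (rball_mul T b)) (t^-1 + t * (x^-1 * x^-1 * 24^-1)).
  by apply: rball_addP => //; exact: rball_mulP.
split.
- rewrite hz_approx_line //; last by exact: leq_trans N100.
  cbv zeta; rewrite -/y -/x.
  apply: cball_addP => //; apply: cball_oppP; apply: cball_addP; first exact: cball_scaleP.
  by apply: cball_muliP; exact: cball_scaleP.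
- rewrite /hz_approx_dt; cbv zeta; rewrite -/y -/x.
  apply: cball_addP; last first.
    by apply: cball_oppP; apply: cball_scaleP => //; exact: rball_mulP.
  apply: cball_muliP; apply: cball_addP; first exact: cball_oppP.
  apply: cball_scaleP => //; apply: rball_addP; first exact: rball_mulP.
  by apply: rball_addP; [exact: rball_mulP | exact: rball_oppP].
- rewrite /hz_approx_dalpha; cbv zeta; rewrite -/y -/x.
  have hbi := rball_mulP hb hi.
  apply: cball_addP.
    apply: cball_oppP; apply: cball_addP => //; apply: cball_muliP; exact: cball_scaleP.
  apply: cball_addP.
    apply: cball_scaleP => //; apply: rball_addP; last exact: rball_oppP.
    apply: rball_mulP => //; apply: rball_addP; first by rewrite -ZR2; exact: rball_ZP.
    by apply: rball_oppP; exact: rball_mulP.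
  apply: cball_muliP; apply: cball_scaleP => //.
  have -> : (3 : R) = ZR 3 by rewrite -(ZR_nat 3).
  by apply: rball_mulZP; exact: rball_mulP.
Qed.

End Evaluation.

(** * Zeros by a simplified Newton iteration *)

Section PlaneContraction.
Context {R : realType}.
Implicit Types (x : nat -> R) (q C : R).

Lemma geometric_cvg x C q : 0 <= q < 1 -> (forall n, `|x n.+1 - x n| <= C * q ^+ n) ->
  exists l, forall e, 0 < e -> exists N, forall n, (N <= n)%N -> `|x n - l| < e.
Proof.
move=> /andP[q0 q1] hx.
pose w n := x n.+1 - x n.
have cw : cvgn (series (fun n => `|w n|)).
  apply: (@series_le_cvg _ _ (geometric C q)).
  - by move=> n; exact: normr_ge0.
  - by move=> n /=; apply: le_trans (hx n).
  - by move=> n /=; exact: hx.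
  - by apply: is_cvg_geometric_series; rewrite ger0_norm.
have sw : series w = fun n => x n - x 0%N.
  by apply/funext => n; rewrite /series /= telescope_sumr.
have := normed_cvg cw; rewrite sw => /cvg_ex[l hl].
exists (l + x 0%N) => e e0.
move/cvgrPdist_lt: hl => /(_ e e0) [N _ hN]; exists N => n Nn.
have := hN n Nn; rewrite /= distrC.
by have -> : x n - x 0%N - l = x n - (l + x 0%N) by ring.
Qed.

(** Banach's theorem in the maximum norm of the plane. *)
Lemma plane_fixed_point (g1 g2 : R -> R -> R) (r q : R) : 0 <= r -> 0 <= q < 1 ->
  (forall u v, `|u| <= r -> `|v| <= r -> `|g1 u v| <= r /\ `|g2 u v| <= r) ->
  (forall u v u' v' d, `|u| <= r -> `|v| <= r -> `|u'| <= r -> `|v'| <= r ->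
     `|u - u'| <= d -> `|v - v'| <= d ->
     `|g1 u v - g1 u' v'| <= q * d /\ `|g2 u v - g2 u' v'| <= q * d) ->
  exists u v, [/\ `|u| <= r, `|v| <= r, g1 u v = u & g2 u v = v].
Proof.
move=> r0 q01 gbox glip; have /andP[q0 q1] := q01.
pose it n := iter n (fun z : R * R => (g1 z.1 z.2, g2 z.1 z.2)) (0, 0).
have box n : `|(it n).1| <= r /\ `|(it n).2| <= r.
  by elim: n => [|n [h1 h2]]; [rewrite /= normr0 | exact: gbox].
have step n : `|(it n.+1).1 - (it n).1| <= r * q ^+ n /\ `|(it n.+1).2 - (it n).2| <= r * q ^+ n.
  elim: n => [|n [h1 h2]].
    by have [h1 h2] := box 1%N; rewrite expr0 mulr1 /= !subr0; split.
  have [b1 b2] := box n; have [c1 c2] := box n.+1.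
  by have := glip _ _ _ _ _ c1 c2 b1 b2 h1 h2; rewrite mulrCA -exprS.
have [u hu] := geometric_cvg q01 (fun n => (step n).1).
have [v hv] := geometric_cvg q01 (fun n => (step n).2).
have lim_box l (z : nat -> R) : (forall n, `|z n| <= r) ->
    (forall e, 0 < e -> exists N, forall n, (N <= n)%N -> `|z n - l| < e) -> `|l| <= r.
  move=> zr hz; apply/ler_addgt0Pr => e /hz[N /(_ N (leqnn N))] h.
  have -> : l = z N - (z N - l) by ring.
  by apply: le_trans (ler_normB _ _) _; apply: lerD => //; exact: ltW.
have bu : `|u| <= r := lim_box u (fun n => (it n).1) (fun n => (box n).1) hu.
have bv : `|v| <= r := lim_box v (fun n => (it n).2) (fun n => (box n).2) hv.
have key e : 0 < e -> `|g1 u v - u| <= e /\ `|g2 u v - v| <= e.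
  move=> e0; have e2 : 0 < e / 2 by lra.
  have [N1 h1] := hu _ e2; have [N2 h2] := hv _ e2.
  pose n := maxn N1 N2.
  have [b1 b2] := box n.
  have d1 : `|u - (it n).1| <= e / 2 by rewrite distrC ltW // h1 // leq_maxl.
  have d2 : `|v - (it n).2| <= e / 2 by rewrite distrC ltW // h2 // leq_maxr.
  have [k1 k2] := glip _ _ _ _ _ bu bv b1 b2 d1 d2.
  have c1 : `|(it n.+1).1 - u| < e / 2 by apply: h1; rewrite (leq_trans (leq_maxl N1 N2)).
  have c2 : `|(it n.+1).2 - v| < e / 2 by apply: h2; rewrite (leq_trans (leq_maxr N1 N2)).
  have qe : q * (e / 2) <= e / 2 by rewrite ler_piMl // ltW.
  split.
    have -> : g1 u v - u = (g1 u v - (it n.+1).1) + ((it n.+1).1 - u) by ring.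
    by apply: le_trans (ler_normD _ _) _; rewrite [leRHS]splitr; apply: lerD; [exact: le_trans k1 qe | exact: ltW].
  have -> : g2 u v - v = (g2 u v - (it n.+1).2) + ((it n.+1).2 - v) by ring.
  by apply: le_trans (ler_normD _ _) _; rewrite [leRHS]splitr; apply: lerD; [exact: le_trans k2 qe | exact: ltW].
have zero (z : R) : (forall e, 0 < e -> `|z| <= e) -> z = 0.
  move=> h; apply/normr0_eq0/le_anti; rewrite normr_ge0 andbT.
  by apply/ler_addgt0Pr => e e0; rewrite add0r; exact: h.
exists u, v; split => //; apply/eqP; rewrite -subr_eq0; apply/eqP; apply: zero => e /key[] //.
Qed.

(** A map that stays close to an invertible linear map on a square, and whose
    value at the center is small, vanishes on the square: the simplified Newton
    iteration is a contraction. *)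
Lemma newton_zero (F : R -> R -> R[i]) (A B : R[i]) (r q m e0 e1 e2 : R) :
  let D := Re A * Im B - Im A * Re B in
  0 <= r -> 0 <= q < 1 -> D != 0 -> 0 <= e1 -> 0 <= e2 ->
  normc A <= m -> normc B <= m ->
  normc (F 0 0) <= e0 ->
  (forall u v u', `|u| <= r -> `|v| <= r -> `|u'| <= r ->
     normc (F u v - F u' v - (u - u')%:C%C * A) <= e1 * `|u - u'|) ->
  (forall u v v', `|u| <= r -> `|v| <= r -> `|v'| <= r ->
     normc (F u v - F u v' - (v - v')%:C%C * B) <= e2 * `|v - v'|) ->
  m * (e1 + e2) <= q * `|D| -> m * e0 <= (1 - q) * r * `|D| ->
  exists u v, [/\ `|u| <= r, `|v| <= r & F u v = 0].
Proof.
move=> D r0 q01 D0 e10 e20 Am Bm F0 FA FB hq hr.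
have /andP[q0 q1] := q01.
have Dp : 0 < `|D| by rewrite normr_gt0.
have m0 : 0 <= m by exact: le_trans (normc_ge0 _) Am.
(* The coordinates of [z] in the basis [A, B] of the plane. *)
pose p z := (Re z * Im B - Im z * Re B) / D.
pose s z := (Im z * Re A - Re z * Im A) / D.
have bound z w : normc w <= m -> `|Re z * Im w - Im z * Re w| <= m * normc z.
  move=> wm; apply: (@le_trans _ _ (normc z * normc w)); last by rewrite mulrC ler_wpM2r // normc_ge0.
  rewrite ler_norml; apply/andP; split.
    have := dot_le_normc (Complex (- Re z) (Im z)) (Complex (Im w) (Re w)).
    have -> : normc (Complex (- Re z) (Im z)) = normc z by case: (z) => a b /=; rewrite sqrrN.
    have -> : normc (Complex (Im w) (Re w)) = normc w by case: (w) => a b /=; rewrite addrC.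
    by move=> /= h; lra.
  have := dot_le_normc (Complex (Re z) (- Im z)) (Complex (Im w) (Re w)).
  have -> : normc (Complex (Re z) (- Im z)) = normc z by case: (z) => a b /=; rewrite sqrrN.
  have -> : normc (Complex (Im w) (Re w)) = normc w by case: (w) => a b /=; rewrite addrC.
  by move=> /= h; lra.
have pb z e : normc z <= e -> `|p z| <= m * e / `|D|.
  move=> ze; rewrite /p normrM normfV ler_wpM2r ?invr_ge0 ?normr_ge0 //.
  by apply: le_trans (bound z B Bm) _; rewrite ler_wpM2l.
have sb z e : normc z <= e -> `|s z| <= m * e / `|D|.
  move=> ze; rewrite /s normrM normfV ler_wpM2r ?invr_ge0 ?normr_ge0 //.
  have -> : Im z * Re A - Re z * Im A = - (Re z * Im A - Im z * Re A) by ring.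
  by rewrite normrN; apply: le_trans (bound z A Am) _; rewrite ler_wpM2l.
have rem u v u' v' d : `|u| <= r -> `|v| <= r -> `|u'| <= r -> `|v'| <= r ->
     `|u - u'| <= d -> `|v - v'| <= d ->
  normc (F u v - F u' v' - (u - u')%:C%C * A - (v - v')%:C%C * B) <= (e1 + e2) * d.
  move=> hu hv hu' hv' du dv.
  have -> : F u v - F u' v' - (u - u')%:C%C * A - (v - v')%:C%C * B =
    (F u v - F u' v - (u - u')%:C%C * A) + (F u' v - F u' v' - (v - v')%:C%C * B) by ring.
  apply: le_trans (le_normcD _ _) _; rewrite mulrDl; apply: lerD.
    by apply: le_trans (FA _ _ _ hu hv hu') _; rewrite ler_wpM2l.
  by apply: le_trans (FB _ _ _ hu' hv hv') _; rewrite ler_wpM2l.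
pose g1 u v := u - p (F u v); pose g2 u v := v - s (F u v).
have gE1 u v u' v' : g1 u v - g1 u' v' =
    - p (F u v - F u' v' - (u - u')%:C%C * A - (v - v')%:C%C * B).
  by rewrite /g1 /p !ReImE /= /D; field.
have gE2 u v u' v' : g2 u v - g2 u' v' =
    - s (F u v - F u' v' - (u - u')%:C%C * A - (v - v')%:C%C * B).
  by rewrite /g2 /s !ReImE /= /D; field.
have lip u v u' v' d : `|u| <= r -> `|v| <= r -> `|u'| <= r -> `|v'| <= r ->
     `|u - u'| <= d -> `|v - v'| <= d ->
     `|g1 u v - g1 u' v'| <= q * d /\ `|g2 u v - g2 u' v'| <= q * d.
  move=> hu hv hu' hv' du dv; have h := rem _ _ _ _ _ hu hv hu' hv' du dv.
  have d0 : 0 <= d by exact: le_trans du.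
  have fin : m * ((e1 + e2) * d) / `|D| <= q * d.
    by rewrite ler_pdivrMr // mulrA [q * d * _]mulrAC ler_wpM2r.
  by rewrite gE1 gE2 !normrN; split; [apply: le_trans (pb _ _ h) fin | apply: le_trans (sb _ _ h) fin].
have z0 : `|0 : R| <= r by rewrite normr0.
have cen1 : `|g1 0 0| <= (1 - q) * r.
  rewrite /g1 sub0r normrN; apply: le_trans (pb _ _ F0) _.
  by rewrite ler_pdivrMr.
have cen2 : `|g2 0 0| <= (1 - q) * r.
  rewrite /g2 sub0r normrN; apply: le_trans (sb _ _ F0) _.
  by rewrite ler_pdivrMr.
have [||u [v [hu hv fu fv]]] := @plane_fixed_point g1 g2 r q r0 q01.
- move=> u v hu hv.
  have := lip u v 0 0 r hu hv z0 z0; rewrite !subr0 => /(_ hu hv) [h1 h2].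
  have rE : r = q * r + (1 - q) * r by ring.
  split.
    have -> : g1 u v = (g1 u v - g1 0 0) + g1 0 0 by ring.
    by apply: le_trans (ler_normD _ _) _; rewrite [leRHS]rE; exact: lerD.
  have -> : g2 u v = (g2 u v - g2 0 0) + g2 0 0 by ring.
  by apply: le_trans (ler_normD _ _) _; rewrite [leRHS]rE; exact: lerD.
- by move=> *; exact: lip.
exists u, v; split => //.
have pF : p (F u v) = 0.
  have : u - (u - p (F u v)) = 0 by rewrite -/(g1 u v) fu subrr.
  by rewrite subKr.
have sF : s (F u v) = 0.
  have : v - (v - s (F u v)) = 0 by rewrite -/(g2 u v) fv subrr.
  by rewrite subKr.
have pD : Re (F u v) * Im B - Im (F u v) * Re B = 0.
  by move: pF; rewrite /p => /eqP; rewrite mulf_eq0 invr_eq0 (negbTE D0) orbF => /eqP.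
have sD : Im (F u v) * Re A - Re (F u v) * Im A = 0.
  by move: sF; rewrite /s => /eqP; rewrite mulf_eq0 invr_eq0 (negbTE D0) orbF => /eqP.
have reD : Re (F u v) * D = 0.
  have -> : Re (F u v) * D = Re A * (Re (F u v) * Im B - Im (F u v) * Re B) +
     Re B * (Im (F u v) * Re A - Re (F u v) * Im A) by rewrite /D; ring.
  by rewrite pD sD !mulr0 addr0.
have imD : Im (F u v) * D = 0.
  have -> : Im (F u v) * D = Im A * (Re (F u v) * Im B - Im (F u v) * Re B) +
     Im B * (Im (F u v) * Re A - Re (F u v) * Im A) by rewrite /D; ring.
  by rewrite pD sD !mulr0 addr0.
apply: complex_ext => /=.
  by move/eqP: reD; rewrite mulf_eq0 (negbTE D0) orbF => /eqP.
by move/eqP: imD; rewrite mulf_eq0 (negbTE D0) orbF => /eqP.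
Qed.

End PlaneContraction.

(** * Data near an approximate zero *)

(** The box of half-sides [2 ^ -22] in [alpha] and [2 ^ -14] in [t], around an
    approximate zero of [zeta (1 + i t, alpha)]. *)
Definition alpha_center : Z := Zpos 270477424852992.
Definition t_center : Z := Zpos 85644876288360448.
Definition alpha_width : Z := Zpos 67108864.
Definition t_width : Z := Zpos 17179869184.

(** The linear model: approximate derivatives in [t] and in [alpha]. *)
Definition dt_re : Z := Zpos 2261425578229.
Definition dt_im : Z := Zpos 253343061133068.
Definition da_re : Z := Zneg 18086670024299153.
Definition da_im : Z := Zneg 51619530682747727.

Definition cball_within (a b e : Z) (z : cball) : bool :=
  Z.leb (Z.add (Z.abs (Z.sub (creal z) a))
          (Z.add (Z.abs (Z.sub (cimag z) b)) (cradius z))) e.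

Lemma center_check : cball_within 0 0 40000000
  (zeta_eval 1000 (RBall alpha_center 0) (RBall t_center 0)).1.1.
Proof. by vm_compute. Qed.

Lemma box_check :
  let v := zeta_eval 1000 (RBall alpha_center alpha_width) (RBall t_center t_width) in
  cball_within dt_re dt_im 2923300000000 v.1.2 && cball_within da_re da_im 19799200000000 v.2.
Proof. by vm_compute. Qed.

Section ZeroOnLine.
Context {R : realType}.
Implicit Types (u v t : R).
Local Notation ZR := (@ZR R).
Let E : R := ZR unit48.
Let E0 : 0 < E. Proof. exact: ZR_gt0. Qed.

Lemma ZR_ratio_le a b c d : Z.ltb 0 b -> Z.ltb 0 d -> Z.leb (Z.mul a d) (Z.mul c b) ->
  ZR a / ZR b <= ZR c / ZR d.
Proof.
move=> /(@ZR_gt0 R) b0 /(@ZR_gt0 R) d0 /(@ZR_le R); rewrite !ZRM => h.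
by rewrite ler_pdivrMr // mulrAC ler_pdivlMr.
Qed.

Lemma cball_withinP a b e z (p : R[i]) : cball_within a b e z -> cin z p ->
  normc (p - Complex (ZR a / E) (ZR b / E)) <= ZR e / E.
Proof.
case: z => [c d r]; rewrite /cball_within [creal _]/= [cimag _]/= [cradius _]/=.
move=> /(@ZR_le R); rewrite !ZRD !ZR_abs !ZRB => he hz.
have {}hz : normc (p * E%:C%C - Complex (ZR c) (ZR d)) <= ZR r by exact: hz.
have nE : normc (E%:C%C) = E by rewrite normc_real gtr0_norm.
rewrite ler_pdivlMr // -[X in _ * X <= _]nE -Normc.normcM.
have -> : (p - Complex (ZR a / E) (ZR b / E)) * E%:C%C =
  Complex (ZR c - ZR a) (ZR d - ZR b) + (p * E%:C%C - Complex (ZR c) (ZR d)).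
  have En : E != 0 by rewrite gt_eqF.
  by clearbody E; apply: complex_ext; rewrite !ReImE /=; field.
apply: le_trans (le_normcD _ _) _; apply: le_trans he; rewrite addrA; apply: lerD => //.
exact: normc_le_abs.
Qed.

(* A unit of [u] is 1/256 of a unit of [alpha]: this makes the two partial
   derivatives comparable. *)
Definition box_alpha u : R := ZR alpha_center / E + u / 256.
Definition box_t v : R := ZR t_center / E + v.
Definition box_radius : R := ZR t_width / E.
Definition box_A : R[i] := Complex (ZR da_re / E / 256) (ZR da_im / E / 256).
Definition box_B : R[i] := Complex (ZR dt_re / E) (ZR dt_im / E).

Let c256 : ZR 256 = 256. Proof. exact: (ZR_nat 256). Qed.

Lemma box_radius_small : box_radius <= 1 / 1000.
Proof.
rewrite -(ZR_nat 1000) -ZR1; apply: ZR_ratio_le; by vm_compute.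
Qed.

Lemma box_alpha_in u : `|u| <= box_radius -> rin (RBall alpha_center alpha_width) (box_alpha u).
Proof.
move=> hu; rewrite /rin /rcenter /rradius /box_alpha -/E mulrDl divfK ?gt_eqF // addrAC subrr add0r.
rewrite mulrAC normrM -(ler_pM2r (x := 256)) // normfV [`|256|]ger0_norm ?ler0n // divfK ?pnatr_eq0 //.
rewrite normrM (gtr0_norm E0); apply: (@le_trans _ _ (box_radius * E)); first by rewrite ler_pM2r.
rewrite /box_radius divfK ?gt_eqF // -c256 -ZRM.
by apply: ZR_le; vm_compute.
Qed.

Lemma box_t_in v : `|v| <= box_radius -> rin (RBall t_center t_width) (box_t v).
Proof.
move=> hv; rewrite /rin /rcenter /rradius /box_t -/E mulrDl divfK ?gt_eqF // addrAC subrr add0r.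
rewrite normrM (gtr0_norm E0); apply: (@le_trans _ _ (box_radius * E)); first by rewrite ler_pM2r.
by rewrite /box_radius divfK ?gt_eqF.
Qed.

Lemma box_alpha_bounds u : `|u| <= box_radius -> 19 / 20 <= box_alpha u <= 1.
Proof.
move=> hu; have hr := box_radius_small; have h : `|u| <= 1 / 1000 by exact: le_trans hr.
have c1 : 96 / 100 <= ZR alpha_center / E.
  by rewrite -(ZR_nat 100) -(ZR_nat 96); apply: ZR_ratio_le; vm_compute.
have c2 : ZR alpha_center / E <= 97 / 100.
  by rewrite -(ZR_nat 100) -(ZR_nat 97); apply: ZR_ratio_le; vm_compute.
rewrite /box_alpha; move: c1 c2 h; set c := ZR _ / E; rewrite ler_norml; clearbody c; clear.
by move=> c1 c2 /andP[h1 h2]; apply/andP; split; lra.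
Qed.

Lemma box_t_bounds v : `|v| <= box_radius -> 304 <= box_t v <= 305.
Proof.
move=> hv; have hr := box_radius_small; have h : `|v| <= 1 / 1000 by exact: le_trans hr.
have c1 : 3042 / 10 <= ZR t_center / E.
  by rewrite -(ZR_nat 3042) -(ZR_nat 10); apply: ZR_ratio_le; vm_compute.
have c2 : ZR t_center / E <= 3043 / 10.
  by rewrite -(ZR_nat 3043) -(ZR_nat 10); apply: ZR_ratio_le; vm_compute.
rewrite /box_t; move: c1 c2 h; set c := ZR _ / E; rewrite ler_norml; clearbody c; clear.
by move=> c1 c2 /andP[h1 h2]; apply/andP; split; lra.
Qed.

Lemma mul_real_Complex (a x y : R) : a%:C%C * Complex x y = Complex (a * x) (a * y).
Proof. by apply: complex_ext; rewrite !ReImE /=; ring. Qed.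

Lemma box_eval u v : `|u| <= box_radius -> `|v| <= box_radius ->
  normc (hz_approx_dt 1000 (box_alpha u) (box_t v) - box_B) <= ZR 2923300000000 / E /\
  normc (hz_approx_dalpha 1000 (box_alpha u) (box_t v) - 256%:R * box_A) <= ZR 19799200000000 / E.
Proof.
move=> hu hv; have /andP[a1 a2] := box_alpha_bounds hu; have /andP[t1 t2] := box_t_bounds hv.
have a91 : 9 / 10 <= box_alpha u <= 1 by apply/andP; split; lra.
have t11 : 1 <= box_t v by lra.
have := zeta_evalP (N := 1000) a91 t11 isT (box_alpha_in hu) (box_t_in hv).
have := box_check; cbv zeta; rewrite /zeta_eval_ok.
(* Generalized, so that no conversion evaluates it again. *)
move: (zeta_eval _ _ _) => w /andP[k1 k2] [_ h1 h2].
split; first exact: (cball_withinP k1 h1).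
have -> : 256%:R * box_A = Complex (ZR da_re / E) (ZR da_im / E).
  rewrite -(rmorph_nat (real_complex R)) mul_real_Complex ![256%:R * _]mulrC.
  have n0 : (256%:R : R) != 0 by rewrite pnatr_eq0.
  by congr Complex; apply: divfK.
exact: (cball_withinP k2 h2).
Qed.

Lemma center_eval :
  normc (hz_approx 1000 (box_alpha 0) (Complex 1 (box_t 0))) <= ZR 40000000 / E.
Proof.
have r0 : `|0 : R| <= box_radius by rewrite normr0 divr_ge0 ?ZR_ge0.
have /andP[a1 a2] := box_alpha_bounds r0; have /andP[t1 t2] := box_t_bounds r0.
have a91 : 9 / 10 <= box_alpha 0 <= 1 by apply/andP; split; lra.
have t11 : 1 <= box_t 0 by lra.
have hA : rin (RBall alpha_center 0) (box_alpha 0).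
  by rewrite /rin /rcenter /rradius /box_alpha mul0r addr0 divfK ?gt_eqF // subrr normr0 ZR0.
have hT : rin (RBall t_center 0) (box_t 0).
  by rewrite /rin /rcenter /rradius /box_t addr0 divfK ?gt_eqF // subrr normr0 ZR0.
have := zeta_evalP (N := 1000) a91 t11 isT hA hT.
have := center_check; rewrite /zeta_eval_ok; move: (zeta_eval _ _ _) => w k [h _ _].
have := cball_withinP k h; rewrite ZR0 mul0r.
by rewrite (_ : Complex 0 0 = 0) // subr0.
Qed.

Lemma hz_approx_increment_t u v v' : `|u| <= box_radius -> `|v| <= box_radius ->
  `|v'| <= box_radius ->
  normc (hz_approx 1000 (box_alpha u) (Complex 1 (box_t v))
         - hz_approx 1000 (box_alpha u) (Complex 1 (box_t v')) - (v - v')%:C%C * box_B)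
  <= ZR 2923300000000 / E * `|v - v'|.
Proof.
wlog vv : v v' / v' <= v => [wl hu hv hv'|hu hv hv'].
  have [h|] := boolP (v' <= v); first exact: wl.
  rewrite -ltNge => /ltW h; rewrite distrC -normcN.
  rewrite (_ : - (_ - _ - _) = hz_approx 1000 (box_alpha u) (Complex 1 (box_t v'))
         - hz_approx 1000 (box_alpha u) (Complex 1 (box_t v)) - (v' - v)%:C%C * box_B).
    exact: wl.
  by rewrite !rmorphB; ring.
pose G x := hz_approx 1000 (box_alpha u) (Complex 1 (box_t x)) - x%:C%C * box_B.
have -> : hz_approx 1000 (box_alpha u) (Complex 1 (box_t v))
    - hz_approx 1000 (box_alpha u) (Complex 1 (box_t v')) - (v - v')%:C%C * box_B = G v - G v'.
  by rewrite /G rmorphB; ring.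
rewrite ger0_norm ?subr_ge0 //.
have inb x : v' <= x <= v -> `|x| <= box_radius.
  move=> /andP[x1 x2]; move: hv hv'; rewrite !ler_norml => /andP[? ?] /andP[? ?].
  by apply/andP; split; lra.
apply: (@Cderiv_lipschitz R G
  (fun x => hz_approx_dt 1000 (box_alpha u) (box_t x) - box_B)) => // x /inb hx; last first.
  by have [] := box_eval hu hx.
have /andP[a1 _] := box_alpha_bounds hu; have /andP[t1 _] := box_t_bounds hx.
apply: CderivB.
  have a0 : 0 < box_alpha u by lra.
  have t0 : box_t x != 0 by rewrite gt_eqF //; lra.
  have d1 := Cderiv_hz_approx_t a0 (isT : (0 < 1000)%N) t0.
  have d2 : is_derive x 1 box_t (0 + 1) := der_add (der_cst _ x) (der_id x).
  by apply: (Cderiv_eq (Cderiv_comp d1 d2)); rewrite add0r mul1r.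
apply: (Cderiv_eq (CderivM (Cderiv_real (der_id x)) (CderivC box_B x))).
by rewrite mulr0 addr0 mul1r.
Qed.

Lemma hz_approx_increment_alpha u u' v : `|u| <= box_radius -> `|u'| <= box_radius ->
  `|v| <= box_radius ->
  normc (hz_approx 1000 (box_alpha u) (Complex 1 (box_t v))
         - hz_approx 1000 (box_alpha u') (Complex 1 (box_t v)) - (u - u')%:C%C * box_A)
  <= ZR 19799200000000 / E / 256%:R * `|u - u'|.
Proof.
wlog uu : u u' / u' <= u => [wl hu hu' hv|hu hu' hv].
  have [h|] := boolP (u' <= u); first exact: wl.
  rewrite -ltNge => /ltW h; rewrite distrC -normcN.
  rewrite (_ : - (_ - _ - _) = hz_approx 1000 (box_alpha u') (Complex 1 (box_t v))
         - hz_approx 1000 (box_alpha u) (Complex 1 (box_t v)) - (u' - u)%:C%C * box_A).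
    exact: wl.
  by rewrite !rmorphB; ring.
pose G x := hz_approx 1000 (box_alpha x) (Complex 1 (box_t v)) - x%:C%C * box_A.
have -> : hz_approx 1000 (box_alpha u) (Complex 1 (box_t v))
    - hz_approx 1000 (box_alpha u') (Complex 1 (box_t v)) - (u - u')%:C%C * box_A = G u - G u'.
  by rewrite /G rmorphB; ring.
rewrite ger0_norm ?subr_ge0 //.
have inb x : u' <= x <= u -> `|x| <= box_radius.
  move=> /andP[x1 x2]; move: hu hu'; rewrite !ler_norml => /andP[? ?] /andP[? ?].
  by apply/andP; split; lra.
have n0 : (256%:R : R[i]) != 0 by rewrite pnatr_eq0.
have cE : (256%:R^-1)%:C%C = 256%:R^-1 :> R[i] by rewrite fmorphV rmorph_nat.
apply: (@Cderiv_lipschitz R G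
  (fun x => (256%:R^-1)%:C%C * (hz_approx_dalpha 1000 (box_alpha x) (box_t v) - 256%:R * box_A)))
  => // x /inb hx; last first.
  have [_ h] := box_eval hx hv.
  rewrite Normc.normcM normc_real ger0_norm ?invr_ge0 ?ler0n // mulrC.
  by rewrite ler_wpM2r ?invr_ge0 ?ler0n.
have /andP[a1 _] := box_alpha_bounds hx; have /andP[t1 _] := box_t_bounds hv.
rewrite mulrBr {2}cE [256%:R^-1 * (256%:R * _)]mulrA mulVf // mul1r.
apply: CderivB.
  have a0 : 0 < box_alpha x by lra.
  have t0 : box_t v != 0 by rewrite gt_eqF //; lra.
  have d1 := Cderiv_hz_approx_alpha a0 (isT : (0 < 1000)%N) t0.
  have d2 : is_derive x 1 box_alpha (256^-1).
    apply: (der_eq (der_add (der_cst _ x) (der_mul (der_id x) (der_cst 256^-1 x)))).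
    by rewrite mulr0 !add0r mulr1.
  exact: Cderiv_comp d1 d2.
apply: (Cderiv_eq (CderivM (Cderiv_real (der_id x)) (CderivC box_A x))).
by rewrite mulr0 addr0 mul1r.
Qed.

End ZeroOnLine.

(** * An exact zero on the line *)

Section ZetaZero.
Context {R : realType}.
Implicit Types (u v t y : R).
Local Notation ZR := (@ZR R).
Let E : R := ZR unit48.
Let E0 : 0 < E. Proof. exact: ZR_gt0. Qed.

Lemma ZR_quotient_le a c b n m (k : nat) y : ZR b <= y -> Z.ltb 0 b -> Z.ltb 0 c ->
  Z.ltb 0 m -> Z.leb 0 a ->
  Z.leb (Z.mul a m) (Z.mul n (Z.mul c (Z.pow b (Z.of_nat k)))) ->
  ZR a / ZR c * y ^- k <= ZR n / ZR m.
Proof.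
move=> hy /(@ZR_gt0 R) b0 /(@ZR_gt0 R) c0 /(@ZR_gt0 R) m0 /(@ZR_ge0 R) a0 /(@ZR_le R).
rewrite !ZRM ZR_pow => h; have y0 : 0 < y by exact: lt_le_trans hy.
apply: (@le_trans _ _ (ZR a / ZR c * ZR b ^- k)).
  apply: ler_wpM2l; first by rewrite divr_ge0 // ltW.
  rewrite lef_pV2 ?posrE ?exprn_gt0 //.
  by apply: lerXn2r; rewrite ?nnegrE // ltW.
rewrite -mulrA -invfM ler_pdivrMr ?mulr_gt0 ?exprn_gt0 //.
by rewrite mulrAC ler_pdivlMr.
Qed.

Lemma box_N_ge (a : R) : 1 / 2 <= a -> ZR 998 <= 1000%:R + a - 2^-1 - 1.
Proof.
move=> ha; have -> : 1000%:R = ZR 998 + 2 :> R.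
  by rewrite -(ZR_nat 1000) -(ZR_nat 2) -ZRD.
by move: ha; set c := ZR 998; clearbody c; clear; lra.
Qed.

Lemma box_det_le : Re (box_A (R:=R)) * Im (box_B (R:=R)) - Im (box_A (R:=R)) * Re (box_B (R:=R)) <= - (22 / 100).
Proof.
rewrite /box_A /box_B /=.
have n0 : (256 : R) != 0 by rewrite pnatr_eq0.
have En : E != 0 by rewrite gt_eqF.
have -> : ZR da_re / ZR unit48 / 256 * (ZR dt_im / ZR unit48) -
  ZR da_im / ZR unit48 / 256 * (ZR dt_re / ZR unit48) =
  (ZR da_re * ZR dt_im - ZR da_im * ZR dt_re) / (E * E * 256).
  rewrite -/E; move: En n0; move: (256 : R) E => c e e0 c0.
  move: (ZR da_re) (ZR da_im) (ZR dt_re) (ZR dt_im) => x y z w.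
  by field; rewrite e0 c0.
rewrite -(ZR_nat 22) -(ZR_nat 100) -(ZR_nat 256) -[leRHS]mulNr -ZRN -!ZRM -ZRB.
by apply: ZR_ratio_le; vm_compute.
Qed.

Lemma ZR_norm_ratio_le a b c d : Z.ltb 0 b -> Z.ltb 0 d ->
  Z.leb (Z.mul (Z.abs a) d) (Z.mul c b) -> `|ZR a / ZR b| <= ZR c / ZR d.
Proof.
move=> b0 d0 h; rewrite normrM normfV (gtr0_norm (@ZR_gt0 R _ b0)) -ZR_abs.
exact: ZR_ratio_le.
Qed.

Lemma normc_box_A : normc (box_A (R:=R)) <= 1.
Proof.
apply: le_trans (normc_le_abs _) _; rewrite /box_A /=.
rewrite -![_ / ZR unit48 / 256]mulrA -!invfM -(ZR_nat 256) -ZRM.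
have -> : (1 : R) = ZR 26 / ZR 100 + ZR 74 / ZR 100.
  by rewrite -mulrDl -ZRD divff // gt_eqF // ZR_gt0.
by apply: lerD; apply: ZR_norm_ratio_le; vm_compute.
Qed.

Lemma normc_box_B : normc (box_B (R:=R)) <= 9002 / 10000.
Proof.
rewrite -(ZR_nat 9002) -(ZR_nat 10000).
have c0 : 0 <= ZR 9002 / ZR 10000 by rewrite divr_ge0 ?ZR_ge0.
rewrite -(ler_pXn2r (n:=2)) ?nnegrE ?normc_ge0 // sqr_normcE /box_B /= !expr_div_n.
rewrite -mulrDl !expr2 -!ZRM -ZRD; apply: ZR_ratio_le; by vm_compute.
Qed.

Lemma normc_box_B_le1 : normc (box_B (R:=R)) <= 1.
Proof. by apply: le_trans normc_box_B _; lra. Qed.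

Definition box_det : R := Re (box_A (R:=R)) * Im (box_B (R:=R)) - Im (box_A (R:=R)) * Re (box_B (R:=R)).

Lemma box_det_abs : 22 / 100 <= `|box_det|.
Proof.
rewrite -normrN; apply: le_trans (ler_norm _).
by rewrite lerNr; exact: box_det_le.
Qed.

(** Deviations from linearity: that of the finite sum and that of the error. *)
Definition dev_alpha : R := ZR 19799200000000 / E / 256%:R + ZR 2 / ZR 1000 / 256%:R.
Definition dev_t : R := ZR 2923300000000 / E + ZR 16 / ZR 100000.

Lemma dev_alpha_ge0 : 0 <= dev_alpha.
Proof.
have n : (0 : R) <= 256%:R by exact: ler0n.
by apply: addr_ge0; apply: divr_ge0 => //; apply: divr_ge0; apply: ZR_ge0.
Qed.

Lemma dev_t_ge0 : 0 <= dev_t.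
Proof. by rewrite addr_ge0 // divr_ge0 ?ZR_ge0. Qed.

Lemma dev_alpha_le : dev_alpha <= 3 / 10000.
Proof.
have h1 : ZR 19799200000000 / E <= 704 / 10000.
  by rewrite -(ZR_nat 704) -(ZR_nat 10000); apply: ZR_ratio_le; vm_compute.
have h2 : ZR 2 / ZR 1000 <= 2 / 1000 by rewrite (ZR_nat 2) (ZR_nat 1000).
rewrite /dev_alpha -mulrDl; move: h1 h2; set a := ZR 19799200000000 / E; set b := ZR 2 / ZR 1000.
by clearbody a b; clear; lra.
Qed.

Lemma dev_t_le : dev_t <= 106 / 10000.
Proof.
have h1 : ZR 2923300000000 / E <= 104 / 10000.
  by rewrite -(ZR_nat 104) -(ZR_nat 10000); apply: ZR_ratio_le; vm_compute.
have h2 : ZR 16 / ZR 100000 <= 2 / 10000.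
  by rewrite -(ZR_nat 2) -(ZR_nat 10000); apply: ZR_ratio_le; vm_compute.
rewrite /dev_t; move: h1 h2; set a := ZR 2923300000000 / E; set b := ZR 16 / ZR 100000.
by clearbody a b; clear; lra.
Qed.

Lemma center_value_small : ZR 40000000 / E + ZR 59 / ZR 10000000 <=
  (1 - 1 / 20) * (box_radius / 2) * `|box_det|.
Proof.
have h1 : ZR 40000000 / E + ZR 59 / ZR 10000000 <= ZR 61 / ZR 10000000.
  have -> : ZR 61 = ZR 59 + ZR 2 by rewrite -ZRD.
  by rewrite [X in _ <= X]mulrDl addrC lerD2l; apply: ZR_ratio_le; vm_compute.
apply: le_trans h1 _.
have h2 : ZR 30500 / ZR 1000000000 <= box_radius / 2.
  by rewrite /box_radius -mulrA -invfM -(ZR_nat 2) -ZRM; apply: ZR_ratio_le; vm_compute.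
apply: (@le_trans _ _ ((1 - 1 / 20) * (ZR 30500 / ZR 1000000000) * (22 / 100))); last first.
  have p1 : 0 <= 1 - 1 / 20 :> R by lra.
  apply: ler_pM.
  - by apply: mulr_ge0 => //; rewrite divr_ge0 ?ZR_ge0.
  - by rewrite divr_ge0 ?ler0n.
  - exact: ler_wpM2l.
  - exact: box_det_abs.
have -> : (1 - 1 / 20) * (ZR 30500 / ZR 1000000000) * (22 / 100) =
  ZR (Z.mul 30500 (Z.mul 95 22)) / ZR (Z.mul 1000000000 (Z.mul 100 100)).
  rewrite !ZRM !invfM (ZR_nat 95) (ZR_nat 22) (ZR_nat 100).
  by move: (ZR 30500) (ZR 1000000000)^-1 => x y; clear; field.
by apply: ZR_ratio_le; vm_compute.
Qed.

(** Newton's iteration applies to the exact function, because it differs from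
    [hz_approx] by a small error with a small Lipschitz constant. The same bound on
    increments in [t] gives the slope at the zero; by [slope_lt] it is below
    [exp (- gamma) * pi ^ 2 / 6]. *)
Lemma zeta_zero (zeta : R -> R[i]^o -> R[i]^o) :
  (forall alpha : R, 0 < alpha <= 1 -> is_hurwitz_zeta alpha (zeta alpha)) ->
  exists alpha T, [/\ 0 < alpha <= 1, 19 / 20 <= alpha, 304 <= T <= 305 &
    forall t, `|t - T| <= box_radius / 2 ->
      normc (zeta alpha (Complex 1 t)) <= 911 / 1000 * `|t - T|].
Proof.
move=> hz.
pose r : R := box_radius.
have r0 : 0 < r by rewrite divr_gt0 ?ZR_gt0.
have rh : r / 2 <= r by lra.
pose F u v := zeta (box_alpha u) (Complex 1 (box_t v)).
pose H u v := hz_approx 1000 (box_alpha u) (Complex 1 (box_t v)).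
have inr (x : R) : `|x| <= r / 2 -> `|x| <= r by move=> h; exact: le_trans rh.
have za u : `|u| <= r -> is_hurwitz_zeta (box_alpha u) (zeta (box_alpha u)).
  by move=> /box_alpha_bounds /andP[h1 h2]; apply: hz; rewrite h2 andbT; lra.
have T0 v : `|v| <= r -> box_t v != 0 /\ `|box_t v| <= ZR 305.
  move=> /box_t_bounds /andP[h1 h2]; split; first by rewrite gt_eqF //; lra.
  by rewrite (ZR_nat 305) ger0_norm //; lra.
have e311 : ZR 305 + 6 = ZR 311 by rewrite -(ZR_nat 6) -ZRD.
have e312 : ZR 305 + 7 = ZR 312 by rewrite -(ZR_nat 7) -ZRD.
have c60000 (x : R) : x / 50 / 400 / 3 = x / ZR 60000.
  have -> : ZR 60000 = 50 * (400 * 3).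
    by rewrite -(ZR_nat 50) -(ZR_nat 400) -(ZR_nat 3) -!ZRM.
  by rewrite !invfM !mulrA.
have c1600 (x : R) : x / 400 / 4 = x / ZR 1600.
  have -> : ZR 1600 = 400 * 4 by rewrite -(ZR_nat 400) -(ZR_nat 4) -!ZRM.
  by rewrite !invfM !mulrA.
have FB u v v' : `|u| <= r -> `|v| <= r -> `|v'| <= r ->
    normc (F u v - F u v' - (v - v')%:C%C * box_B) <= dev_t * `|v - v'|.
  move=> hu hv hv'; have [n1 t1] := T0 _ hv; have [n2 t2] := T0 _ hv'.
  have /andP[a1 a2] := box_alpha_bounds hu.
  have a0 : 0 < box_alpha u by lra.
  have NN : 502 <= 1000%:R :> R by rewrite ler_nat.
  have h1 := zeta_error_lipschitz_t (za _ hu) a0 n2 n1 t2 t1 NN.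
  have h2 := hz_approx_increment_t hu hv hv'.
  have -> : F u v - F u v' - (v - v')%:C%C * box_B =
    (H u v - H u v' - (v - v')%:C%C * box_B) + ((F u v - H u v) - (F u v' - H u v')) by ring.
  apply: le_trans (le_normcD _ _) _; rewrite /dev_t mulrDl; apply: lerD; first exact: h2.
  apply: le_trans h1 _.
  have -> : box_t v - box_t v' = v - v' by rewrite /box_t; ring.
  apply: ler_wpM2r => //; rewrite e311 -(ZR_pow 311 4) c60000; apply: (ZR_quotient_le (b := 998)) => //.
  by apply: box_N_ge; lra.
have FA u u' v : `|u| <= r -> `|u'| <= r -> `|v| <= r ->
    normc (F u v - F u' v - (u - u')%:C%C * box_A) <= dev_alpha * `|u - u'|.
  move=> hu hu' hv; have [n1 t1] := T0 _ hv.
  have /andP[a1 a2] := box_alpha_bounds hu; have /andP[b1 b2] := box_alpha_bounds hu'.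
  have c0 : (0 : R) < 19 / 20 by lra.
  have h1 := zeta_error_lipschitz_alpha (za _ hu) (za _ hu') c0 a1 b1 n1 t1 (isT : (2 < 1000)%N).
  have h2 := hz_approx_increment_alpha hu hu' hv.
  have -> : F u v - F u' v - (u - u')%:C%C * box_A =
    (H u v - H u' v - (u - u')%:C%C * box_A) + ((F u v - H u v) - (F u' v - H u' v)) by ring.
  apply: le_trans (le_normcD _ _) _; rewrite /dev_alpha mulrDl; apply: lerD; first exact: h2.
  apply: le_trans h1 _.
  have -> : box_alpha u - box_alpha u' = (u - u') / 256 by rewrite /box_alpha; ring.
  rewrite normrM normfV [`|256|]ger0_norm ?ler0n // [`|_| / _]mulrC mulrA.
  apply: ler_wpM2r => //; apply: ler_wpM2r; first by rewrite invr_ge0 ler0n.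
  rewrite e312 -(ZR_pow 312 5) c1600; apply: (ZR_quotient_le (b := 998)) => //.
  by apply: box_N_ge; lra.
have z0 : `|0 : R| <= r by rewrite normr0 ltW.
have F0 : normc (F 0 0) <= ZR 40000000 / E + ZR 59 / ZR 10000000.
  have [n1 t1] := T0 _ z0; have /andP[a1 a2] := box_alpha_bounds z0.
  have a0 : 0 < box_alpha (0 : R) by apply: lt_le_trans a1; lra.
  have x12 : 1 <= (1 : R) <= 2 by rewrite lexx ler1n.
  have h := zeta_approx (za _ z0) a0 x12 n1 (isT : (1 < 1000)%N).
  have -> : F 0 0 = H 0 0 + (F 0 0 - H 0 0) by ring.
  apply: le_trans (le_normcD _ _) _; apply: lerD; first exact: center_eval.
  apply: le_trans h _.
  apply: (@le_trans _ _ (ZR (Z.pow 311 4) / ZR 1600 * (1000%:R + box_alpha (0 : R) - 2^-1 - 1) ^- 4)).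
    have aH : 1 / 2 <= box_alpha (0 : R) by apply: le_trans a1; lra.
    have hN := le_trans (ZR_ge0 (isT : Z.leb 0 998)) (box_N_ge aH).
    apply: ler_wpM2r; first by rewrite invr_ge0; apply: exprn_ge0; exact: hN.
    have -> : (1600 : R) = ZR 1600 by rewrite -(ZR_nat 1600).
    apply: ler_wpM2r; first by rewrite invr_ge0 ZR_ge0.
    rewrite (ZR_pow 311 4) -e311; apply: lerXn2r; rewrite ?nnegrE ?addr_ge0 ?ZR_ge0 ?ler0n //.
    by rewrite lerD2r.
  apply: (ZR_quotient_le (b := 998)) => //.
  by apply: box_N_ge; apply: le_trans a1; lra.
have Dp := box_det_abs.
have D0 : box_det != 0 by rewrite -normr_gt0; apply: lt_le_trans Dp.
have q01 : 0 <= (1 / 20 : R) < 1 by rewrite divr_ge0 //= ltr_pdivrMr // mul1r ltr1n.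
have B1 := normc_box_B_le1.
have r20 : 0 <= r / 2 by rewrite divr_ge0 // ltW.
have dev_small : 1 * (dev_alpha + dev_t) <= 1 / 20 * `|box_det|.
  move: (dev_alpha_le) (dev_t_le) Dp; clear.
  by move: dev_alpha dev_t `|box_det| => a b d; lra.
have [] := @newton_zero R F box_A box_B (r / 2) (1 / 20) 1 _ dev_alpha dev_t r20 q01 D0
  dev_alpha_ge0 dev_t_ge0 normc_box_A B1 F0 _ _ dev_small _.
- by move=> u v u' /inr hu /inr hv /inr hu'; exact: FA.
- by move=> u v v' /inr hu /inr hv /inr hv'; exact: FB.
- by rewrite mul1r; exact: center_value_small.
move=> u [v [hu hv Fuv]].
have hur := inr u hu; have hvr := inr v hv.
have /andP[a1 a2] := box_alpha_bounds hur.
exists (box_alpha u), (box_t v); split => //.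
- by rewrite a2 andbT; lra.
- exact: box_t_bounds.
move=> t ht; pose w := t - box_t v + v.
have tE : t = box_t w by rewrite /w /box_t; ring.
have hw : `|w| <= r.
  rewrite /w; apply: le_trans (ler_normD _ _) _; rewrite [r]splitr; exact: lerD.
have h := FB u w v hur hw hvr; rewrite Fuv subr0 /F -tE in h.
have tv : w - v = t - box_t v by rewrite /w; ring.
rewrite tv in h.
have -> : zeta (box_alpha u) (Complex 1 t) =
  (zeta (box_alpha u) (Complex 1 t) - (t - box_t v)%:C%C * box_B) + (t - box_t v)%:C%C * box_B by ring.
apply: le_trans (le_normcD _ _) _; apply: le_trans (lerD h (lexx _)) _.
rewrite Normc.normcM normc_real [`|_| * _]mulrC -mulrDl; apply: ler_wpM2r => //.
have hB := @normc_box_B.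
by move: dev_t_le hB; set x := normc _; clear; lra.
Qed.

End ZetaZero.

(** * Bounds for Euler's constant and for pi *)

Definition log2_ball : rball := rball_log artanh_coefs20 (rball_invZ 3).
Definition log_9_5_ball : rball := rball_log artanh_coefs20 (rball_mulZ 2 (rball_invZ 7)).
Definition harmonic_ball (n : nat) : rball :=
  foldr (fun k acc => rball_add (rball_invZ (Z.of_nat k)) acc) (RBall 0 0) (iota 1 n).
(** For [h], [l] and [m] that enclose the harmonic number of 64, [ln 2] and
    [ln (9 / 5)], a negative ball bounds Euler's constant by [ln (9 / 5)]. *)
Definition gamma_ball (h l m : rball) : rball :=
  rball_add (rball_add h (rball_mulZ (Zneg 6) l)) (rball_opp m).

Lemma gamma_ball_neg :
  let b := gamma_ball (harmonic_ball 64) log2_ball log_9_5_ball in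
  Z.leb (Z.add (rcenter b) (rradius b)) 0.
Proof. by vm_compute. Qed.

Lemma cos_157_pos :
  let z := cball_cis (rball_mulZ 157 (rball_invZ 100)) in Z.ltb (cradius z) (creal z).
Proof. by vm_compute. Qed.

Section Constants.
Context {R : realType}.
Local Notation ZR := (@ZR R).
Local Notation E := (ZR unit48).
Let E0 : 0 < E. Proof. exact: ZR_gt0. Qed.

(** [cos (157 / 100)] is positive, whereas the cosine is negative just after
    [pi / 2]. *)
Lemma pi_ge : 314 / 100 <= pi :> R.
Proof.
rewrite leNgt; apply/negP => hpi.
have hx : rin (rball_mulZ 157 (rball_invZ 100)) (157 / 100 : R).
  rewrite -(ZR_nat 157) -(ZR_nat 100); apply: rball_mulZP.
  exact: rball_invZP.
have := cball_cisP hx; have := cos_157_pos; cbv zeta.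
move: (cball_cis _) => z; rewrite /cin => /(@ZR_lt R) hz h.
have c0 : 0 < cos (157 / 100 : R).
  have := le_trans (abs_Re_le_normc _) h.
  rewrite !ReImE /= expR0 !mul1r mulr0 subr0 ler_norml => /andP[h1 _].
  rewrite -(pmulr_lgt0 _ E0); move: h1 hz.
  by move: (cos _ * _) => c; lra.
have pi2 := pi_ge2 R.
have s0 : 0 < sin (157 / 100 - pi / 2 : R).
  by apply: sin_gt0_pi; apply/andP; split; lra.
have : cos (157 / 100 : R) = - sin (157 / 100 - pi / 2).
  by rewrite -cosDpihalf subrK.
by move=> e; rewrite e in c0; lra.
Qed.

Definition harmonic_sub_ln (n : nat) : R := \sum_(1 <= k < n.+1) k%:R^-1 - ln n%:R.

Lemma harmonic_sub_ln_nonincreasing n :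
  harmonic_sub_ln n.+2 <= harmonic_sub_ln n.+1.
Proof.
rewrite /harmonic_sub_ln big_nat_recr //=.
have a0 : (0 : R) < n.+1%:R by rewrite ltr0n.
have b0 : (0 : R) < n.+2%:R by rewrite ltr0n.
have h := @le_ln1Dx R (- n.+2%:R^-1).
have e : 1 + - n.+2%:R^-1 = n.+1%:R / n.+2%:R :> R.
  by rewrite -[in RHS](addrK 1 n.+1%:R) natr1; field; rewrite gt_eqF.
rewrite e ln_div ?posrE // in h.
have {}h : ln n.+1%:R - ln n.+2%:R <= - n.+2%:R^-1 :> R.
  by apply: h; rewrite ltrN2 invf_lt1 // ltr1n.
by move: h; move: (ln _) (ln _) (_^-1) (\sum_(_ <= _ < _) _) => x y z w; lra.
Qed.

Lemma harmonic_sub_ln_ge0 n : 0 <= harmonic_sub_ln n.+1.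
Proof.
suff h : ln n.+2%:R <= \sum_(1 <= k < n.+2) k%:R^-1 :> R.
  rewrite subr_ge0; apply: le_trans h; rewrite ler_ln ?posrE ?ltr0n // ler_nat //.
elim: n => [|n ih].
  rewrite big_nat1 invr1 (_ : 2%:R = 1 + 1) //; apply: le_ln1Dx; lra.
rewrite big_nat_recr //=.
have b0 : (0 : R) < n.+2%:R by rewrite ltr0n.
have -> : n.+3%:R = n.+2%:R * (1 + n.+2%:R^-1) :> R.
  by rewrite mulrDr mulr1 mulfV ?gt_eqF // natr1.
rewrite lnM ?posrE ?addr_gt0 ?invr_gt0 //.
apply: lerD => //; apply: le_ln1Dx.
have i0 : 0 < n.+2%:R^-1 :> R by rewrite invr_gt0.
by move: i0; move: (_^-1) => i; lra.
Qed.

(** The defining sequence decreases from its first term on; at [n = 0] it is 0, so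
    the statement is about a shifted sequence. *)
Lemma euler_gamma_le n : euler_gamma R <= harmonic_sub_ln n.+1.
Proof.
pose u := [sequence harmonic_sub_ln n.+1]_n.
have ni : nonincreasing_seq u.
  by apply/nonincreasing_seqP => k; exact: harmonic_sub_ln_nonincreasing.
have cu : cvgn u.
  apply: nonincreasing_is_cvgn => //; exists 0 => _ [k _ <-]; exact: harmonic_sub_ln_ge0.
have -> : euler_gamma R = limn u.
  rewrite /euler_gamma; apply: cvg_lim => //.
  by rewrite -cvg_shiftS; exact: cu.
exact: nonincreasing_cvgn_ge.
Qed.

Lemma harmonic_ballP n : rin (harmonic_ball n) (\sum_(1 <= k < n.+1) k%:R^-1 : R).
Proof.
rewrite /harmonic_ball /index_iota subSS subn0.
have : all (fun k => 0 < k)%N (iota 1 n).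
  by apply/allP => k; rewrite mem_iota => /andP[].
elim: (iota 1 n) => [_|k s ih /andP[k0 ks]].
  by rewrite big_nil /rin /= mul0r ZR0 subrr normr0.
rewrite big_cons; apply: (@rball_addP _ (rball_invZ (Z.of_nat k))); last exact: ih.
by rewrite -ZR_nat; apply: rball_invZP; apply/Z.ltb_lt; lia.
Qed.

Lemma rball_log20P u (z : rball) : rin z u -> 0 <= u <= 2 / 5 ->
  rin (rball_log artanh_coefs20 z) (ln ((1 + u) / (1 - u)) : R).
Proof.
move=> hz hu; apply: (@rball_logP _ 20 _ 2 5) => //.
by rewrite ZR2 (ZR_nat 5).
Qed.

Lemma gamma_ballP (h l m : rball) (u v w : R) : rin h u -> rin l v -> rin m w ->
  rin (gamma_ball h l m) (u - 6 * v - w).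
Proof.
move=> hu hv hw; have e6 : ZR (Zneg 6) = - 6.
  by rewrite (_ : Zneg 6 = Z.opp 6) // ZRN (ZR_nat 6).
rewrite -mulNr -e6.
by apply: rball_addP (rball_oppP hw); apply: rball_addP => //; exact: rball_mulZP.
Qed.

Lemma exp_gamma_ge : 5 / 9 <= expR (- euler_gamma R).
Proof.
have g := euler_gamma_le 63.
have l2 : rin log2_ball (ln 2 : R).
  have -> : (2 : R) = (1 + (ZR 3)^-1) / (1 - (ZR 3)^-1) by rewrite (ZR_nat 3); field.
  apply: rball_log20P; first exact: rball_invZP.
  by rewrite (ZR_nat 3); apply/andP; split; lra.
have l95 : rin log_9_5_ball (ln (9 / 5) : R).
  have -> : 9 / 5 = (1 + 2 * (ZR 7)^-1) / (1 - 2 * (ZR 7)^-1) :> R.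
    by rewrite (ZR_nat 7); field.
  apply: rball_log20P; first by rewrite -ZR2; apply: rball_mulZP; exact: rball_invZP.
  by rewrite (ZR_nat 7); apply/andP; split; lra.
have := gamma_ballP (harmonic_ballP 64) l2 l95.
have := gamma_ball_neg; cbv zeta; move: (gamma_ball _ _ _) => b.
move=> /(@ZR_le R); rewrite ZRD ZR0 => hn hb.
have l64 : ln (64%:R) = 6 * ln 2 :> R.
  have -> : (64%:R : R) = 2 ^+ 6 by rewrite -natrX.
  by rewrite lnXn // mulr_natl.
have hg : euler_gamma R <= ln (9 / 5).
  apply: le_trans g _; rewrite /harmonic_sub_ln l64 -subr_le0.
  rewrite -(pmulr_lle0 _ E0).
  move: hb; rewrite /rin.
  move: (_ * E) hn => X; move: (ZR (rcenter _)) (ZR (rradius _)) => c r hn.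
  by rewrite ler_norml => /andP[_ h]; lra.
have -> : 5 / 9 = expR (- ln (9 / 5)) :> R.
  by rewrite expRN lnK ?posrE ?divr_gt0 ?ltr0n // invf_div.
by rewrite ler_expR lerN2.
Qed.

Lemma slope_lt : 911 / 1000 / 4 <= expR (- euler_gamma R) * pi ^+ 2 / 24 :> R.
Proof.
have := pi_ge; have := exp_gamma_ge; move: (expR _) (pi : R) => g p hg hp.
have h : 5 / 9 * (314 / 100) ^+ 2 <= g * p ^+ 2 by rewrite !expr2; nra.
by move: h; move: (g * _) => x; rewrite expr2; lra.
Qed.

End Constants.

(** * The upper bound *)

Section UpperBound.
Context {R : realType}.
Implicit Types (alpha T d t : R).
Local Notation mu := (@lebesgue_measure R).

Lemma integral_normc_le alpha f a b (g : R -> R) : is_hurwitz_zeta alpha f -> 0 < a ->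
  continuous g -> (forall t, a <= t <= b -> normc (f (Complex 1 t)) <= g t) ->
  (\int[mu]_(t in `[a, b]) (normc (f (Complex 1 t)))%:E <= (segint a b g)%:E)%E.
Proof.
move=> hf a0 cg hg; rewrite -integral_segint //.
have mf : measurable_fun `[a, b] (fun t => normc (f (Complex 1 t))).
  apply: (measurable_zeta_line 1 hf); first exact: measurable_itv.
  by rewrite /= in_itv /= leNgt a0.
apply: ge0_le_integral => //.
- by move=> t _; rewrite lee_fin normc_ge0.
- exact/measurable_EFinP.
- by apply/measurable_EFinP; apply: measurable_funTS; apply: continuous_measurable_fun.
Qed.

Lemma line1_integral_le_cone alpha f T d (s : R) : is_hurwitz_zeta alpha f -> 0 < d -> d < T ->
  (forall t, `|t - T| <= d / 2 -> normc (f (Complex 1 t)) <= s * `|t - T|) ->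
  (line1_integral f d (T - d / 2) <= (s / 4 * d ^+ 2)%:E)%E.
Proof.
move=> hf d0 dT hs; rewrite /line1_integral.
have -> : T - d / 2 + d = T + d / 2 by field.
set a := T - d / 2; set b := T + d / 2.
have aT : a < T by rewrite /a; lra.
have Tb : T < b by rewrite /b; lra.
have a0 : 0 < a by rewrite /a; lra.
have split_ab : `[a, b]%classic = `[a, T]%classic `|` `]T, b]%classic.
  by rewrite -itv_bndbnd_setU // bnd_simp; exact: ltW.
have mf : measurable_fun `[a, b] (fun t => normc (f (Complex 1 t))).
  apply: (measurable_zeta_line 1 hf); first exact: measurable_itv.
  by rewrite /= in_itv /= leNgt a0.
have der (c : R) t : is_derive t 1 (fun t => c / 2 * (t - T) ^+ 2) (c * (t - T)).
  apply: (der_eq (der_scale (c / 2) (der_pow 1 (der_sub (der_id t) (der_cst T t))))).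
  by field.
have cont (c : R) : continuous (fun t => c * (t - T)).
  apply: (@der_continuous R _ (fun=> c)) => t.
  by apply: (der_eq (der_scale c (der_sub (der_id t) (der_cst T t)))); ring.
have left_le : (\int[mu]_(t in `[a, T]) (normc (f (Complex 1 t)))%:E <= (s / 8 * d ^+ 2)%:E)%E.
  apply: le_trans (@integral_normc_le alpha f a T (fun t => - s * (t - T)) hf a0 (cont _) _) _.
    move=> t /andP[t1 t2]; apply: le_trans (hs t _) _.
      by rewrite ler0_norm; rewrite /a in t1; lra.
    by rewrite ler0_norm; [rewrite mulNr mulrN | lra].
  rewrite (segint_FTC aT (cont _) (der (- s))) /a lee_fin le_eqVlt; apply/orP; left; apply/eqP.
  by field.
have right_le : (\int[mu]_(t in `]T, b]) (normc (f (Complex 1 t)))%:E <= (s / 8 * d ^+ 2)%:E)%E.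
  apply: (@le_trans _ _ (\int[mu]_(t in `[T, b]) (normc (f (Complex 1 t)))%:E)%E).
    apply: ge0_subset_integral => //.
    - apply/measurable_EFinP; apply: measurable_funS mf => // t /=; rewrite !in_itv /= => /andP[t1 t2].
      by rewrite t2 (ltW (lt_le_trans aT t1)).
    - by move=> t _; rewrite lee_fin normc_ge0.
    - by move=> t /=; rewrite !in_itv /= => /andP[/ltW -> ->].
  have T0 : 0 < T by lra.
  apply: le_trans (@integral_normc_le alpha f T b (fun t => s * (t - T)) hf T0 (cont _) _) _.
    move=> t /andP[t1 t2]; apply: le_trans (hs t _) _.
      by rewrite ger0_norm; rewrite /b in t2; lra.
    by rewrite ger0_norm; [ | lra].
  rewrite (segint_FTC Tb (cont _) (der s)) /b lee_fin le_eqVlt; apply/orP; left; apply/eqP.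
  by field.
rewrite split_ab ge0_integral_setU //.
- have -> : s / 4 * d ^+ 2 = s / 8 * d ^+ 2 + s / 8 * d ^+ 2 by field.
  by rewrite EFinD; exact: leeD.
- by rewrite -split_ab; exact/measurable_EFinP.
- by move=> t _; rewrite lee_fin normc_ge0.
- apply/disj_setPS => t [] /=; rewrite !in_itv /= => /andP[_ h1] /andP[h2 _].
  by rewrite ltNge h1 in h2.
Qed.

Lemma line_bound_anti a alpha h t : 0 < a -> a <= alpha ->
  line_bound alpha h t <= line_bound a h t.
Proof.
move=> a0 aa; rewrite /line_bound -!addrA lerD2r ler_wpM2l //.
rewrite lef_pV2 ?posrE ?exprn_gt0 //; last exact: lt_le_trans aa.
by apply: lerXn2r; rewrite ?nnegrE // ltW //; exact: lt_le_trans aa.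
Qed.

Lemma line1_integral_le_bound alpha f T d : is_hurwitz_zeta alpha f ->
  0 < alpha <= 1 -> 19 / 20 <= alpha -> 0 < d -> 1 <= T -> T + d <= 306 ->
  (line1_integral f d T <= (line_bound (19 / 20) 1 306 * d)%:E)%E.
Proof.
move=> hf a01 a19 d0 T1 Td; rewrite /line1_integral.
have T0 : 0 < T by lra.
set K := line_bound _ _ _.
have cK : continuous (fun _ : R => K : R) by move=> x; exact: cvg_cst.
apply: le_trans (@integral_normc_le alpha f T (T + d) (fun=> K) hf T0 cK _) _.
  move=> t /andP[t1 t2]; have ht : t = `|t| by rewrite ger0_norm //; lra.
  apply: le_trans (@zeta_line_bound R alpha f 1 t 1 306 hf a01 _ _ _) _.
  - by rewrite lexx ler1n.
  - by rewrite -ht ltr01; lra.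
  - by rewrite -ht; lra.
  by apply: line_bound_anti => //; lra.
rewrite segint_cst; last by lra.
by have -> : T + d - T = d by ring.
Qed.

End UpperBound.

Theorem theorem29 (R : realType) :
  exists C : R, forall zeta : R -> R[i]^o -> R[i]^o,
    (forall alpha : R, 0 < alpha <= 1 -> is_hurwitz_zeta alpha (zeta alpha)) ->
    forall delta : R, 0 < delta <= 5%:R / 100%:R ->
      let J : \bar R :=
        ereal_inf [set ereal_inf [set line1_integral (zeta alpha) delta T
                                 | T in [set: R]]
                  | alpha in [set a : R | 0 < a <= 1]] in
      ((delta `^ (7%:R / (6%:R * delta)) * 10%:R `^ (- (9%:R / delta)))%:E
         <= J)%E
      /\ (J <= (expR (- euler_gamma R) * pi ^+ 2 / 24%:R * delta ^+ 2
               + C * delta ^+ 4)%:E)%E.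
Proof.
pose K : R := line_bound (19 / 20) 1 306; pose r : R := box_radius.
have r0 : 0 < r by rewrite divr_gt0 ?ZR_gt0.
have K0 : 0 <= K by apply: line_bound_ge0; rewrite ?divr_ge0 ?ler0n.
exists (K / r ^+ 3) => zeta hz d hd J; have /andP[d0 d1] := hd; split.
  apply: le_ereal_inf_tmp => _ /= [alpha a01 <-].
  apply: le_ereal_inf_tmp => _ /= [T _ <-].
  exact: (line1_integral_ge T (hz _ a01) a01 hd).
have [alpha [T [a01 a19 /andP[T1 T2] hs]]] := zeta_zero hz.
have d2 : d <= 1 by apply: le_trans d1 _; rewrite ler_pdivrMr // mul1r ler_nat.
have Jle : (J <= line1_integral (zeta alpha) d (T - d / 2))%E.
  apply: (@le_trans _ _ (ereal_inf [set line1_integral (zeta alpha) d T | T in [set: R]])).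
    by apply: ereal_inf_lbound; exists alpha.
  by apply: ereal_inf_lbound; exists (T - d / 2).
apply: le_trans Jle _.
have C0 : 0 <= K / r ^+ 3 * d ^+ 4.
  by rewrite mulr_ge0 ?divr_ge0 ?exprn_ge0 // ltW.
have main0 : 911 / 1000 / 4 * d ^+ 2 <= expR (- euler_gamma R) * pi ^+ 2 / 24%:R * d ^+ 2.
  by apply: ler_wpM2r; [exact: sqr_ge0 | exact: slope_lt].
(* Below [r] the interval stays where the zero controls the modulus; above, the
   term in [d ^ 4] exceeds any bound that is linear in [d]. *)
have [dr|rd] := leP d r.
  apply: (@le_trans _ _ (911 / 1000 / 4 * d ^+ 2)%:E).
    apply: line1_integral_le_cone (hz _ a01) d0 _ _; first by lra.
    by move=> t ht; apply: hs; apply: le_trans ht _; rewrite ler_wpM2r // invr_ge0.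
  by rewrite lee_fin; apply: le_trans main0 _; rewrite lerDl.
have t1 : 1 <= T - d / 2 by move: T1 d2; clear; lra.
have t2 : T - d / 2 + d <= 306 by move: T2 d2; clear; lra.
apply: le_trans (line1_integral_le_bound (hz _ a01) a01 a19 d0 t1 t2) _.
rewrite lee_fin; apply: (@le_trans _ _ (K / r ^+ 3 * d ^+ 4)).
  have -> : K / r ^+ 3 * d ^+ 4 = K * d * (d ^+ 3 / r ^+ 3) by ring.
  rewrite -/K ler_peMr ?mulr_ge0 // ?(ltW d0) // ler_pdivlMr ?exprn_gt0 // mul1r.
  by apply: lerXn2r; rewrite ?nnegrE ltW.
rewrite lerDr; apply: le_trans main0; apply: mulr_ge0 (sqr_ge0 d).
by rewrite !divr_ge0 ?ler0n.
Qed.
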